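(* Let $n$ be an integer of the form $n=3^{k_1}+3^{k_2}+3^{k_3}$ with integers $k_1>k_2>k_3\geq 0$, and let $E_n/F_n$ be the general field extension of degree $n$ over the base field $\mathbb{Q}$. For every finite field extension $F'/F_n$ of degree prime to $3$, there does not exist $0\neq\delta\in E':=F'\otimes_{F_n}E_n$ such that $\operatorname{Tr}_{E'/F'}(\delta)=\operatorname{Tr}_{E'/F'}(\delta^3)=0$. In particular, there does not exist $0\neq\delta\in E_n$ such that $\operatorname{Tr}_{E_n/F_n}(\delta)=\operatorname{Tr}_{E_n/F_n}(\delta^3)=0$.
   Context: For an integer $n\geq 2$, the general field extension $E_n/F_n$ of degree $n$ over the base field $\mathbb{Q}$ is defined as follows. Let $x_1,\ldots,x_n$ be independent variables and $L_n:=\mathbb{Q}(x_1,\ldots,x_n)$. The symmetric group $S_n$ acts on $L_n$ by permuting $x_1,\ldots,x_n$, and $S_{n-1}$ acts on $L_n$ by permuting $x_2,\ldots,x_n$. Set $F_n:=L_n^{S_n}$ and $E_n:=L_n^{S_{n-1}}=F_n(x_1)$. For a finite-dimensional commutative algebra $E'$ over a field $F'$, $\operatorname{Tr}_{E'/F'}(\delta)$ denotes the trace of the $F'$-linear map $E'\to E'$ given by multiplication by $\delta$. *)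

(* Defs.v *)
From HB Require Import structures.
From mathcomp Require Import all_boot all_order all_fingroup all_algebra all_field.
From mathcomp Require Import mpoly generic_quotient.

Set Implicit Arguments.
Unset Strict Implicit.
Unset Printing Implicit Defensive.

Import GRing.Theory.

Local Open Scope ring_scope.
Local Open Scope quotient_scope.

(* The variables are indexed by 'I_n, so that x_1 is the variable of index 0. *)
Notation ratfun n := {fraction {mpoly rat[n]}}.

Section Action.

Variable n : nat.
Implicit Types (s t : 'S_n) (x y : ratfun n) (p q : {mpoly rat[n]}).

Lemma ratfun_numden x :
  x = tofrac \n_(repr x) / tofrac \d_(repr x).
Proof.
have d0 : tofrac \d_(repr x) != 0 by rewrite tofrac_eq0 denom_ratioP.
apply: (mulIf d0); rewrite divfK //.
move: (repr x) (reprK x) => y <-; unlock FracField.tofrac.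
rewrite -[LHS](FracField.pi_mul); apply/eqmodP => /=.
by rewrite FracField.equivfE /FracField.mulf !numden_Ratio
  ?mulr1 ?oner_eq0 ?denom_ratioP ?mulf_neq0 ?oner_eq0 ?denom_ratioP // mulrC.
Qed.

Definition var (i : 'I_n) : ratfun n := tofrac 'X_i.

Definition perm_act s x : ratfun n :=
  tofrac (msym s \n_(repr x)) / tofrac (msym s \d_(repr x)).

Lemma msym_eq0 s p : (msym s p == 0) = (p == 0).
Proof. exact: (raddf_eq0 _ (@inj_msym _ _ s)). Qed.

Lemma perm_act_frac s p q : q != 0 ->
  perm_act s (tofrac p / tofrac q) = tofrac (msym s p) / tofrac (msym s q).
Proof.
move=> q0; rewrite /perm_act; move: (ratfun_numden (tofrac p / tofrac q)).
case: (repr _) => -[a b] /= b0 /eqP.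
rewrite eqr_div ?tofrac_eq0 // -!tofracM tofrac_eq => /eqP E.
by apply/eqP; rewrite eqr_div ?tofrac_eq0 ?msym_eq0 // -!tofracM -!msymM E.
Qed.

Lemma perm_act_tofrac s p : perm_act s (tofrac p) = tofrac (msym s p).
Proof.
have := perm_act_frac s p (oner_neq0 _).
by rewrite msym1 !rmorph1 !divr1.
Qed.

Lemma perm_act_var s i : perm_act s (var i) = var (s i).
Proof.
rewrite perm_act_tofrac msymX; congr (tofrac 'X_[_]).
by apply/mnmP => j; rewrite !mnmE; congr (nat_of_bool _); apply/eqP/eqP => [->|<-];
   rewrite ?permKV ?permK.
Qed.

Lemma ratfunP x : exists p q, q != 0 /\ x = tofrac p / tofrac q.
Proof.
exists \n_(repr x), \d_(repr x).
by rewrite denom_ratioP -ratfun_numden.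
Qed.

Fact perm_act_zmod_morphism s : zmod_morphism (perm_act s).
Proof.
move=> x y; have [a [b [b0 ->]]] := ratfunP x; have [c [d [d0 ->]]] := ratfunP y.
have subE (a1 b1 c1 d1 : {mpoly rat[n]}) : b1 != 0 -> d1 != 0 ->
    tofrac a1 / tofrac b1 - tofrac c1 / tofrac d1
    = tofrac (a1 * d1 - c1 * b1) / tofrac (b1 * d1).
  by move=> b10 d10; rewrite -mulNr addf_div ?tofrac_eq0 // mulNr -!tofracM -tofracB.
rewrite subE // !perm_act_frac ?mulf_neq0 // subE ?msym_eq0 //.
by rewrite msymB !msymM.
Qed.

HB.instance Definition _ s :=
  GRing.isZmodMorphism.Build _ _ (perm_act s) (perm_act_zmod_morphism s).

Fact perm_act_monoid_morphism s : monoid_morphism (perm_act s).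
Proof.
split=> [|x y]; first by rewrite -(rmorph1 (@tofrac _)) perm_act_tofrac msym1.
have [a [b [b0 ->]]] := ratfunP x; have [c [d [d0 ->]]] := ratfunP y.
rewrite mulf_div -!tofracM !perm_act_frac ?mulf_neq0 //.
by rewrite mulf_div -!tofracM -!msymM.
Qed.

HB.instance Definition _ s :=
  GRing.isMonoidMorphism.Build _ _ (perm_act s) (perm_act_monoid_morphism s).

Lemma perm_act1 x : perm_act 1%g x = x.
Proof. by rewrite /perm_act !msym1m -ratfun_numden. Qed.

Lemma perm_actM s t x : perm_act (s * t)%g x = perm_act t (perm_act s x).
Proof.
have [p [q [q0 ->]]] := ratfunP x.
by rewrite !perm_act_frac ?msym_eq0 ?denom_ratioP // !msymMm.
Qed.

End Action.

Section FixedField.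

Variables (L : fieldType) (I : finType) (act : I -> {rmorphism L -> L}).
Implicit Types (G : {set I}).

Definition fixed_pred G : {pred L} := [pred x | [forall s in G, act s x == x]].

Lemma fixedP G x : reflect {in G, forall s, act s x = x} (x \in fixed_pred G).
Proof. by apply: (iffP forall_inP) => h s /h /eqP. Qed.

Fact fixed_divring_closed G : divring_closed (fixed_pred G).
Proof.
split=> [|x y /fixedP hx /fixedP hy|x y /fixedP hx /fixedP hy];
  apply/fixedP => s sG.
- exact: rmorph1.
- by rewrite rmorphB hx ?hy.
- by rewrite fmorph_div hx ?hy.
Qed.

HB.instance Definition _ G :=
  GRing.isDivringClosed.Build L (fixed_pred G) (fixed_divring_closed G).

Record fixed G := Fixed { fixed_val :> L; fixed_valP : fixed_val \in fixed_pred G }.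

HB.instance Definition _ G := [isSub for @fixed_val G].
HB.instance Definition _ G := [Choice of fixed G by <:].
HB.instance Definition _ G := [SubChoice_isSubIntegralDomain of fixed G by <:].
HB.instance Definition _ G := [SubIntegralDomain_isSubField of fixed G by <:].

HB.instance Definition _ G :=
  GRing.RMorphism.copy (@fixed_val G) (val : fixed G -> L).

Lemma fixed_actE G (u : fixed G) s : s \in G -> act s (fixed_val u) = fixed_val u.
Proof. exact/fixedP/fixed_valP. Qed.

Variable G : {set I}.
Local Notation F := (fixed [set: I]).
Local Notation E := (fixed G).

Fact fixed_scale_subproof (a : F) (u : E) :
  fixed_val a * fixed_val u \in fixed_pred G.
Proof. by apply/fixedP => s sG; rewrite rmorphM !fixed_actE ?inE. Qed.

Definition fixed_scale (a : F) (u : E) : E := Fixed (fixed_scale_subproof a u).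

Fact fixed_scaleA a b u : fixed_scale a (fixed_scale b u) = fixed_scale (a * b) u.
Proof. by apply: val_inj; rewrite /= mulrA. Qed.
Fact fixed_scale1 : left_id 1 fixed_scale.
Proof. by move=> u; apply: val_inj; rewrite /= mul1r. Qed.
Fact fixed_scaleDr : right_distributive fixed_scale +%R.
Proof. by move=> a u v; apply: val_inj; rewrite /= mulrDr. Qed.
Fact fixed_scaleDl u : {morph fixed_scale^~ u : a b / a + b}.
Proof. by move=> a b; apply: val_inj; rewrite /= mulrDl. Qed.

HB.instance Definition _ := GRing.Zmodule_isLmodule.Build F E
  fixed_scaleA fixed_scale1 fixed_scaleDr fixed_scaleDl.

Fact fixed_scaleAl (a : F) (u v : E) : a *: (u * v) = (a *: u) * v.
Proof. by apply: val_inj; rewrite /= mulrA. Qed.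
HB.instance Definition _ := GRing.Lmodule_isLalgebra.Build F E fixed_scaleAl.

Fact fixed_scaleAr (a : F) (u v : E) : a *: (u * v) = u * (a *: v).
Proof. by apply: val_inj; rewrite /= mulrCA. Qed.
HB.instance Definition _ := GRing.Lalgebra_isAlgebra.Build F E fixed_scaleAr.

End FixedField.

(* The copy of S_(n-1) permuting x_2, ..., x_n only. *)
Definition stab0 n : {set 'S_n} := Sym [set i : 'I_n | (0 < i)%N].

(* Each e in E_n is P(x_1) for a unique P over F_n of size at most n: P is the
   Lagrange polynomial interpolating the conjugates of e at the x_i. *)
Section Interpolation.

Variables (L : fieldType) (m : nat).
Local Notation n := m.+1.
Variables (act : 'S_n -> {rmorphism L -> L}) (X : 'I_n -> L).
Hypothesis actM : forall s t x, act (s * t)%g x = act t (act s x).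
Hypothesis actX : forall s i, act s (X i) = X (s i).
Hypothesis X_inj : injective X.

Local Notation F := (fixed act [set: 'S_n]).
Local Notation E := (fixed act (stab0 n)).

Fact stab0P (s : 'S_n) : (s \in stab0 n) = (s ord0 == ord0).
Proof.
rewrite inE; apply/idP/eqP => [s_on|s0].
  by rewrite (out_perm s_on) // inE.
apply/subsetP => i; rewrite !inE lt0n; apply: contraNneq => i0.
by rewrite (_ : i = ord0) ?s0 //; apply: val_inj.
Qed.

Let conj (e : L) (i : 'I_n) := act (tperm ord0 i) e.

Let conj0 e : e \in fixed_pred act (stab0 n) -> conj e ord0 = e.
Proof. by move=> /fixedP; apply; rewrite stab0P tpermL. Qed.

Let act_fixed e s : e \in fixed_pred act (stab0 n) -> act s e = conj e (s ord0).
Proof.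
move=> /fixedP he; rewrite /conj; set t := tperm _ _.
have -> : s = ((s * t) * t)%g by rewrite -mulgA tperm2 mulg1.
by rewrite actM he // stab0P permM tpermR.
Qed.

Let act_conj e s i : e \in fixed_pred act (stab0 n) ->
  act s (conj e i) = conj e (s i).
Proof. by move=> he; rewrite /conj -actM act_fixed // permM tpermL. Qed.

Let lag (i : 'I_n) : {poly L} :=
  \prod_(j | j != i) ((X i - X j)^-1 *: ('X - (X j)%:P)).

Let lagE i k : (lag i).[X k] = (i == k)%:R.
Proof.
rewrite horner_prod; case: eqP => [<-|/eqP ik]; last first.
  by rewrite (bigD1 k) 1?eq_sym //= !hornerE subrr mulr0 mul0r.
rewrite big1 // => j ji; rewrite !hornerE mulVf //.
by rewrite subr_eq0 (inj_eq X_inj) eq_sym.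
Qed.

Let size_lag i : (size (lag i) <= n)%N.
Proof.
apply: leq_trans (size_prod_leq _ _) _.
have -> : (\sum_(j | j != i) size ((X i - X j)^-1 *: ('X - (X j)%:P)) =
           2 * #|[pred j | j != i]|)%N.
  rewrite mulnC -sum_nat_const; apply: eq_bigr => j ji.
  by rewrite size_scale ?size_XsubC // invr_eq0 subr_eq0 (inj_eq X_inj) eq_sym.
have -> : #|[pred j | j != i]| = m.
  by have := cardC1 i; rewrite card_ord => E; rewrite -[RHS]E; apply: eq_card => j; rewrite !inE.
by rewrite mul2n -addnn subSn ?leq_addl // addnK.
Qed.

Let interp (e : L) : {poly L} := \sum_i conj e i *: lag i.

Let size_interp e : (size (interp e) <= n)%N.
Proof.
rewrite /interp; apply: (leq_trans (size_sum _ _ _)); apply/bigmax_leqP => i _.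
exact: leq_trans (size_scale_leq _ _) (size_lag _).
Qed.

Let interpE e i : (interp e).[X i] = conj e i.
Proof.
rewrite /interp horner_sum (bigD1 i) //= hornerZ lagE eqxx mulr1 big1 ?addr0 //.
by move=> j ji; rewrite hornerZ lagE (negPf ji) mulr0.
Qed.

Let interp_uniq e (p : {poly L}) : (size p <= n)%N ->
  (forall i, p.[X i] = conj e i) -> p = interp e.
Proof.
move=> sp hp; apply/eqP; rewrite -subr_eq0; apply/negPn/negP => nz.
have roots : all (root (p - interp e)) [seq X i | i <- enum 'I_n].
  apply/allP => _ /mapP[i _ ->].
  by rewrite rootE hornerD hornerN hp interpE subrr.
have := max_poly_roots nz roots.
rewrite map_inj_uniq // enum_uniq size_map size_enum_ord => /(_ isT).
apply/negP; rewrite -leqNgt.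
by rewrite (leq_trans (size_polyD _ _)) // size_polyN geq_max sp size_interp.
Qed.

Let interp_fixed (e : E) k : (interp (fixed_val e))`_k \in fixed_pred act [set: 'S_n].
Proof.
have he := fixed_valP e; apply/fixedP => s _.
rewrite -coef_map.
suff -> : map_poly (act s) (interp (fixed_val e)) = interp (fixed_val e) by [].
apply: interp_uniq => [|i].
  by rewrite size_map_poly.
have -> : X i = act s (X (s^-1 i)%g) by rewrite actX permKV.
by rewrite horner_map interpE act_conj // permKV.
Qed.

Let v2r (e : E) : 'rV[F]_n := \row_k Fixed (interp_fixed e k).

Let x1_subproof : X ord0 \in fixed_pred act (stab0 n).
Proof. by apply/fixedP => s; rewrite stab0P actX => /eqP ->. Qed.

Let x1 : E := Fixed x1_subproof.

Let r2v (c : 'rV[F]_n) : E := \sum_k c 0 k *: x1 ^+ k.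

Let fixed_valX k : fixed_val (x1 ^+ k) = X ord0 ^+ k.
Proof. exact: rmorphXn. Qed.

Let r2vE c : fixed_val (r2v c) = (\poly_(k < n) fixed_val (c 0 (inord k))).[X ord0].
Proof.
rewrite /r2v raddf_sum horner_poly.
by apply: eq_bigr => k _; rewrite /= fixed_valX inord_val.
Qed.

Lemma interp_linear : linear v2r.
Proof.
move=> a u v; apply/rowP => k; apply: val_inj; rewrite !mxE /=.
suff -> : interp (fixed_val a * fixed_val u + fixed_val v) =
  fixed_val a *: interp (fixed_val u) + interp (fixed_val v) by rewrite coefD coefZ.
apply/esym/interp_uniq => [|i].
  rewrite (leq_trans (size_polyD _ _)) // geq_max size_interp andbT.
  exact: leq_trans (size_scale_leq _ _) (size_interp _).
by rewrite hornerD hornerZ !interpE /conj rmorphD rmorphM (fixed_actE a) ?inE.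
Qed.

Lemma interp_bij : bijective v2r.
Proof.
exists r2v => [e|c].
  apply: val_inj; rewrite /= r2vE.
  have -> : \poly_(k < n) fixed_val ((v2r e) 0 (inord k)) = interp (fixed_val e).
    apply/polyP => k; rewrite coef_poly; case: ltnP => kn.
      by rewrite mxE /= inordK.
    by rewrite nth_default // (leq_trans (size_interp _)).
  by rewrite interpE conj0 // fixed_valP.
apply/rowP => k; apply: val_inj; rewrite mxE /= r2vE.
rewrite -(@interp_uniq _ (\poly_(k < n) fixed_val (c 0 (inord k)))) ?size_poly //.
  by rewrite coef_poly ltn_ord inord_val.
move=> i; rewrite /conj -horner_map actX tpermL; congr (_.[_]).
apply/polyP => j; rewrite coef_map !coef_poly; case: ifP => _.
  by apply/esym/fixed_actE; rewrite inE.
exact/esym/rmorph0.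
Qed.

Lemma fixed_vector_axiom_S : Vector.axiom n E.
Proof. by exists v2r; [exact: interp_linear|exact: interp_bij]. Qed.

End Interpolation.

Fact fixed_vector_axiom_0 (L : fieldType) (act : 'S_0 -> {rmorphism L -> L}) :
  Vector.axiom 1 (fixed act (stab0 0)).
Proof.
have eqG : stab0 0 = [set: 'S_0].
  by apply/setP => s; rewrite !inE; apply/subsetP => -[].
rewrite eqG; exists (fun e => const_mx e) => [a u v|].
  by apply/rowP => k; rewrite !mxE; apply: val_inj.
exists (fun c : 'rV_1 => c 0 0) => [e|c]; first by rewrite mxE.
by apply/rowP => k; rewrite mxE ord1.
Qed.

Section GeneralExtension.

Variable n : nat.

Fact var_inj : injective (@var n).
Proof.
move=> i j /eqP; rewrite tofrac_eq => /eqP /(congr1 (mcoeff U_(i)%MM)).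
rewrite !mcoeffX eqxx; case: eqP => [/mnmP/(_ i)|_ /eqP]; last by rewrite oner_eq0.
by rewrite !mnm1E eqxx; case: eqVneq.
Qed.

Definition ratfun_aut (s : 'S_n) : {rmorphism ratfun n -> ratfun n} := perm_act s.

Definition Fn := fixed ratfun_aut [set: 'S_n].
HB.instance Definition _ := GRing.Field.on Fn.

Definition En := fixed ratfun_aut (stab0 n).
HB.instance Definition _ := GRing.Field.on En.
HB.instance Definition _ := GRing.Zmodule_isLmodule.Build Fn En
  (@fixed_scaleA _ _ _ _) (@fixed_scale1 _ _ _ _) (@fixed_scaleDr _ _ _ _)
  (@fixed_scaleDl _ _ _ _).
HB.instance Definition _ := GRing.Lmodule_isLalgebra.Build Fn En (@fixed_scaleAl _ _ _ _).
HB.instance Definition _ := GRing.Lalgebra_isComAlgebra.Build Fn En.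

End GeneralExtension.

(* n.-1.+1 is n, except that E_0 = F_0 has dimension 1. *)
Fact En_vector_axiom n : Vector.axiom n.-1.+1 (En n).
Proof.
case: n => [|m]; first exact: fixed_vector_axiom_0.
apply: (@fixed_vector_axiom_S _ _ _ (@var m.+1)) => [s t x|s i|].
- exact: perm_actM.
- exact: perm_act_var.
- exact: var_inj.
Qed.

HB.instance Definition _ n := Lmodule_hasFinDim.Build (Fn n) (En n) (En_vector_axiom n).

Lemma dim_En n : (0 < n)%N -> \dim {:En n} = n.
Proof. by rewrite dimvf; case: n. Qed.

(* K (x)_F E is presented as the K-vector space with basis the elements
   1 (x) b_i, for (b_i) a basis of E over F, and multiplication table that of
   the b_i.  It is a commutative K-algebra, and tensor_univ shows that, with the
   two maps x |-> x *: 1 and tensor_inr, it is the pushout of K and E over F. *)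

Section Tensor.

Variables (F : fieldType) (K E : fieldExtType F).
Local Notation n := (\dim {:E}).
Local Notation b := (vbasis {:E}).
Local Notation b_ i := ((b : seq E)`_(i : 'I_n)).

Definition tensor := 'rV[K]_n.

HB.instance Definition _ := GRing.Lmodule.on tensor.
HB.instance Definition _ := Vector.on tensor.

Implicit Types (u v w : tensor) (x y : E).

Definition tensor_inr x : tensor := \row_i (coord b i x)%:A.

Definition tensor_mul u v : tensor :=
  \sum_i \sum_j (u 0 i * v 0 j) *: tensor_inr (b_ i * b_ j).

Definition tensor_one : tensor := tensor_inr 1.

Let bE x : x = \sum_i coord b i x *: b_ i.
Proof. exact: coord_vbasis (memvf x). Qed.

Fact tensor_inr_zmod_morphism : zmod_morphism tensor_inr.
Proof. by move=> x y; apply/rowP => i; rewrite !mxE linearB scalerBl. Qed.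

HB.instance Definition _ :=
  GRing.isZmodMorphism.Build E tensor tensor_inr tensor_inr_zmod_morphism.

Lemma tensor_inrZ (a : F) x : tensor_inr (a *: x) = a%:A *: tensor_inr x.
Proof.
by apply/rowP => i; rewrite !mxE linearZ /= -scalerAl mul1r scalerA.
Qed.

Let tensorE u : u = \sum_i u 0 i *: tensor_inr (b_ i).
Proof.
apply/rowP => j; rewrite summxE (bigD1 j) //= !mxE coord_free ?(basis_free (vbasisP _)) //.
rewrite eqxx scale1r mulr1 big1 ?addr0 // => i ij.
by rewrite !mxE coord_free ?(basis_free (vbasisP _)) // (negPf ij) scale0r mulr0.
Qed.

Fact tensor_mulDl : left_distributive tensor_mul +%R.
Proof.
move=> u v w; rewrite /tensor_mul -big_split; apply: eq_bigr => i _ /=.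
by rewrite -big_split; apply: eq_bigr => j _ /=; rewrite mxE mulrDl scalerDl.
Qed.

Fact tensor_mulC : commutative tensor_mul.
Proof.
move=> u v; rewrite /tensor_mul exchange_big; apply: eq_bigr => i _.
by apply: eq_bigr => j _; rewrite mulrC (mulrC (b_ _)).
Qed.

Fact tensor_mulZl a u v : a *: tensor_mul u v = tensor_mul (a *: u) v.
Proof.
rewrite /tensor_mul scaler_sumr; apply: eq_bigr => i _.
by rewrite scaler_sumr; apply: eq_bigr => j _; rewrite scalerA mulrA mxE.
Qed.

Let tensor_mulZr a u v : a *: tensor_mul u v = tensor_mul u (a *: v).
Proof. by rewrite tensor_mulC tensor_mulZl tensor_mulC. Qed.

Let tensor_mul_suml (I : finType) (f : I -> tensor) v :
  tensor_mul (\sum_i f i) v = \sum_i tensor_mul (f i) v.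
Proof.
apply: (big_morph (tensor_mul^~ v)) => [u w|]; first exact: tensor_mulDl.
by rewrite -(scale0r (0 : tensor)) -tensor_mulZl !scale0r.
Qed.

Let tensor_mul_sumr (I : finType) (f : I -> tensor) v :
  tensor_mul v (\sum_i f i) = \sum_i tensor_mul v (f i).
Proof.
by rewrite tensor_mulC tensor_mul_suml; apply: eq_bigr => i _; rewrite tensor_mulC.
Qed.

Lemma tensor_inr_mul x y : tensor_inr (x * y) = tensor_mul (tensor_inr x) (tensor_inr y).
Proof.
rewrite {1}(bE x) {1}(bE y) mulr_suml raddf_sum; apply: eq_bigr => i _.
rewrite mulr_sumr raddf_sum; apply: eq_bigr => j _.
by rewrite /= -scalerAl -scalerAr scalerA tensor_inrZ !mxE -scalerAl mul1r scalerA.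
Qed.

Let tensor_mulZ a c u v :
  tensor_mul (a *: u) (c *: v) = (a * c) *: tensor_mul u v.
Proof. by rewrite -tensor_mulZl -tensor_mulZr scalerA. Qed.

Fact tensor_mulA : associative tensor_mul.
Proof.
pose t (c : 'I_n -> K) i : tensor := c i *: tensor_inr (b_ i).
suff H c d e : tensor_mul (\sum_i t c i) (tensor_mul (\sum_i t d i) (\sum_i t e i)) =
    tensor_mul (tensor_mul (\sum_i t c i) (\sum_i t d i)) (\sum_i t e i).
  by move=> u v w; rewrite (tensorE u) (tensorE v) (tensorE w); apply: H.
rewrite !(tensor_mul_suml (t c)) (tensor_mul_suml (fun i => tensor_mul (t c i) _)).
apply: eq_bigr => i _; rewrite (tensor_mul_suml (t d)) (tensor_mul_sumr (t d)).
rewrite (tensor_mul_sumr (fun j => tensor_mul (t d j) _)).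
rewrite (tensor_mul_suml (fun j => tensor_mul (t c i) (t d j))).
apply: eq_bigr => j _; rewrite !(tensor_mul_sumr (t e)).
rewrite (tensor_mul_sumr (fun k => tensor_mul (t d j) (t e k))).
apply: eq_bigr => k _; rewrite /t !tensor_mulZ.
by rewrite -!tensor_inr_mul !mulrA.
Qed.

Fact tensor_mul1 : left_id tensor_one tensor_mul.
Proof.
move=> u; rewrite (tensorE u) tensor_mul_sumr; apply: eq_bigr => i _.
by rewrite -tensor_mulZr -tensor_inr_mul mul1r.
Qed.

Fact tensor_one_neq0 : tensor_one != 0.
Proof.
apply/eqP => /rowP h; have /eqP := oner_neq0 E; apply.
rewrite (bE 1) big1 // => i _; move: (h i); rewrite !mxE => /eqP.
by rewrite scaler_eq0 oner_eq0 orbF => /eqP ->; rewrite scale0r.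
Qed.

HB.instance Definition _ := GRing.Zmodule_isComNzRing.Build tensor
  tensor_mulA tensor_mulC tensor_mul1 tensor_mulDl tensor_one_neq0.
HB.instance Definition _ := GRing.Lmodule_isLalgebra.Build K tensor tensor_mulZl.
HB.instance Definition _ := GRing.Lalgebra_isComAlgebra.Build K tensor.
HB.instance Definition _ := Algebra_isFalgebra.Build K tensor.

Fact tensor_inr_monoid_morphism : monoid_morphism tensor_inr.
Proof. by split=> // x y; rewrite tensor_inr_mul. Qed.

HB.instance Definition _ :=
  GRing.isMonoidMorphism.Build E tensor tensor_inr tensor_inr_monoid_morphism.

Lemma tensor_inrA (a : F) : tensor_inr a%:A = a%:A%:A.
Proof. by rewrite tensor_inrZ rmorph1. Qed.

Lemma tensor_univ (C : comNzRingType)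
    (f : {rmorphism K -> C}) (g : {rmorphism E -> C}) :
    (forall a : F, f a%:A = g a%:A) ->
  exists h : {rmorphism tensor -> C},
    [/\ forall x : K, h x%:A = f x,
        forall y : E, h (tensor_inr y) = g y
      & forall h' : {rmorphism tensor -> C},
          (forall x : K, h' x%:A = f x) -> (forall y : E, h' (tensor_inr y) = g y) ->
          h' =1 h].
Proof.
move=> fg; pose h u := \sum_i f (u 0 i) * g (b_ i).
have hB : zmod_morphism h.
  move=> u v; rewrite /h -sumrB; apply: eq_bigr => i _.
  by rewrite !mxE rmorphB mulrBl.
have hZ a u : h (a *: u) = f a * h u.
  rewrite /h mulr_sumr; apply: eq_bigr => i _; by rewrite mxE rmorphM mulrA.
have hr y : h (tensor_inr y) = g y.
  rewrite {2}(bE y) rmorph_sum; apply: eq_bigr => i _.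
  by rewrite mxE fg -rmorphM -scalerAl mul1r.
have h_sum (I : finType) (t : I -> tensor) : h (\sum_i t i) = \sum_i h (t i).
  have h0 : h 0 = 0 by rewrite -(subrr 0) hB subrr.
  apply: (big_morph h _ h0) => u v.
  by rewrite -{1}(opprK v) hB -(sub0r v) hB h0 sub0r opprK.
have hM : monoid_morphism h.
  split=> [|u v]; first by rewrite -[1]/(tensor_inr 1) hr rmorph1.
  rewrite -[u * v]/(tensor_mul u v) /tensor_mul h_sum {2}/h mulr_suml.
  apply: eq_bigr => i _; rewrite h_sum {2}/h mulr_sumr; apply: eq_bigr => j _.
  by rewrite hZ hr !rmorphM mulrACA.
pose hh : {rmorphism tensor -> C} := HB.pack h
  (GRing.isZmodMorphism.Build _ _ h hB) (GRing.isMonoidMorphism.Build _ _ h hM).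
exists hh; split=> [x|y|h' hl' hr' u] /=.
- by rewrite hZ -[1]/(tensor_inr 1) hr !rmorph1 mulr1.
- exact: hr.
rewrite [in LHS](tensorE u) rmorph_sum; apply: eq_bigr => i _.
by rewrite -[_ *: _]mulr_algl rmorphM hl' hr'.
Qed.

End Tensor.

Definition trace (F : fieldType) (A : falgType F) (a : A) : F :=
  \tr (passmx.mxof (vbasis {:A}) (vbasis {:A}) (amull a)).

(* Main.v *)
(* Suppose delta exists over F', of degree d over F_n.  Its conjugates form d
   points P_j, one for each embedding of F', of the variety
   sum x_i = sum x_i^3 = 0, over an extension W of L = Q(x_1, ..., x_n).  The
   product Phi of the linear forms s |-> sum_i P_j(i) s_i is a determinant with
   entries over L, on whose coefficients S_n acts by permuting the variables s_i.

   Cut the n indices into blocks F_3^k1, F_3^k2 and F_3^k3, and let A in S_n be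
   the 3-group of the translations of the blocks.  Over k = Q(zeta_3), the x_i
   are linear combinations of variables u_j on which A acts by characters.  A
   place of W above the leading coefficient map of k[u] reduces the P_j to points
   of the same variety with algebraic coordinates, and the product of their
   linear forms is, up to a scalar, the leading coefficient of Phi, which is
   defined over k and multiplied by scalars by A.  By unique factorisation A
   permutes these d points, so d is congruent modulo 3 to the number of points
   fixed by A.

   A fixed point is constant on the blocks, with values t, 1, -(3^a t + 3^b) up to
   scaling, where a = k1 - k3, b = k2 - k3 and t is a root of the cubic
   3^a t^3 + 3^b = (3^a t + 3^b)^3.  This cubic has no rational root, hence is
   irreducible over the quadratic field k, so that the fixed points, being cut out
   over k, are evenly distributed among its three roots.  Hence 3 divides d.

   A rational root of the cubic would yield coprime integers y and z, prime to 3,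
   with y^3 + z^3 = 9^b (9^c y + z)^3; descent in Z[zeta_3] controls y modulo a
   power of 3, which contradicts the fact that y divides 9^b - 1. *)

From HB Require Import structures.
From Stdlib Require Classical_Prop.
Require Import Defs.
From mathcomp Require Import all_boot all_order all_fingroup all_algebra all_field.
From mathcomp Require Import mpoly generic_quotient zify ring.

Set Implicit Arguments.
Unset Strict Implicit.
Unset Printing Implicit Defensive.

Import Order.TTheory GRing.Theory Num.Theory.
Local Open Scope ring_scope.

(** * Sums of two cubes *)

(** With d = gcd(a, c), a = a' d and c = c' d, the equation becomes a' b = d^2 c'^3. As a' is prime
    to c', and b to d, a' and d^2 divide each other. *)
Lemma coprime_cube_nat (a b c : nat) :
  coprime a b -> (a * b = c ^ 3)%N -> exists d, a = (d ^ 3)%N.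
Proof.
case: (posnP a) => [-> _ _|a0 ab abc]; first by exists 0%N.
set d := gcdn a c; have d0 : (0 < d)%N by rewrite gcdn_gt0 a0.
have /dvdnP[a' aE] : (d %| a)%N by exact: dvdn_gcdl.
have /dvdnP[c' cE] : (d %| c)%N by exact: dvdn_gcdr.
have ca : coprime a' c'.
  have : gcdn a c = (gcdn a' c' * d)%N by rewrite aE cE muln_gcdl.
  rewrite -/d -{1}(mul1n d) => /eqP; rewrite eqn_pmul2r // eq_sym => ?.
  by rewrite /coprime.
have E : (a' * b = d ^ 2 * c' ^ 3)%N.
  apply/eqP; rewrite -(eqn_pmul2r d0); apply/eqP.
  by rewrite [RHS]mulnC mulnAC -aE abc cE expnMn !expnS; ring.
exists d; rewrite aE expnS mulnC; congr (_ * _)%N.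
apply/eqP; rewrite eqn_dvd; apply/andP; split.
  by rewrite -(@Gauss_dvdl _ _ (c' ^ 3)) ?coprimeXr // -E dvdn_mulr.
have db : coprime (d ^ 2) b by rewrite coprimeXl // (coprime_dvdl _ ab) ?dvdn_gcdl.
by rewrite -(Gauss_dvdl _ db) E dvdn_mulr.
Qed.

Lemma coprimez_cube (a b c : int) :
  coprimez a b -> a * b = c ^+ 3 -> exists d, a = d ^+ 3.
Proof.
move=> ab E; have H := @coprime_cube_nat `|a|%N `|b|%N `|c|%N ab.
have /H[d dE] : (`|a| * `|b| = `|c| ^ 3)%N.
  by rewrite -abszM E abszX.
have aE : a = d%:Z ^+ 3 \/ a = - d%:Z ^+ 3.
  have : `|a|%N = `|d%:Z ^+ 3|%N by rewrite abszX.
  by move: (d%:Z ^+ 3) => D; lia.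
case: aE => ->; [by exists d%:Z|by exists (- d%:Z); rewrite exprNn; lia].
Qed.

(** This is principality of Z[w], for w a primitive cube root of unity: the kernel of Z[w] -> Z/s, w
    |-> k, contains an element u + v w of norm s. The proof is Fermat's descent from s to its
    cofactor s' in k0^2 + k0 + 1, where k0 is the residue of k of least absolute value. *)
Lemma eisenstein_norm_rep (s k : int) : 0 < s -> (s %| k ^+ 2 + k + 1)%Z ->
  exists u v, u ^+ 2 - u * v + v ^+ 2 = s /\ (s %| u + k * v)%Z.
Proof.
have [N sN] : exists N : nat, (`|s| <= N)%N by exists `|s|%N.
elim: N s k sN => [|N IH] s k sN s0 sk; first by lia.
have [s1|s1] : s = 1 \/ 1 < s by lia.
  by exists 1, 0; rewrite s1 dvd1z; split.
have [k0 [k0s /dvdzP[q kE]]] :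
    exists k0 : int, (2 * `|k0| <= s) /\ (s %| k - k0)%Z.
  have := divz_eq k s; have := modz_ge0 k (lt0r_neq0 s0).
  have := ltz_pmod k s0.
  set r := (k %% s)%Z; set q := (k %/ s)%Z => rs r0 E.
  have [h|h] : 2 * r <= s \/ s < 2 * r by lia.
    exists r; split; first lia.
    by apply/dvdzP; exists q; rewrite E; ring.
  exists (r - s); split; first lia.
  by apply/dvdzP; exists (q + 1); rewrite E; ring.
have {}kE : k = k0 + q * s by rewrite -kE; ring.
have /dvdzP[s' s'E] : (s %| k0 ^+ 2 + k0 + 1)%Z.
  have -> : k0 ^+ 2 + k0 + 1 =
     k ^+ 2 + k + 1 - (q * (2 * k0 + q * s + 1)) * s by rewrite kE; ring.
  by rewrite rpredB // dvdz_mull.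
have s'0 : 0 < s' by nia.
have s's : s' < s by nia.
have s'N : (`|s'| <= N)%N by lia.
have [|u1 [v1 [n1 /dvdzP[t tE]]]] := IH s' k0 s'N s'0.
  by rewrite s'E dvdz_mulr.
(* In Z[w] the witness is w - k0, of norm s s', divided by u1 + v1 w, of norm s'. *)
exists (v1 * s - k0 * t), t; split; last first.
  apply/dvdzP; exists (v1 + q * t); rewrite kE; ring.
have u1E : u1 = t * s' - k0 * v1 by rewrite -tE; ring.
have s'n : s' != 0 by apply: lt0r_neq0.
apply: (mulIf s'n).
have E : s' * (t ^+ 2 * s' - t * (2 * k0 + 1) * v1 + s * v1 ^+ 2) = s' * 1.
  rewrite mulr1 -[RHS]n1 u1E.
  have -> : s' * (t ^+ 2 * s' - t * (2 * k0 + 1) * v1 + s * v1 ^+ 2) =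
     t ^+ 2 * s' ^+ 2 - t * s' * (2 * k0 + 1) * v1 + (s' * s) * v1 ^+ 2 by ring.
  by rewrite -s'E; ring.
have {}E := mulfI s'n E.
have -> : ((v1 * s - k0 * t) ^+ 2 - (v1 * s - k0 * t) * t + t ^+ 2) * s' =
  s' * (v1 ^+ 2 * s ^+ 2 - (2 * k0 + 1) * v1 * s * t + (k0 ^+ 2 + k0 + 1) * t ^+ 2) by ring.
rewrite s'E; transitivity (s * s' *
  (t ^+ 2 * s' - t * (2 * k0 + 1) * v1 + s * v1 ^+ 2)); first ring.
by rewrite E mulr1.
Qed.

(* With w a primitive cube root of unity, (m + n w)^3 = eisU m n + eisV m n w. *)
Definition eisU (m n : int) := m ^+ 3 + n ^+ 3 - 3 * m * n ^+ 2.
Definition eisV (m n : int) := 3 * m * n * (m - n).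

(* In Z[w] this reads a + b w = (e + f w) (m + n w)^3, with e + f w a unit. *)
Lemma eisenstein_cube (a b s : int) : coprimez a b ->
    a ^+ 2 - a * b + b ^+ 2 = s ^+ 3 ->
  exists m n e f, [/\ e ^+ 2 - e * f + f ^+ 2 = 1,
    a = e * eisU m n - f * eisV m n
  & b = e * eisV m n + f * eisU m n - f * eisV m n].
Proof.
move=> ab E.
have s0 : 0 < s.
  have ab0 : (a != 0) || (b != 0).
    by apply: contraTT ab; rewrite negb_or !negbK => /andP[/eqP -> /eqP ->].
  have : 0 < s ^+ 3 by rewrite -E; nia.
  by nia.
set S := s ^+ 3 in E *.
have S0 : S != 0 by rewrite expf_neq0 // lt0r_neq0.
have bS : coprimez S b.
  rewrite -E.
  have -> : a ^+ 2 - a * b + b ^+ 2 = a ^+ 2 + (b - a) * b by ring.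
  rewrite /coprimez gcdzC addrC gcdzMDl -/(coprimez _ _) coprimezXr //.
  by rewrite coprimez_sym.
have /coprimezP[[x y] /= xy] := bS.
(* Modulo S, y inverts b, so that k is - a / b and w |-> k sends a + b w to 0. *)
pose k := - a * y.
have bk : (S %| a + b * k)%Z.
  apply/dvdzP; exists (a * x).
  have <- : a * 1 + b * k = a + b * k by ring.
  by rewrite -xy /k; ring.
have kk : (S %| k ^+ 2 + k + 1)%Z.
  have [q qE] := dvdzP bk.
  rewrite -(@Gauss_dvdzr _ (b ^+ 2)) ?coprimezXr //.
  have aE : a = q * S - b * k by rewrite -qE; ring.
  have -> : b ^+ 2 * (k ^+ 2 + k + 1) = S + (k * b - a + b) * (b * k + a).
     by rewrite -E; ring.
  by rewrite rpredD // dvdz_mull // addrC.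
have [u [v [uv /dvdzP[t tE]]]] : exists u v,
    u ^+ 2 - u * v + v ^+ 2 = s /\ (s %| u + k * v)%Z.
  apply: eisenstein_norm_rep => //.
  by apply: dvdz_trans kk; rewrite /S exprS dvdz_mulr.
(* Under w |-> k the element (u + v w)^3 goes to (t s)^3, which is 0 modulo S. *)
have UV : (S %| eisU u v + k * eisV u v)%Z.
  have -> : eisU u v + k * eisV u v = (t * s) ^+ 3 -
      (3 * u * v ^+ 2 + v ^+ 3 * (k - 1)) * (k ^+ 2 + k + 1).
    by rewrite -tE /eisU /eisV; ring.
  by rewrite exprMn rpredB // dvdz_mull.
have NUV : eisU u v ^+ 2 - eisU u v * eisV u v + eisV u v ^+ 2 = S.
  by rewrite /S -uv /eisU /eisV; ring.
set U := eisU u v in UV NUV *; set V := eisV u v in UV NUV *.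
(* g + f w is to be (a + b w) / (U + V w): both coordinates of a + b w times the conjugate of U + V
   w are divisible by the norm S. *)
have /dvdzP[f fE] : (S %| b * U - a * V)%Z.
  have -> : b * U - a * V = b * (U + k * V) - V * (a + b * k) by ring.
  by rewrite rpredB ?dvdz_mull.
have /dvdzP[g gE] : (S %| a * U - a * V + b * V)%Z.
  have -> : a * U - a * V + b * V =
    (a + b * k) * (U - V) - b * k * (U + k * V) + b * V * (k ^+ 2 + k + 1) by ring.
  by apply: rpredD; [apply: rpredB; [apply: dvdz_mulr|apply: dvdz_mull]|apply: dvdz_mull].
exists u, v, g, f; rewrite -/U -/V; split.
- have S2 : S ^+ 2 != 0 by rewrite expf_neq0.
  apply: (mulIf S2); rewrite mul1r.
  have -> : (g ^+ 2 - g * f + f ^+ 2) * S ^+ 2 =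
    (g * S) ^+ 2 - (g * S) * (f * S) + (f * S) ^+ 2 by ring.
  rewrite -gE -fE; transitivity
    ((a ^+ 2 - a * b + b ^+ 2) * (U ^+ 2 - U * V + V ^+ 2)); first ring.
  by rewrite E NUV.
- apply: (mulIf S0).
  have -> : (g * U - f * V) * S = (g * S) * U - (f * S) * V by ring.
  by rewrite -gE -fE -NUV; ring.
- apply: (mulIf S0).
  have -> : (g * V + f * U - f * V) * S = (g * S) * V + (f * S) * (U - V) by ring.
  by rewrite -gE -fE -NUV; ring.
Qed.

Lemma dvd3M (x y : int) : (3 %| x * y)%Z = (3 %| x)%Z || (3 %| y)%Z.
Proof. by rewrite !dvdzE abszM Euclid_dvdM. Qed.

Lemma dvd3X (x : int) k : (3 %| x ^+ k.+1)%Z = (3 %| x)%Z.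
Proof. by rewrite !dvdzE abszX Euclid_dvdX // andbT. Qed.

Lemma coprime3X (x : int) k : ~~ (3 %| x)%Z -> coprimez (3 ^+ k) x.
Proof. by move=> h; rewrite coprimezXl // coprimezE prime_coprime // -dvdzE. Qed.

Lemma dvd_exp3 i k (x : int) : (i <= k)%N -> (3 ^+ k %| x)%Z -> (3 ^+ i %| x)%Z.
Proof. by move=> ik; apply: dvdz_trans; rewrite -(subnK ik) exprD dvdz_mull. Qed.

(** With x + y = 3 b, the other factor x^2 - x y + y^2 is 3 N, where N is the norm of (x - b) + b w
    and is prime to both 3 and b. So the factors of b N = 3^(j+1) z^3 are coprime, N is a cube and b
    is 3^(j+1) times a cube. *)
Lemma descent_split j (x y z : int) : coprimez x y -> ~~ (3 %| x)%Z ->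
    x ^+ 3 + y ^+ 3 = 3 ^+ j.+3 * z ^+ 3 ->
  exists b r s, [/\ y = 3 * b - x, b = 3 ^+ j.+1 * r ^+ 3,
    (x - b) ^+ 2 - (x - b) * b + b ^+ 2 = s ^+ 3, coprimez (x - b) b &
    z ^+ 3 = (r * s) ^+ 3].
Proof.
move=> cxy x3 E.
have /dvdzP[b bE] : (3 %| x + y)%Z.
  rewrite -(dvd3X _ 2).
  have -> : (x + y) ^+ 3 = x ^+ 3 + y ^+ 3 + 3 * (x * y * (x + y)) by ring.
  by rewrite E exprS -mulrA rpredD // dvdz_mulr.
have {}bE : y = 3 * b - x by lia.
set N := (x - b) ^+ 2 - (x - b) * b + b ^+ 2.
have E1 : b * N = 3 ^+ j.+1 * z ^+ 3.
  have n9 : (9 : int) != 0 by [].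
  apply: (mulfI n9); transitivity (x ^+ 3 + y ^+ 3).
    by rewrite bE /N; ring.
  by rewrite E 2!exprS; ring.
have cab : coprimez (x - b) b.
  apply/coprimezP; have /coprimezP[[u v] /= uv] := cxy.
  exists (u - v, u + 2 * v) => /=; move: uv; rewrite bE; lia.
have N3 : ~~ (3 %| N)%Z.
  apply: contra x3 => h; rewrite -(dvd3X _ 1).
  have -> : x ^+ 2 = N + 3 * (b * (x - b)) by rewrite /N; ring.
  by rewrite rpredD // dvdz_mulr.
have /dvdzP[b' b'E] : (3 ^+ j.+1 %| b)%Z.
  by rewrite -(@Gauss_dvdzl _ _ N) ?coprime3X // E1 dvdz_mulr.
have E2 : b' * N = z ^+ 3.
  have n3 : (3 ^+ j.+1 : int) != 0 by rewrite expf_neq0.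
  by apply: (mulfI n3); rewrite -E1 b'E; ring.
have cbN : coprimez b N.
  have -> : N = (x - b) ^+ 2 + (2 * b - x) * b by rewrite /N; ring.
  rewrite /coprimez addrC gcdzMDl -/(coprimez _ _) coprimezXr //.
  by rewrite coprimez_sym.
have cb'N : coprimez b' N.
  by move: cbN; rewrite b'E coprimezMl => /andP[].
have [r rE] := coprimez_cube cb'N E2.
have [s sE] : exists s, N = s ^+ 3.
  by apply: (@coprimez_cube N b' z); rewrite 1?coprimez_sym // mulrC.
by exists b, r, s; split; rewrite // 1?b'E 1?rE 1?mulrC // -E2 rE sE mulrC exprMn.
Qed.

Lemma cube_factors i (a b c r : int) : coprimez a b -> coprimez a c ->
    coprimez b c -> ~~ (3 %| r)%Z -> (0 < i)%N ==> (3 %| c)%Z ->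
    a * b * c = 3 ^+ i * r ^+ 3 ->
  exists x y z, [/\ a = x ^+ 3, b = y ^+ 3, c = 3 ^+ i * z ^+ 3,
    ~~ (3 %| x)%Z & ~~ (3 %| y)%Z /\ ~~ (3 %| z)%Z].
Proof.
move=> ab ac bc r3 ci E.
have n3 : (3 ^+ i : int) != 0 by rewrite expf_neq0.
have /dvdzP[c' cE] : (3 ^+ i %| c)%Z.
  case: i ci E {n3} => [|i] /= ci E; first by rewrite expr0 dvd1z.
  have nd x : coprimez x c -> ~~ (3 %| x)%Z.
    apply: contraTN => x3; rewrite /coprimez; apply/negP => /eqP g1.
    by have := dvdz_gcd 3 x c; rewrite x3 ci g1.
  rewrite -(@Gauss_dvdzr _ (a * b)) ?E ?dvdz_mulr //.
  by rewrite coprimezMr !coprime3X ?nd.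
have E2 : a * b * c' = r ^+ 3 by apply: (mulfI n3); transitivity (a * b * c); [rewrite cE; ring|exact: E].
have [ac' bc'] : coprimez a c' /\ coprimez b c'.
  by move: ac bc; rewrite cE !coprimezMr => /andP[-> _] /andP[-> _].
have [x xE] : exists x, a = x ^+ 3.
  apply: (@coprimez_cube a (b * c') r); first by rewrite coprimezMr ab.
  by rewrite -E2; ring.
have [y yE] : exists y, b = y ^+ 3.
  apply: (@coprimez_cube b (a * c') r); last by rewrite -E2; ring.
  by rewrite coprimezMr coprimez_sym ab.
have [z zE] : exists z, c' = z ^+ 3.
  apply: (@coprimez_cube c' (a * b) r); last by rewrite -E2; ring.
  by rewrite coprimezMr ![coprimez c' _]coprimez_sym ac'.
exists x, y, z.
have : ~~ (3 %| r ^+ 3)%Z by rewrite dvd3X.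
rewrite -E2 !dvd3M !negb_or xE yE zE !dvd3X => /andP[/andP[-> ->] ->].
by split=> //; rewrite cE mulrC zE.
Qed.

(* One of m, n and m - n carries the power of 3; the other two and it are cubes,
   whose linear relation is the new equation. *)
Lemma cube_triple i (m n r : int) : coprimez m n -> ~~ (3 %| r)%Z ->
    m * n * (m - n) = 3 ^+ i * r ^+ 3 ->
  exists e g p d, [/\ coprimez e g, ~~ (3 %| e)%Z /\ ~~ (3 %| g)%Z, ~~ (3 %| p)%Z,
    e ^+ 3 + g ^+ 3 = 3 ^+ i * p ^+ 3 &
    [/\ d ^+ 2 = 1 :> int &
     (0 < i)%N -> (3 ^+ i.+1 %| eisU m n - 2 * eisV m n - d * e ^+ 9)%Z]].
Proof.
move=> mn r3 E.
have mD : coprimez m (m - n).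
  by rewrite -[m in m - n]mul1r /coprimez gcdzMDl -/(coprimez _ _) coprimezN.
have nD : coprimez n (m - n).
  rewrite (_ : m - n = -1 * n + m); last ring.
  by rewrite /coprimez gcdzMDl -/(coprimez _ _) coprimez_sym.
have cX (x y : int) : coprimez (x ^+ 3) (y ^+ 3) -> coprimez x y.
  by rewrite coprimez_pexpl // coprimez_pexpr.
have dv c z q : (0 < i)%N -> c = 3 ^+ i * z -> (3 %| q)%Z -> (3 ^+ i.+1 %| c * q)%Z.
  move=> _ -> /dvdzP[t ->]; apply/dvdzP; exists (z * t); rewrite exprS; ring.
have dv3 c z : (0 < i)%N -> c = 3 ^+ i * z -> (3 %| c)%Z.
  by move=> i0 ->; rewrite -(prednK i0) exprS -mulrA dvdz_mulr.
have [n3|n3] := boolP ((0 < i)%N ==> (3 %| n)%Z).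
  have [||x [y [z [xE yE zE x3 [y3 z3]]]]] := cube_factors mD mn _ r3 n3.
  - by rewrite coprimez_sym.
  - by rewrite -E; ring.
  exists x, (- y), z, 1; split => //.
  - by rewrite coprimezN cX // -xE -yE.
  - by rewrite rpredN.
  - by rewrite -zE exprNn -yE -xE; ring.
  split=> // i0.
  (* Modulo n only m^3 = x^9 survives; besides the 3^i in n, the cofactor contributes one more
     factor 3. *)
  have -> : eisU m n - 2 * eisV m n - 1 * x ^+ 9 = n * (n ^+ 2 + 3 * (m * n - 2 * m ^+ 2)).
    by rewrite (_ : x ^+ 9 = m ^+ 3) /eisU /eisV; [ring|rewrite xE; ring].
  rewrite (dv n (z ^+ 3)) // rpredD ?dvdz_mulr //.
  exact: dv3 zE.
have [m3|m3] := boolP ((0 < i)%N ==> (3 %| m)%Z).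
  have [|||x [y [z [xE yE zE x3 [y3 z3]]]]] := cube_factors nD _ _ r3 m3.
  - by rewrite coprimez_sym.
  - by rewrite coprimez_sym.
  - by rewrite -E; ring.
  exists x, y, z, 1; split => //.
  - by rewrite cX // -xE -yE.
  - by rewrite -zE -yE -xE; ring.
  split=> // i0.
  have -> : eisU m n - 2 * eisV m n - 1 * x ^+ 9 = m * (m ^+ 2 + 3 * (n ^+ 2 - 2 * m * n)).
    by rewrite (_ : x ^+ 9 = n ^+ 3) /eisU /eisV; [ring|rewrite xE; ring].
  rewrite (dv m (z ^+ 3)) // rpredD ?dvdz_mulr //.
  exact: dv3 zE.
have d3 : (0 < i)%N ==> (3 %| m - n)%Z.
  apply/implyP => i0; move: n3 m3; rewrite i0 /= => n3 m3.
  have : (3 %| m * n * (m - n))%Z by rewrite E -(prednK i0) exprS -mulrA dvdz_mulr.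
  by rewrite !dvd3M (negPf n3) (negPf m3).
have [|||x [y [z [xE yE zE x3 [y3 z3]]]]] := cube_factors mn _ _ r3 d3 => //.
exists y, (- x), (- z), (-1); split => //.
- by rewrite coprimezN cX // -xE -yE coprimez_sym.
- by rewrite rpredN.
- by rewrite rpredN.
- rewrite (_ : 3 ^+ i * (- z) ^+ 3 = - (3 ^+ i * z ^+ 3)); last ring.
  by rewrite -zE xE yE; ring.
split=> // i0.
have -> : eisU m n - 2 * eisV m n - -1 * y ^+ 9 =
    (m - n) * ((m - n) ^+ 2 + 3 * (- 2 * n ^+ 2 - n * (m - n))).
  by rewrite (_ : y ^+ 9 = n ^+ 3) /eisU /eisV; [ring|rewrite yE; ring].
rewrite (dv _ (z ^+ 3)) // rpredD ?dvdz_mulr //.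
exact: dv3 zE.
Qed.

Lemma eisenstein_unit_dvd3 (e q : int) :
  e ^+ 2 - e * (q * 3) + (q * 3) ^+ 2 = 1 -> q = 0.
Proof.
move=> E; have : (2 * e - 3 * q) ^+ 2 + 27 * q ^+ 2 =
    4 * (e ^+ 2 - e * (q * 3) + (q * 3) ^+ 2) by ring.
rewrite E; have : 0 <= (2 * e - 3 * q) ^+ 2 by exact: sqr_ge0.
by move: ((2 * e - 3 * q) ^+ 2) => s {E}; nia.
Qed.

(** One descent step lowers the exponent from j + 3 to j: (x - b) + b w is a unit times a cube (m +
    n w)^3, the unit is a sign, and b = 3^(j+1) r^3 then says that m n (m - n) is 3^j times a cube.
    This product is even, which makes z even. *)
Lemma descent_step j (x y z : int) : coprimez x y -> ~~ (3 %| x)%Z ->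
    ~~ (3 %| z)%Z -> x ^+ 3 + y ^+ 3 = 3 ^+ j.+3 * z ^+ 3 ->
  (2 %| z)%Z /\
  exists e g p d, [/\ coprimez e g, ~~ (3 %| e)%Z /\ ~~ (3 %| g)%Z, ~~ (3 %| p)%Z,
    e ^+ 3 + g ^+ 3 = 3 ^+ j * p ^+ 3 &
    [/\ d ^+ 2 = 1 :> int &
     (0 < j)%N -> (3 ^+ j.+1 %| y - d * e ^+ 9)%Z]].
Proof.
move=> cxy x3 z3 E.
have [b [r [s [yE bE N cab zE]]]] := descent_split cxy x3 E.
have [m [n [e [f [ef aU bV]]]]] := eisenstein_cube cab N.
set U := eisU m n in aU bV; set V := eisV m n in aU bV.
have V3 : (3 %| V)%Z by rewrite /V /eisV -!mulrA dvdz_mulr.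
have b3 : (3 %| b)%Z by rewrite bE exprS -mulrA dvdz_mulr.
have r3 : ~~ (3 %| r)%Z.
  by apply: contra z3 => h; rewrite -(dvd3X _ 2) zE dvd3X dvd3M h.
(* As 3 divides b and V, it divides f U; if it divided U, it would divide x. A unit e + f w with 3
   dividing f is a sign. *)
have f3 : (3 %| f)%Z.
  apply: contraNT x3 => f3.
  have : (3 %| f * U)%Z.
    have -> : f * U = b - e * V + f * V by rewrite bV; ring.
    by apply: rpredD; [apply: rpredB => //|]; apply: dvdz_mull.
  rewrite dvd3M (negPf f3) /= => U3.
  have -> : x = (e * U - f * V) + b by rewrite -aU; ring.
  by apply: rpredD => //; apply: rpredB; apply: dvdz_mull.
have f0 : f = 0 by move/dvdzP: f3 ef => [q ->] /eisenstein_unit_dvd3 ->; rewrite mul0r.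
have e2 : e ^+ 2 = 1 by rewrite -ef f0; ring.
have {}bV : b = e * V by rewrite bV f0; ring.
have {}aU : x - b = e * U by rewrite aU f0; ring.
have mn : coprimez m n.
  move: cab; rewrite aU bV coprimezMl => /andP[_]; rewrite coprimezMr => /andP[_].
  rewrite /U /V /eisU /eisV.
  have [t tE] : exists t, gcdz m n = t by exists (gcdz m n).
  have /dvdzP[m' mE] := dvdz_gcdl m n; have /dvdzP[n' nE] := dvdz_gcdr m n.
  rewrite tE in mE nE; rewrite /coprimez.
  have tU : (t %| m ^+ 3 + n ^+ 3 - 3 * m * n ^+ 2)%Z.
    by apply/dvdzP; exists (m' * m ^+ 2 + n' * n ^+ 2 - 3 * m * n * n'); rewrite mE nE; ring.
  have tV : (t %| 3 * m * n * (m - n))%Z.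
    by apply/dvdzP; exists (3 * m' * n * (m - n)); rewrite mE nE; ring.
  move=> /eqP g1; have := dvdz_gcd t (m ^+ 3 + n ^+ 3 - 3 * m * n ^+ 2) (3 * m * n * (m - n)).
  rewrite tU tV g1 => t1; rewrite tE.
  have : 0 <= t by rewrite -tE.
  by move=> /gez0_abs <-; move: t1; rewrite dvdz1 => /eqP ->.
have E2 : m * n * (m - n) = 3 ^+ j * (e * r) ^+ 3.
  have n3 : (3 : int) != 0 by [].
  have e4 : e * (3 ^+ j.+1 * r ^+ 3) = V.
    by rewrite -bE bV mulrA -expr2 e2 mul1r.
  apply: (mulfI n3); transitivity V; first by rewrite /V /eisV; ring.
  by rewrite -e4 exprMn [e ^+ 3]exprS e2 [3 ^+ j.+1]exprS; ring.
have er3 : ~~ (3 %| e * r)%Z.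
  rewrite dvd3M negb_or r3 andbT; apply/negP => h.
  by have := dvd3X e 1; rewrite e2 h.
split.
  have two : (2 %| m * n * (m - n))%Z.
    have := divz_eq m 2; have := divz_eq n 2.
    have m2 : 0 <= (m %% 2)%Z < 2 by rewrite modz_ge0 // ltz_pmod.
    have n2 : 0 <= (n %% 2)%Z < 2 by rewrite modz_ge0 // ltz_pmod.
    move: (m %/ 2)%Z (n %/ 2)%Z (m %% 2)%Z (n %% 2)%Z m2 n2 => q q' u u' hu hu' nE mE.
    have : u = 0 \/ u = 1 by lia.
    have : u' = 0 \/ u' = 1 by lia.
    case=> u'E; case=> uE; apply/dvdzP; rewrite mE nE u'E uE.
    - by exists (q * (q' * 2) * (q * 2 - q' * 2)); ring.
    - by exists ((q * 2 + 1) * q' * (q * 2 + 1 - q' * 2)); ring.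
    - by exists (q * (q' * 2 + 1) * (q * 2 - q' * 2 - 1)); ring.
    - by exists ((q * 2 + 1) * (q' * 2 + 1) * (q - q')); ring.
  have c2 : coprimez 2 (3 ^+ j) by rewrite coprimezXr.
  have dX (u : int) k : (2 %| u ^+ k.+1)%Z = (2 %| u)%Z.
    by rewrite !dvdzE abszX Euclid_dvdX // andbT.
  rewrite -(dX _ 2) zE dX.
  move: two; rewrite E2 Gauss_dvdzr // dX => two.
  apply: dvdz_mulr; have -> : r = e * (e * r) by rewrite mulrA -expr2 e2 mul1r.
  exact: dvdz_mull.
have [e1 [g1 [p1 [d [c1 n1 n2 E1 [d2 h]]]]]] := cube_triple mn er3 E2.
exists e1, g1, p1, (- e * d); split=> //; split.
  by rewrite exprMn d2 sqrrN e2.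
move=> /h h1; have -> : y - - e * d * e1 ^+ 9 = - e * (U - 2 * V - d * e1 ^+ 9).
  rewrite yE (_ : 3 * b - x = 2 * b - (x - b)); last ring.
  by rewrite aU bV; ring.
by rewrite dvdz_mull.
Qed.

Lemma sqr1_int (d : int) : d ^+ 2 = 1 -> d = 1 \/ d = -1.
Proof. by nia. Qed.

Lemma coprimez_sqr1 (x d : int) : d ^+ 2 = 1 -> coprimez x d.
Proof. by case/sqr1_int => ->; rewrite coprimezE; exact: coprimen1. Qed.

Lemma mod3_unit (x : int) : ~~ (3 %| x)%Z -> exists q d, d ^+ 2 = 1 :> int /\ x = q * 3 + d.
Proof.
move=> x3; have := divz_eq x 3.
have m2 : 0 <= (x %% 3)%Z < 3 by rewrite modz_ge0 // ltz_pmod.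
have m0 : (x %% 3)%Z <> 0 by move/dvdz_mod0P; apply/negP.
move: (x %/ 3)%Z (x %% 3)%Z m2 m0 => q r hr r0 ->.
have [->|->] : r = 1 \/ r = 2 by lia.
  by exists q, 1.
by exists (q + 1), (-1); split=> //; ring.
Qed.

Lemma cube_mod9 (x : int) : ~~ (3 %| x)%Z ->
  exists t d, d ^+ 2 = 1 :> int /\ x ^+ 3 = 9 * t + d.
Proof.
move=> /mod3_unit[q [d [d2 ->]]]; exists (3 * q ^+ 3 + 3 * q ^+ 2 * d + q), d.
split=> //; transitivity (27 * q ^+ 3 + 27 * q ^+ 2 * d + 9 * q * d ^+ 2 + d ^+ 2 * d).
  by ring.
by rewrite d2; ring.
Qed.

Lemma cube_close k (e d : int) : d ^+ 2 = 1 -> (0 < k)%N ->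
  (3 ^+ k %| e - d)%Z -> (3 ^+ k.+1 %| e ^+ 3 - d)%Z.
Proof.
case: k => // k d2 _ /dvdzP[t tE].
have dE : d ^+ 3 = d by rewrite exprS d2 mulr1.
apply/dvdzP; exists (t * (t ^+ 2 * 3 ^+ (k + k.+1) + e * d)).
have -> : e ^+ 3 - d = (e - d) * ((e - d) ^+ 2 + 3 * (e * d)).
  by rewrite -{1}dE; ring.
by rewrite tE exprD !exprS; ring.
Qed.

(** Descent lowers j by 3 until j < 3, where cubes modulo 9 exclude 0 and 1. At each step y is
    3-adically close to a sign times e^9, so that a congruence for e gains two powers of 3. *)
Lemma sum_cubes_exponent j (x y z : int) : coprimez x y ->
    ~~ (3 %| x)%Z -> ~~ (3 %| y)%Z -> ~~ (3 %| z)%Z ->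
    x ^+ 3 + y ^+ 3 = 3 ^+ j * z ^+ 3 ->
  exists i d, [/\ j = (3 * i + 2)%N, d ^+ 2 = 1 & (3 ^+ (2 * i).+1 %| y - d)%Z].
Proof.
elim/ltn_ind: j x y z => j IH x y z cxy x3 y3 z3 E.
have [tx [dx [dx2 xE]]] := cube_mod9 x3.
have [ty [dy [dy2 yE]]] := cube_mod9 y3.
have [tz [dz [dz2 zE]]] := cube_mod9 z3.
case: j IH E => [|[|[|j]]] IH E.
- exfalso; move: E; rewrite xE yE zE expr0.
  by move: dx2 dy2 dz2 => /sqr1_int[->|->] /sqr1_int[->|->] /sqr1_int[->|->]; lia.
- exfalso; move: E; rewrite xE yE zE expr1.
  by move: dx2 dy2 dz2 => /sqr1_int[->|->] /sqr1_int[->|->] /sqr1_int[->|->]; lia.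
- have [q [d [d2 yq]]] := mod3_unit y3; exists 0%N, d; split=> //.
  by apply/dvdzP; exists q; rewrite yq; ring.
have [_ [e [g [p [d [eg [e3 g3] p3 E1 [d2 h]]]]]]] := descent_step cxy x3 z3 E.
(* The roles of e and g are exchanged, so that the congruence obtained by induction bears on e. *)
have [|||i [d' [jE d'2 h']]] := IH j _ g e p _ g3 e3 p3; first by lia.
- by rewrite coprimez_sym.
- by rewrite addrC.
exists i.+1, (d * d'); split; [by rewrite jE; lia|by rewrite exprMn d2 d'2|].
have -> : y - d * d' = y - d * e ^+ 9 + d * ((e ^+ 3) ^+ 3 - d') by ring.
apply: rpredD.
  by apply: (dvd_exp3 _ (h _)); rewrite jE; clear; lia.
apply: dvdz_mull; rewrite mulnS.
by apply: cube_close => //; apply: cube_close.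
Qed.

Lemma sum_cubes_even j (x y z : int) : (2 < j)%N -> coprimez x y ->
    ~~ (3 %| x)%Z -> ~~ (3 %| z)%Z ->
    x ^+ 3 + y ^+ 3 = 3 ^+ j * z ^+ 3 -> (2 %| z)%Z.
Proof.
case: j => [|[|[|j]]] // _ cxy x3 z3 E.
by have [] := descent_step cxy x3 z3 E.
Qed.

(** [descent_split] applied to x and d turns the equation into b^3 = (b - d)^3 + (d s)^3, where b is
    a power of 3 times r^3 with r prime to 3. The exponent of 3 in b^3 is then a multiple of 3,
    against [sum_cubes_exponent]. *)
Lemma cube_plus_unit j (x d z : int) : (2 < j)%N -> d ^+ 2 = 1 ->
  ~~ (3 %| x)%Z -> ~~ (3 %| z)%Z -> x ^+ 3 + d ^+ 3 <> 3 ^+ j * z ^+ 3.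
Proof.
case: j => [|[|[|j]]] // _ d2 x3 z3 E.
have cxd := coprimez_sqr1 x d2.
have [b [r [s [dE bE N cab zE]]]] := descent_split cxd x3 E.
have bd : b ^+ 3 = (b - d) ^+ 3 + (d * s) ^+ 3.
  rewrite exprMn -N (_ : x = 3 * b - d); last by rewrite dE; ring.
  pose Y := 3 * b ^+ 2 * d - 3 * b * d ^+ 2 + d ^+ 3.
  have dY : d ^+ 2 * Y = Y by rewrite d2 mul1r.
  transitivity ((b - d) ^+ 3 + Y); first by rewrite /Y; ring.
  by rewrite -dY /Y; ring.
have b3 : (3 %| b)%Z by rewrite bE exprS -mulrA dvdz_mulr.
have d3 : ~~ (3 %| d)%Z by case: (sqr1_int d2) => ->.
have nbd : ~~ (3 %| b - d)%Z.
  by apply: contra d3 => h; have -> : d = b - (b - d); [ring|exact: rpredB].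
have nrs : ~~ (3 %| r * s)%Z.
  by apply: contra z3; rewrite -(dvd3X z 2) zE dvd3X.
have [nr ns] : ~~ (3 %| r)%Z /\ ~~ (3 %| d * s)%Z.
  by move: nrs; rewrite !dvd3M !negb_or (negPf d3) => /andP[].
have c1 : coprimez (b - d) (d * s).
  have : coprimez (b - d) ((d * s) ^+ 3).
    have -> : (d * s) ^+ 3 = (3 * d * (b - d) + 3 * d ^+ 2) * (b - d) + d ^+ 3.
      by rewrite -[LHS](addKr ((b - d) ^+ 3)) -bd; ring.
    rewrite /coprimez gcdzMDl -/(coprimez _ _) coprimezXr //.
    exact: coprimez_sqr1.
  by rewrite coprimez_pexpr.
have r3 : ~~ (3 %| r ^+ 3)%Z by rewrite dvd3X.
have [|i [_ [iE _ _]]] := @sum_cubes_exponent (3 * j.+1)%N _ _ _ c1 nbd ns r3.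
  by rewrite -bd bE exprMn -exprM mulnC.
by move: iE; clear; lia.
Qed.

(** Modulo y, w is z and the equation reads z^3 = B z^3, with z invertible. *)
Lemma coprime_divisor_of_cubes (B y z w : int) : coprimez y z -> (y %| z - w)%Z ->
  y ^+ 3 + z ^+ 3 = B * w ^+ 3 -> (y %| B - 1)%Z.
Proof.
move=> cyz /dvdzP[t tE] E.
have czy3 : coprimez y (z ^+ 3) by rewrite coprimezXr.
rewrite -(Gauss_dvdzl _ czy3).
apply/dvdzP; exists (y ^+ 2 - B * (- t) * (z ^+ 2 + z * w + w ^+ 2)).
transitivity (y ^+ 3 - (y ^+ 3 + z ^+ 3) + B * z ^+ 3); first ring.
rewrite E; transitivity (y ^+ 3 + B * ((z - w) * (z ^+ 2 + z * w + w ^+ 2))); first ring.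
by rewrite tE; ring.
Qed.

(** As M <= 2 b, 9^b vanishes modulo 3^M, so that y' is - d there. If y differs from d and y' from -
    d, then |y y'| is at least (3^M - 1)^2, more than 9^b - 1; and y' = - d makes y even, like 9^b -
    1. *)
Lemma unit_divisor_mod3 b M (y y' d : int) : (b < M)%N -> (M <= b + b)%N -> d ^+ 2 = 1 ->
    ~~ (2 %| y)%Z -> y * y' = 9 ^+ b - 1 -> (3 ^+ M %| y - d)%Z -> y ^+ 2 = 1.
Proof.
move=> bM Mb d2 y2 E /dvdzP[t tE].
have T0 : (0 : int) < 3 ^+ b by rewrite exprn_gt0.
have TM : (3 * 3 ^+ b <= 3 ^+ M :> int).
  by rewrite -exprS ler_weXn2l.
have T2 : 9 ^+ b = 3 ^+ b * 3 ^+ b :> int by rewrite -exprMn.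
have /dvdzP[u uE] : (3 ^+ M %| y' + d)%Z.
  have cM : coprimez (3 ^+ M) d by exact: coprimez_sqr1.
  rewrite -(Gauss_dvdzr _ cM); apply/dvdzP.
  exists (3 ^+ (b + b - M) - t * y').
  have -> : d * (y' + d) = (d ^+ 2 - 1) + (y * y' + 1) - (y - d) * y' by ring.
  rewrite d2 E tE T2 -exprD -{1}(subnK Mb) exprD; ring.
have yE : y = d + t * 3 ^+ M by rewrite -tE; ring.
have y'E : y' = u * 3 ^+ M - d by rewrite -uE; ring.
have [t0|t0] := eqVneq t 0; first by rewrite yE t0 mul0r addr0.
exfalso; have [u0|u0] := eqVneq u 0.
  move/negP: y2; apply.
  have -> : y = - (9 ^+ b - 1) * d.
    by rewrite -E y'E u0 mul0r add0r; rewrite mulrN opprK -mulrA -expr2 d2 mulr1.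
  apply: dvdz_mulr; rewrite rpredN subrX1.
  by apply: dvdz_mulr.
move: T0 TM E; rewrite T2 yE y'E; move: (3 ^+ b) (3 ^+ M) => T P T0 TP.
have dP : - 1 <= d <= 1 by case: (sqr1_int d2) => ->.
have h1 (v : int) : v != 0 -> P <= `|v * P|.
  have P0 : 0 <= P by move: T0 TP; clear; lia.
  move=> v0; rewrite normrM (ger0_norm P0) ler_peMl //.
  by move: v0; clear; lia.
have h2 := h1 t t0; have h3 := h1 u u0.
move: (t * P) (u * P) h2 h3 => v w hv hw E.
have : (P - 1) * (P - 1) <= `|d + v| * `|w - d|.
  by apply: ler_pM; move: hv hw T0 TP dP; clear; lia.
rewrite -normrM E; clear - T0 TP; rewrite ger0_norm; nia.
Qed.

(* For b = 1 in the equation of sum_cubes_3pow_no_line, y divides 8; with x = 9^c,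
   v is the integer - 8 (9^c y + z) / y - x. *)
Lemma reduced_cubic_no_root k (v x : int) : x = 9 ^+ k.+1 ->
  v ^+ 3 - 27 * x ^+ 2 * v - 90 * x ^+ 3 + 64 <> 0.
Proof.
move=> xE E.
have x9 : 9 <= x by rewrite xE exprS ler_peMr // exprn_ege1.
have /dvdzP[q qE] : (3 %| v + 4)%Z.
  rewrite -(dvd3X _ 2).
  have -> : (v + 4) ^+ 3 =
    (v ^+ 3 - 27 * x ^+ 2 * v - 90 * x ^+ 3 + 64) +
    3 * (9 * x ^+ 2 * v + 30 * x ^+ 3 + 4 * v ^+ 2 + 16 * v) by ring.
  by rewrite E add0r dvdz_mulr.
have {}qE : v = 3 * q - 4 by rewrite -[LHS](addrK 4) qE; ring.
(* The equation reads q u = x^2 (9 q - 12 + 10 x) with u prime to 3 and x a power of 3. So q = l x^2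
   with l nonzero, and u, quadratic in q, is too large for l u = 9 q - 12 + 10 x. *)
pose u := 3 * q ^+ 2 - 12 * q + 16.
have qu : q * u = x ^+ 2 * (9 * q - 12 + 10 * x).
  have n9 : (9 : int) != 0 by [].
  apply: (mulfI n9); apply: subr0_eq; rewrite -[RHS]E qE /u; ring.
have u3 : ~~ (3 %| u)%Z.
  apply/negP => h; suff: (3 %| (16 : int)%R)%Z by [].
  have -> : 16 = u - 3 * (q ^+ 2 - 4 * q) by rewrite /u; ring.
  by rewrite rpredB // dvdz_mulr.
have /dvdzP[l lE] : (x ^+ 2 %| q)%Z.
  have x3 : x ^+ 2 = 3 ^+ (2 * k.+1 * 2) by rewrite xE -exprM !exprM.
  have xu : coprimez (x ^+ 2) u by rewrite x3; apply: coprime3X.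
  by rewrite -(Gauss_dvdzl _ xu) qu dvdz_mulr.
have lu : l * u = 9 * q - 12 + 10 * x.
  have n2 : x ^+ 2 != 0 by rewrite expf_neq0 //; move: x9; clear; lia.
  by apply: (mulfI n2); rewrite -qu lE; ring.
have l0 : l != 0.
  apply/eqP => l0; move: lu; rewrite lE l0; move: x9; clear; lia.
have qx : x ^+ 2 <= `|q|.
  rewrite lE normrM (ger0_norm (sqr_ge0 _)) ler_peMl ?sqr_ge0 //.
  by move: l0; clear; lia.
have q9 : 9 * x <= `|q|.
  by apply: le_trans qx; rewrite expr2 ler_pM2r //; move: x9; clear; lia.
have uq : 200 * `|q| <= u.
  have : 3 * (81 * `|q|) <= 3 * q ^+ 2.
    rewrite -real_normK ?num_real // expr2 ler_pM2l // ler_pM //.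
    by move: q9 x9; clear; lia.
  by rewrite /u; move: q9 x9 (q ^+ 2); clear; lia.
have : u <= `|l * u|.
  rewrite normrM [`|u|]ger0_norm ?ler_peMl //; move: l0 uq; clear; lia.
by rewrite lu; move: uq q9 x9; clear; lia.
Qed.

(** By [sum_cubes_exponent], 2 b = 3 i + 2. For i = 0, b is 1 and y divides 8, which leads to
    [reduced_cubic_no_root]. For i > 0, w is even, so y is odd; as y divides 9^b - 1 and is a sign
    modulo 3^(2 i + 1), where b < 2 i + 1 <= 2 b, it is a sign, and [cube_plus_unit] concludes. *)
Lemma sum_cubes_3pow_no_line b c (y z : int) : (0 < b)%N -> (0 < c)%N ->
  coprimez y z -> ~~ (3 %| y)%Z -> ~~ (3 %| z)%Z ->
  y ^+ 3 + z ^+ 3 <> 9 ^+ b * (9 ^+ c * y + z) ^+ 3.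
Proof.
move=> b0 c0 cyz y3 z3 E; set w := _ * y + z in E.
have E9 : 9 ^+ b = 3 ^+ (2 * b) :> int by rewrite exprM.
have w3 : ~~ (3 %| w)%Z.
  apply: contra z3 => h; have -> : z = w - 9 ^+ c * y by rewrite /w; ring.
  apply: rpredB => //; rewrite -(prednK c0) exprS -!mulrA.
  by rewrite (_ : (9 : int) = 3 * 3) // -mulrA dvdz_mulr.
have yB : (y %| 9 ^+ b - 1)%Z.
  apply: (coprime_divisor_of_cubes cyz _ E).
  by apply/dvdzP; exists (- 9 ^+ c); rewrite /w; ring.
have czy : coprimez z y by rewrite coprimez_sym.
have E3 : z ^+ 3 + y ^+ 3 = 3 ^+ (2 * b) * w ^+ 3 by rewrite addrC -E9.
have [i [d [bi d2 yd]]] := sum_cubes_exponent czy z3 y3 w3 E3.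
have [i0|i0] := posnP i.
  have b1 : b = 1%N by move: bi; rewrite i0; clear; lia.
  move: yB E; rewrite b1 => /dvdzP[y' y'E] E.
  apply: (@reduced_cubic_no_root c.-1 (- (y' * w) - 9 ^+ c) (9 ^+ c)).
    by rewrite prednK.
  have yn : y ^+ 3 != 0 by rewrite expf_neq0 //; apply: contraNneq y3 => ->.
  apply: (mulfI yn); rewrite mulr0; move: E; rewrite {1}(_ : z = w - 9 ^+ c * y); last first.
    by rewrite /w; ring.
  move: (w) (9 ^+ c) => w' x; move/eqP; rewrite expr1 -subr_eq0 => /eqP E.
  have y8 : 8 = y' * y by rewrite -y'E.
  transitivity (64 * (y ^+ 3 + (w' - x * y) ^+ 3 - 9 * w' ^+ 3)); last by rewrite E mulr0.
  transitivity ((- (y' * y * w') - x * y) ^+ 3 - 27 * x ^+ 2 * (- (y' * y * w') - x * y) * y ^+ 2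
     - 90 * x ^+ 3 * y ^+ 3 + 64 * y ^+ 3); first ring.
  by rewrite -y8; ring.
have y2 : ~~ (2 %| y)%Z.
  apply/negP => y2; have w2 : (2 %| w)%Z.
    by apply: (sum_cubes_even _ czy z3 w3 E3); move: bi i0; clear; lia.
  by have := dvdz_gcd 2 y w; rewrite y2 w2 /w gcdzMDl (eqP cyz).
have [y' y'E] := dvdzP yB.
have y1 : y ^+ 2 = 1.
  apply: (@unit_divisor_mod3 b (2 * i).+1 y y' d) => //.
  - by move: bi i0; clear; lia.
  - by move: bi i0; clear; lia.
  - by rewrite y'E mulrC.
apply: (@cube_plus_unit (2 * b) z y w) => //.
by move: bi i0; clear; lia.
Qed.

(** * Rational roots of the cubic, by 3-adic valuations *)

Lemma exp3_valuation (x : int) : x != 0 ->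
  exists e q, x = 3 ^+ e * q /\ ~~ (3 %| q)%Z.
Proof.
move=> x0; have [|m cm mE] := @pfactor_coprime 3 `|x| isT; first by rewrite absz_gt0.
exists (logn 3 `|x|), (Num.sg x * m%:Z); split.
  rewrite {1}[x]intEsg {1}mE PoszM -[(3 ^ _)%N%:Z]natz natrX; ring.
have s3 : ~~ (3 %| Num.sg x)%Z by case: sgrP x0.
by rewrite dvd3M negb_or s3 /= dvdzE -prime_coprime.
Qed.

Lemma exp3_split d k : (d <= k)%N -> 3 ^+ k = 3 ^+ d * 3 ^+ (k - d) :> int.
Proof. by move=> dk; rewrite -exprD subnKC. Qed.

(** Write z = 3^e q with q prime to 3. The right-hand side has valuation larger than min(d, 3 e), so
    the two terms on the left have the same valuation d = 3 e, and division by 3^d gives the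
    equation of [sum_cubes_3pow_no_line] with c = e. *)
Lemma weighted_cubes_int b d (y z : int) : (0 < b)%N -> (0 < d)%N -> z != 0 ->
  coprimez y z -> 3 ^+ d * y ^+ 3 + z ^+ 3 <> 9 ^+ b * (3 ^+ d * y + z) ^+ 3.
Proof.
move=> b0 d0 z0 cyz E.
have T k : 3 ^+ k.+1 = 3 * 3 ^+ k :> int by rewrite exprS.
have z3 : (3 %| z)%Z.
  rewrite -(dvd3X _ 2) (_ : z ^+ 3 =
    9 ^+ b * (3 ^+ d * y + z) ^+ 3 - 3 ^+ d * y ^+ 3); last by rewrite -E; ring.
  rewrite -(prednK b0) -(prednK d0) T exprS -!mulrA (_ : (9 : int) = 3 * 3) // -mulrA.
  by apply: rpredB; exact: dvdz_mulr.
have [e [q [zE q3]]] := exp3_valuation z0.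
have e0 : (0 < e)%N.
  by case: e zE => // zE; move: z3; rewrite zE expr0 mul1r (negPf q3).
have y3 : ~~ (3 %| y)%Z.
  by apply/negP => y3; have := dvdz_gcd 3 y z; rewrite y3 z3 (eqP cyz).
have E9 : 9 ^+ b = 3 ^+ (b + b) :> int by rewrite exprD -exprMn.
(* t is the smaller of d and e; s may still be divisible by 3. *)
have [t [s [sE ht]]] : exists t s, 3 ^+ d * y + z = 3 ^+ t * s /\
    ((t = d /\ d <= e) \/ (t = e /\ e < d))%N.
  have [de|ed] := leqP d e.
    exists d, (y + 3 ^+ (e - d) * q); split; last by left.
    by rewrite mulrDr mulrA -exprD subnKC // -zE.
  exists e, (3 ^+ (d - e) * y + q); split; last by right.
  by rewrite mulrDr mulrA -exprD subnKC 1?ltnW // -zE.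
have {}E : 3 ^+ d * y ^+ 3 + 3 ^+ (3 * e) * q ^+ 3 = 3 ^+ (b + b + 3 * t) * s ^+ 3.
  by rewrite exprD -E9 mulnC exprM -exprMn -zE E sE exprMn -exprM mulnC mulrA.
have [|d3|dE] := ltngtP d (3 * e)%N.
- move=> d3; move: y3; rewrite -(dvd3X _ 2); apply/negP; rewrite negbK.
  have H1 : (d < b + b + 3 * t)%N by move: ht d3 b0; clear; lia.
  have -> : y ^+ 3 = 3 ^+ (b + b + 3 * t - d) * s ^+ 3 - 3 ^+ (3 * e - d) * q ^+ 3.
    have n3 : (3 ^+ d : int) != 0 by rewrite expf_neq0.
    apply: (mulfI n3); transitivity (3 ^+ (b + b + 3 * t) * s ^+ 3 - 3 ^+ (3 * e) * q ^+ 3).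
      by rewrite -E addrK.
    by rewrite (exp3_split (ltnW H1)) (exp3_split (ltnW d3)); ring.
  apply: rpredB; apply: dvdz_mulr.
    by rewrite -(prednK (n := b + b + 3 * t - d)) ?subn_gt0 // T dvdz_mulr.
  by rewrite -(prednK (n := 3 * e - d)) ?subn_gt0 // T dvdz_mulr.
- move: q3; rewrite -(dvd3X _ 2); apply/negP; rewrite negbK.
  have H1 : (3 * e < b + b + 3 * t)%N by move: ht d3 b0 e0; clear; lia.
  have -> : q ^+ 3 = 3 ^+ (b + b + 3 * t - 3 * e) * s ^+ 3 - 3 ^+ (d - 3 * e) * y ^+ 3.
    have n3 : (3 ^+ (3 * e) : int) != 0 by rewrite expf_neq0.
    apply: (mulfI n3); transitivity (3 ^+ (b + b + 3 * t) * s ^+ 3 - 3 ^+ d * y ^+ 3).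
      by rewrite -E addrC addKr.
    by rewrite (exp3_split (ltnW H1)) (exp3_split (ltnW d3)); ring.
  apply: rpredB; apply: dvdz_mulr.
    by rewrite -(prednK (n := b + b + 3 * t - 3 * e)) ?subn_gt0 // T dvdz_mulr.
  by rewrite -(prednK (n := d - 3 * e)) ?subn_gt0 // T dvdz_mulr.
have yq : coprimez y q by move: cyz; rewrite zE coprimezMr => /andP[].
apply: (sum_cubes_3pow_no_line b0 e0 yq y3 q3).
have n3 : (3 ^+ d : int) != 0 by rewrite expf_neq0.
have n3e : (3 ^+ e : int) != 0 by rewrite expf_neq0.
have te : t = e by move: ht dE e0; clear; lia.
have E9e : 9 ^+ e = 3 ^+ e * 3 ^+ e :> int by rewrite -exprMn.
have d3 : 3 ^+ d = 3 ^+ e * 3 ^+ e * 3 ^+ e :> int.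
  by rewrite dE -!exprD; congr (_ ^+ _); lia.
have ss : 9 ^+ e * y + q = s.
  by apply: (mulfI n3e); rewrite -[in RHS]te -sE zE d3 E9e; ring.
apply: (mulfI n3); rewrite ss; transitivity (3 ^+ (b + b + 3 * t) * s ^+ 3 : int).
  by rewrite -E -dE; ring.
by rewrite te -dE exprD -E9; ring.
Qed.

Lemma weighted_cubes_rat a b (x : rat) : (0 < b)%N -> (b < a)%N ->
  3 ^+ a * x ^+ 3 + 3 ^+ b <> (3 ^+ a * x + 3 ^+ b) ^+ 3.
Proof.
move=> b0 ba E.
have d0 : (0 < a - b)%N by rewrite subn_gt0.
apply: (@weighted_cubes_int b (a - b) (numq x) (denq x)) => //.
  by rewrite coprimezE coprime_num_den.
have h9 : (9 ^+ b)%:~R = 3 ^+ b * 3 ^+ b :> rat by rewrite rmorphXn /= -exprMn.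
have h3 : (3 ^+ (a - b))%:~R = 3 ^+ (a - b) :> rat by rewrite rmorphXn.
have aE : 3 ^+ a = 3 ^+ (a - b) * 3 ^+ b :> rat by rewrite -exprD subnK // ltnW.
have nb : 3 ^+ b != 0 :> rat by rewrite expf_neq0.
have nE := numqE x; move: h9 h3 aE nb nE E.
move: (9 ^+ b) (3 ^+ (a - b)) (3 ^+ b) (3 ^+ (a - b)) (3 ^+ a) (numq x) (denq x).
move=> t9 t3 B D A u v h9 h3 aE nb nE E; apply: (@intr_inj rat).
rewrite !(rmorphD, rmorphM, rmorphXn) /= h9 h3 nE.
apply: (mulfI nb); transitivity ((A * x ^+ 3 + B) * v%:~R ^+ 3); first by rewrite aE; ring.
by rewrite E aE; ring.
Qed.

(** * Products of linear forms *)

Section Counting.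
Variable T : eqType.
Implicit Types (f : T -> T) (s : seq T).

(** Orbits have length 1 or 3. Repetitions are allowed in s, so the induction removes one occurrence
    of each of x, f x and f (f x). *)
Lemma count_order3 f s : {in s, forall x, f (f (f x)) = x} ->
  perm_eq (map f s) s -> size s = count (fun x => f x == x) s %[mod 3].
Proof.
have [N] := ubnP (size s); elim: N s => // N IH s; rewrite ltnS => sN f3 fs.
have [all_fix|] := boolP (all (fun x => f x == x) s).
  by move: all_fix; rewrite all_count => /eqP ->.
rewrite -has_predC => /hasP[x xs /= fx].
have memf y : y \in s -> f y \in s by move=> ys; rewrite -(perm_mem fs) map_f.
have fxs := memf _ xs; have ffxs := memf _ fxs.
have f3x := f3 _ xs.
have fx_ffx : f x != f (f x).
  apply: contra fx => /eqP e; have := congr1 (f \o f) e.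
  by rewrite /= f3x => <-.
have x_ffx : x != f (f x).
  by apply: contra fx => /eqP e; rewrite {1}e f3x.
pose s3 := [:: x; f x; f (f x)].
pose s' := foldl (fun t y => rem y t) s s3.
have ss' : perm_eq s (s3 ++ s').
  rewrite /s' /=; apply: (perm_trans (perm_to_rem xs)); rewrite perm_cons.
  have fxs1 : f x \in rem x s.
    by move: fxs; rewrite (perm_mem (perm_to_rem xs)) inE (negPf fx).
  apply: (perm_trans (perm_to_rem fxs1)); rewrite perm_cons.
  apply: perm_to_rem; move: ffxs; rewrite (perm_mem (perm_to_rem xs)) inE eq_sym.
  by rewrite (negPf x_ffx) (perm_mem (perm_to_rem fxs1)) inE eq_sym (negPf fx_ffx).
have s's y : y \in s' -> y \in s by rewrite (perm_mem ss') mem_cat orbC => ->.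
have fs' : perm_eq (map f s') s'.
  have H1 : perm_eq (map f (s3 ++ s')) (s3 ++ s').
    by apply: perm_trans (perm_trans fs ss'); rewrite perm_sym; apply: perm_map.
  move: H1;rewrite map_cat => H2.
  have e3 : perm_eq (map f s3) s3.
    by rewrite /s3 /= f3x; rewrite (perm_rcons x [:: f x; f (f x)]) perm_refl.
  by rewrite -(perm_cat2l (map f s3)); apply: perm_trans H2 _; rewrite perm_cat2r perm_sym.
have c3 : count (fun x => f x == x) s3 = 0%N.
  by rewrite /= f3x (negPf fx) [f (f x) == _]eq_sym (negPf fx_ffx) (negPf x_ffx).
rewrite (perm_size ss') size_cat /= (seq.permP ss' (fun x => f x == x)) count_cat c3 add0n.
rewrite addnC modnDr; apply: IH => //; last by move=> y /s's /f3.
by move: sN; rewrite (perm_size ss') size_cat /=; apply: leq_trans; rewrite addSn ltnS leq_addl.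
Qed.

(** As the maps commute, [F a] permutes the points fixed by all of [As], and [count_order3] applies
    to them. *)
Lemma count_commuting_order3 (I : eqType) (F : I -> T -> T) (As : seq I) s :
    {in As, forall a, {in s, forall x, F a (F a (F a x)) = x}} ->
    {in As, forall a, perm_eq (map (F a) s) s} ->
    {in As &, forall a b, {in s, forall x, F a (F b x) = F b (F a x)}} ->
  size s = count (fun x => all (fun a => F a x == x) As) s %[mod 3].
Proof.
elim: As => [|a As IH] F3 Fs FC; first by rewrite count_predT.
have sub b : b \in As -> b \in a :: As by rewrite inE orbC => ->.
rewrite IH; first last.
- by move=> b c /sub ? /sub ?; apply: FC.
- by move=> b /sub /Fs.
- by move=> b /sub /F3.
have a0 := mem_head a As.
have memF b x : b \in a :: As -> x \in s -> F b x \in s.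
  by move=> bA xs; rewrite -(perm_mem (Fs b bA)) map_f.
pose p x := all (fun b => F b x == x) As.
have pF x : x \in s -> p (F a x) = p x.
  move=> xs; apply: eq_in_all => b /sub bA; rewrite FC //.
  apply/eqP/eqP => [e|->//].
  by have := congr1 (F a \o F a) e; rewrite /= !F3 // memF.
have c3 : {in [seq x <- s | p x], forall x, F a (F a (F a x)) = x}.
  by move=> x; rewrite mem_filter => /andP[_ xs]; apply: F3.
rewrite -size_filter (count_order3 c3) ?count_filter //.
have -> : [seq F a i | i <- [seq x <- s | p x]] = [seq x <- map (F a) s | p x].
  by rewrite filter_map; congr map; apply: eq_in_filter => x /pF /=.
by rewrite perm_filter // Fs.
Qed.
End Counting.

(* If q divides f it divides g, and is cancelled from both; otherwise g is constant. *)
Lemma size_dvd_irreducible (k K : fieldType) (i : {rmorphism k -> K})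
    (q f : {poly k}) (g h : {poly K}) N :
    irreducible_poly q -> f != 0 -> map_poly i f = g * h ->
    g %| map_poly i q ^+ N -> coprimep (map_poly i q) h ->
  ((size q).-1 %| (size g).-1)%N.
Proof.
move=> qI; have [M] := ubnP (size f); elim: M f g => // M IH f g.
rewrite ltnS => fM f0 E gN qh.
have irr := apply_irredp qI.
have q0 := irredp_neq0 qI.
have qK0 : map_poly i q != 0 by rewrite map_poly_eq0.
have fK0 : g * h != 0 by rewrite -E map_poly_eq0.
have [qf|nqf] := boolP (q %| f); last first.
  have cqf : coprimep q f.
    rewrite /coprimep; apply: contraNT nqf => sz.
    have /eqp_dvdl <- := irr _ sz (dvdp_gcdl q f); exact: dvdp_gcdr.
  have gg : coprimep g g.
    apply: (@coprimep_dvdl _ (g * h)); first exact: dvdp_mulr.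
    rewrite coprimep_sym; apply: (coprimep_dvdl gN); rewrite coprimep_sym.
    by apply: coprimep_expl; rewrite -E coprimep_map.
  by move: gg; rewrite coprimepp => /eqP ->; exact: dvdn0.
have /dvdpP[f' fE] := qf.
have /dvdpP[g' gE] : map_poly i q %| g.
  by rewrite -(Gauss_dvdpl g qh) -E dvdp_map.
have E' : map_poly i f' = g' * h.
  by move: E; rewrite fE rmorphM gE /= mulrAC => /(mulIf qK0).
have f'0 : f' != 0 by apply: contraNneq f0 => e; rewrite fE e mul0r.
have g'0 : g' != 0.
  by apply: contraNneq fK0 => e; rewrite gE e !mul0r.
have g'N : g' %| map_poly i q ^+ N by apply: dvdp_trans gN; rewrite gE dvdp_mulr.
have sf' : (size f' < M)%N.
  apply: leq_trans fM; rewrite fE size_mul //.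
  have := qI.1; have : (0 < size f')%N by rewrite size_poly_gt0.
  move: (size f') (size q).
  by clear; lia.
have := IH f' g' sf' f'0 E' g'N qh.
rewrite gE size_mul // size_map_poly.
have : (0 < size g')%N by rewrite size_poly_gt0.
have := qI.1; case: (size g') (size q) => [//|m] [//|l] _ _ /=.
by rewrite addnS /= => H; rewrite dvdn_addl.
Qed.

Lemma mpoly_rmorph_eq (n : nat) (R S : comNzRingType) (f g : {rmorphism {mpoly R[n]} -> S}) :
  (forall c, f c%:MP = g c%:MP) -> (forall i, f 'X_i = g 'X_i) -> f =1 g.
Proof.
move=> fgC fgX p; rewrite (mpolyE p) !rmorph_sum; apply: eq_bigr => m _.
rewrite -mul_mpolyC !rmorphM fgC; congr (_ * _).
rewrite mpolyXE_id !rmorph_prod; apply: eq_bigr => i _.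
by rewrite !rmorphXn fgX.
Qed.

(** * Linear forms and unique factorisation of their products *)

Section LinearForm.
Variables (n : nat) (R : comNzRingType).
Implicit Types (v w : 'rV[R]_n).

Definition lform v : {mpoly R[n]} := \sum_i v 0 i *: 'X_i.

Lemma lform_is_linear : linear lform.
Proof.
move=> a v w; rewrite /lform scaler_sumr -big_split; apply: eq_bigr => i _ /=.
by rewrite !mxE scalerDl scalerA.
Qed.

HB.instance Definition _ := GRing.isLinear.Build R 'rV[R]_n {mpoly R[n]} _ lform lform_is_linear.

Lemma mcoeff_lform v i : (lform v)@_U_(i) = v 0 i.
Proof.
rewrite raddf_sum (bigD1 i) //= mcoeffZ mcoeffXU eqxx mulr1 big1 ?addr0 // => j ji.
by rewrite mcoeffZ mcoeffXU (negPf ji) mulr0.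
Qed.

Lemma lform_eq0 v : (lform v == 0) = (v == 0).
Proof.
apply/eqP/eqP => [e|->]; last exact: linear0.
by apply/rowP => i; rewrite -mcoeff_lform e mcoeff0 mxE.
Qed.

Lemma mmap_lform (S : comNzRingType) (f : {rmorphism R -> S}) (h : 'I_n -> S) v :
  mmap f h (lform v) = \sum_i f (v 0 i) * h i.
Proof.
rewrite rmorph_sum; apply: eq_bigr => i _.
by rewrite -mul_mpolyC rmorphM /= mmapC mmapX mmap1U.
Qed.

Lemma msym_lform (s : 'S_n) v : msym s (lform v) = lform (col_perm s^-1 v).
Proof.
rewrite raddf_sum /= [RHS](reindex_inj (@perm_inj _ s)); apply: eq_bigr => i _.
rewrite msymZ mxE permK; congr (_ *: _).
by rewrite /msym mmapX mmap1U.
Qed.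

End LinearForm.

Lemma map_lform n (R S : comNzRingType) (f : {rmorphism R -> S}) (v : 'rV[R]_n) :
  map_mpoly f (lform v) = lform (map_mx f v).
Proof.
rewrite rmorph_sum; apply: eq_bigr => i _.
by rewrite -mul_mpolyC rmorphM /= map_mpolyC map_mpolyX mxE mul_mpolyC.
Qed.

Section Normalisation.
Variables (n : nat) (K : fieldType).
Implicit Types (v w : 'rV[K]_n).

(** A representative of the projective point of v: the coordinate made equal to 1 depends only on
    the support of v. *)
Definition nrm v : 'rV[K]_n :=
  if [pick i | v 0 i != 0] is Some i then (v 0 i)^-1 *: v else v.

Lemma nrm_scale v : exists2 c, c != 0 & nrm v = c *: v.
Proof.
rewrite /nrm; case: pickP => [i vi|_]; last by exists 1; rewrite ?oner_neq0 ?scale1r.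
by exists (v 0 i)^-1; rewrite ?invr_eq0.
Qed.

Lemma nrmZ c v : c != 0 -> nrm (c *: v) = nrm v.
Proof.
move=> c0; rewrite /nrm.
have e i : ((c *: v) 0 i != 0) = (v 0 i != 0) by rewrite mxE mulf_eq0 (negPf c0).
rewrite (eq_pick e).
case: (pickP (fun i => v 0 i != 0)) => [i vi|h].
  by rewrite mxE scalerA invfM mulrAC mulVf // mul1r.
by apply/rowP => i; move/negbFE/eqP: (h i) => vi; rewrite mxE vi mulr0.
Qed.

Lemma nrm_eq0 v : (nrm v == 0) = (v == 0).
Proof. by have [c c0 ->] := nrm_scale v; rewrite scaler_eq0 (negPf c0). Qed.

Lemma nrm_nrm v : nrm (nrm v) = nrm v.
Proof. by have [c c0 e] := nrm_scale v; rewrite {1}e nrmZ. Qed.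

Lemma row_neq0 v : v != 0 -> exists i, v 0 i != 0.
Proof.
move=> v0; apply/existsP; apply: contraNT v0; rewrite negb_exists => /forallP h.
by apply/eqP/rowP => i; rewrite mxE; apply/eqP; rewrite -[_ == _]negbK.
Qed.

(** The substitution h kills exactly the multiples of [lform v] among the linear forms, so one
    factor of the product is such a multiple. *)
Lemma lform_prime v (t : seq 'rV[K]_n) (q : {mpoly K[n]}) c : v != 0 -> c != 0 ->
  lform v * q = c *: \prod_(w <- t) lform w -> exists2 w, w \in t & exists a, w = a *: v.
Proof.
move=> /row_neq0[i vi] c0 E.
pose h (j : 'I_n) : {mpoly K[n]} := 'X_j - ((j == i)%:R / v 0 i) *: lform v.
have hE w : mmap (@mpolyC n K) h (lform w) = lform (w - (w 0 i / v 0 i) *: v).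
  rewrite mmap_lform linearB linearZ /= [lform w]/lform.
  transitivity (\sum_j (w 0 j *: 'X_j - (w 0 j * ((j == i)%:R / v 0 i)) *: lform v)).
    by apply: eq_bigr => j _; rewrite mul_mpolyC /h scalerBr scalerA.
  rewrite sumrB; congr (_ - _); rewrite -scaler_suml; congr (_ *: _).
  rewrite (bigD1 i) //= eqxx mul1r big1 ?addr0 // => j /negPf ->.
  by rewrite mul0r mulr0.
have := congr1 (mmap (@mpolyC n K) h) E.
rewrite rmorphM /= hE divff // scale1r subrr linear0 mul0r.
rewrite -mul_mpolyC rmorphM /= mmapC rmorph_prod => /esym/eqP.
rewrite mulf_eq0 mpolyC_eq0 (negPf c0) /= prodf_seq_eq0 => /hasP[w wt /=].
by rewrite hE lform_eq0 subr_eq0 => /eqP e; exists w => //; exists (w 0 i / v 0 i).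
Qed.

(** Unique factorisation, proportional forms being identified through [nrm]. *)
Lemma lform_prod_unique (s t : seq 'rV[K]_n) c d :
    c != 0 -> d != 0 -> 0 \notin s -> 0 \notin t ->
    c *: \prod_(v <- s) lform v = d *: \prod_(v <- t) lform v ->
  perm_eq (map nrm s) (map nrm t).
Proof.
elim: s t c d => [|v s IH] t c d c0 d0.
  case: t => [|w t] // _ _; rewrite big_nil => /(congr1 (meval (fun _ => 0))).
  rewrite !mevalZ meval1 big_cons mevalM {2}/lform rmorph_sum big1 ?mul0r ?mulr0 ?mulr1.
    by move=> e; rewrite e eqxx in c0.
  by move=> i _; rewrite /= mevalZ mevalXU mulr0.
rewrite inE negb_or eq_sym => /andP[v0 s0] t0 E.
have [w wt [a wE]] : exists2 w, w \in t & exists a, w = a *: v.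
  apply: (@lform_prime v t (c *: \prod_(v <- s) lform v) d) => //.
  by rewrite -E big_cons scalerAr.
have w0 : w != 0 by apply: contraNneq t0 => <-.
have a0 : a != 0 by apply: contraNneq w0 => a0; rewrite wE a0 scale0r.
have tE := perm_to_rem wt.
apply: (perm_trans (y := map nrm (w :: rem w t))); last first.
  by rewrite perm_sym; apply: perm_map.
rewrite /= wE nrmZ // -wE perm_cons; apply: (IH _ c (d * a)) => //.
- by rewrite mulf_neq0.
- by apply: contra t0 => /mem_rem.
apply: (@mulfI _ (lform v)); first by rewrite lform_eq0.
by move: E; rewrite big_cons (perm_big _ tE) /= big_cons {1}wE linearZ /= -scalerAl scalerA -!scalerAr.
Qed.

End Normalisation.

(** w is taken on the moment curve (1, t, t^2, ...) with t a natural number: each v gives a nonzero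
    polynomial in t, and their product has finitely many roots. *)
Lemma generic_vector n (k : fieldType) (i : {rmorphism k -> algC}) (vs : seq 'rV[algC]_n) :
  0 \notin vs -> exists w : 'rV[k]_n, all (fun v : 'rV_n => \sum_j v 0 j * i (w 0 j) != 0) vs.
Proof.
move=> vs0; pose p : {poly algC} := \prod_(v <- vs) rVpoly v.
have p0 : p != 0.
  rewrite prodf_seq_neq0; apply/allP => v vvs /=.
  apply: contraNneq vs0 => e; rewrite -[v]rVpolyK e linear0 in vvs.
  by rewrite -(_ : poly_rV 0 = 0 :> 'rV[algC]_n) ?linear0.
have [t pt] : exists t : nat, p.[t%:R] != 0.
  have : ~~ all (root p) [seq (t : nat)%:R | t <- iota 0 (size p)].
    apply/negP => /(max_poly_roots p0); rewrite size_map size_iota ltnn.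
    by rewrite map_inj_uniq ?iota_uniq => [/(_ isT)|x y /eqP]; rewrite // eqr_nat => /eqP.
  by rewrite -has_predC => /hasP[_ /mapP[t _ ->]] h; exists t.
exists (\row_j t%:R ^+ j); apply/allP => v vvs.
move: pt; rewrite horner_prod prodf_seq_neq0 => /allP /(_ v vvs) /=.
rewrite -{1}[v]rVpolyK /= (horner_coef_wide _ (size_poly _ _)).
congr (_ != _); apply: eq_bigr => j _; rewrite mxE rmorphXn rmorph_nat; congr (_ * _).
by rewrite coef_rVpoly_ord rVpolyK.
Qed.

(* The translations of F_3^k1, F_3^k2 and F_3^k3, extended by the identity to
   the other two blocks. *)
Record block_translations n (sz : 'I_3 -> nat) := BlockTranslations {
  blk : 'I_n -> 'I_3;
  trs : seq 'S_n;
  card_blk : forall b, #|[pred i | blk i == b]| = sz b;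
  trs_comm : {in trs &, forall s t, (s * t = t * s)%g};
  trs_order : {in trs, forall s, (s * s * s = 1)%g};
  trs_blk : {in trs, forall (s : 'S_n) i, blk (s i) = blk i};
  trs_trans : forall i j, blk i = blk j -> exists2 s, s \in trs &
    s i = j /\ forall l, blk l != blk i -> s l = l }.

Section FixedVectors.
Variables (n : nat) (sz : 'I_3 -> nat) (B : block_translations n sz).
Implicit Types x : 'rV[algC]_n.

Lemma sum_blocks (g : 'I_3 -> algC) : \sum_i g (blk B i) = \sum_b (sz b)%:R * g b.
Proof.
rewrite (partition_big (blk B) predT) //=; apply: eq_bigr => b _.
rewrite (eq_bigr (fun _ => g b)) => [|i /eqP -> //].
by rewrite sumr_const -(card_blk B) mulr_natl; congr (_ *+ _); apply: eq_card.
Qed.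

(* A translation scales x by 1 as soon as it fixes an index where x is nonzero, and
   a nonzero x cannot live on a single block, where its cubes agree. *)
Lemma fixed_block_constant x : (forall b, (0 < sz b)%N) -> x != 0 ->
    \sum_i x 0 i ^+ 3 = 0 ->
    {in trs B, forall s : 'S_n, exists c, forall i, x 0 (s i) = c * x 0 i} ->
  forall i j, blk B i = blk B j -> x 0 i = x 0 j.
Proof.
move=> sz0 x0 x3 fx i j ij.
have [s sB [<- sl]] := trs_trans ij; have [c xc] := fx s sB.
rewrite xc; have [->|c1] := eqVneq c 1; first by rewrite mul1r.
exfalso; move/eqP: x0; apply.
have out l : blk B l != blk B i -> x 0 l = 0.
  move=> /sl e; have := xc l; rewrite e => /eqP; rewrite -subr_eq0 -{1}[x 0 l]mul1r -mulrBl.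
  by rewrite mulf_eq0 subr_eq0 eq_sym (negPf c1) => /eqP.
have inb l : blk B l = blk B i -> x 0 l ^+ 3 = x 0 i ^+ 3.
  move=> li; have [t tB [<- _]] := trs_trans (esym li); have [d xd] := fx t tB.
  have [/eqP d0|d0] := boolP (x 0 i == 0); first by rewrite xd d0 mulr0.
  have d3 : d ^+ 3 = 1.
    have e3 : t (t (t i)) = i by rewrite -!permM mulgA (trs_order tB) perm1.
    have : x 0 (t (t (t i))) = d * (d * (d * x 0 i)) by rewrite !xd.
    by rewrite e3 => e; apply: (mulIf d0); rewrite mul1r [RHS]e; ring.
  by rewrite xd exprMn d3 mul1r.
have xi : x 0 i = 0.
  move: x3; rewrite (bigID (fun l => blk B l == blk B i)) /= [X in _ + X]big1 ?addr0 => [|l /out ->].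
    rewrite (eq_bigr (fun _ => x 0 i ^+ 3)) => [|l /eqP /inb //].
    rewrite sumr_const (eq_card (B := [pred l | blk B l == blk B i])) // card_blk.
    by move/eqP; rewrite mulrn_eq0 expf_eq0 /= eqn0Ngt sz0 => /eqP.
  by rewrite expr0n.
apply/rowP => l; rewrite mxE; have [e|/out //] := eqVneq (blk B l) (blk B i).
by have /eqP := inb l e; rewrite xi expr0n expf_eq0 => /eqP.
Qed.
End FixedVectors.

Section WeightedCubic.
Variable R : comNzRingType.
Implicit Types (u w x : R).

(** The sum of the cubes of the values x, 1 and - (u x + w), counted with weights u, w and 1, for
    which the weighted sum of the values is 0. *)
Definition weighted_cubic u w : {poly R} :=
  u *: 'X^3 + w%:P - (u *: 'X + w%:P) ^+ 3.

Lemma horner_weighted_cubic u w x :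
  (weighted_cubic u w).[x] = u * x ^+ 3 + w - (u * x + w) ^+ 3.
Proof. by rewrite /weighted_cubic !hornerE. Qed.

Lemma size_weighted_cubic u w : u - u ^+ 3 != 0 -> size (weighted_cubic u w) = 4.
Proof.
move=> ne0.
have -> : weighted_cubic u w = Poly [:: w - w ^+ 3; - (3 * u * w ^+ 2);
    - (3 * u ^+ 2 * w); u - u ^+ 3].
  rewrite /= !cons_poly_def mul0r add0r /weighted_cubic -!mul_polyC.
  by rewrite !(polyCB, polyCN, polyCM, polyC_exp, polyC_natr); ring.
by rewrite (PolyK (c := 0)).
Qed.
End WeightedCubic.

Lemma map_weighted_cubic (R S : comNzRingType) (f : {rmorphism R -> S}) u w :
  map_poly f (weighted_cubic u w) = weighted_cubic (f u) (f w).
Proof.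
by rewrite /weighted_cubic rmorphB rmorphD rmorphXn rmorphD /= !map_polyZ !map_polyC
   map_polyXn map_polyX.
Qed.

Definition block_size k1 k2 k3 (b : 'I_3) : nat := (3 ^ nth 0 [:: k1; k2; k3] b)%N.

Section ChowForm.
Variables (k1 k2 k3 : nat).
Hypotheses (k12 : (k2 < k1)%N) (k23 : (k3 < k2)%N).
Local Notation sz := (block_size k1 k2 k3).
Variables (n : nat) (B : block_translations n sz).
Let a := (k1 - k3)%N.
Let b := (k2 - k3)%N.
Let o1 : 'I_3 := lift ord0 ord0.
Let o2 : 'I_3 := lift ord0 (lift ord0 ord0).

(* line t is the blockwise constant vector with values t, 1 and -(3^a t + 3^b). *)
Let base (R : nzRingType) (j : 'I_3) : R := nth 0 [:: 0; 1; - 3 ^+ b] j.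
Let slope (R : nzRingType) (j : 'I_3) : R := nth 0 [:: 1; 0; - 3 ^+ a] j.
Let line (t : algC) : 'rV[algC]_n :=
  \row_i (base algC (blk B i) + t * slope algC (blk B i)).

Let sz_gt0 j : (0 < sz j)%N. Proof. by rewrite expn_gt0. Qed.

Let ex_rep j : exists i, blk B i == j.
Proof.
have : (0 < #|[pred i | blk B i == j]|)%N by rewrite card_blk.
by case/card_gt0P => i /=; exists i.
Qed.

Let rep j := xchoose (ex_rep j).
Let repE j : blk B (rep j) = j. Proof. exact/eqP/(xchooseP (ex_rep j)). Qed.
Local Notation i1 := (rep o1).

Let pow_neq0 m : (3 : algC) ^+ m != 0. Proof. by rewrite expf_neq0 // pnatr_eq0. Qed.

Let lead_neq0 : (3 : algC) ^+ a - (3 ^+ a) ^+ 3 != 0.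
Proof.
rewrite -exprM -!natrX subr_eq0 eqr_nat eqn_exp2l // neq_ltn ltn_Pmulr //.
by rewrite subn_gt0 (ltn_trans k23).
Qed.

(** Divided by 3^k3, the two sums become sums over the blocks with weights 3^a, 3^b and 1. If the
    value on the second block were 0, then the value y0 on the first one would satisfy (3^a - 3^(3
    a)) y0^3 = 0, and x would be 0. *)
Let line_shape (x : 'rV[algC]_n) : x != 0 -> \sum_i x 0 i = 0 -> \sum_i x 0 i ^+ 3 = 0 ->
    (forall i j, blk B i = blk B j -> x 0 i = x 0 j) ->
  x 0 i1 != 0 /\ exists2 t, root (weighted_cubic (3 ^+ a) (3 ^+ b)) t & x = x 0 i1 *: line t.
Proof.
move=> x0 sx sx3 xc; pose y j := x 0 (rep j).
have xy i : x 0 i = y (blk B i) by apply: xc; rewrite repE.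
have U : (3 ^+ k1 : algC) = 3 ^+ a * 3 ^+ k3 by rewrite -exprD subnK // ltnW // (ltn_trans k23).
have W : (3 ^+ k2 : algC) = 3 ^+ b * 3 ^+ k3 by rewrite -exprD subnK // ltnW.
have szE (z0 z1 z2 : algC) : 3 ^+ k1 * z0 + (3 ^+ k2 * z1 + 3 ^+ k3 * z2) = 0 ->
    z2 = - (3 ^+ a * z0 + 3 ^+ b * z1).
  rewrite U W => e; apply: (mulfI (pow_neq0 k3)); apply: subr0_eq; rewrite -[RHS]e; ring.
have e1 : y o2 = - (3 ^+ a * y ord0 + 3 ^+ b * y o1).
  apply: szE; rewrite -[RHS]sx (eq_bigr _ (fun i _ => xy i)) (sum_blocks B).
  by rewrite !big_ord_recl big_ord0 addr0 /block_size /= !natrX.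
have e3 : y o2 ^+ 3 = - (3 ^+ a * y ord0 ^+ 3 + 3 ^+ b * y o1 ^+ 3).
  apply: szE; rewrite -[RHS]sx3 (eq_bigr (fun i => y (blk B i) ^+ 3)) => [|i _]; last by rewrite xy.
  rewrite (sum_blocks B (fun j => y j ^+ 3)).
  by rewrite !big_ord_recl big_ord0 addr0 /block_size /= !natrX.
have y1 : y o1 != 0.
  apply: contraNneq x0 => y1; move: e1 e3; rewrite y1 => e1 e3.
  have y0 : y ord0 = 0.
    have /eqP : (3 ^+ a - (3 ^+ a) ^+ 3) * y ord0 ^+ 3 = 0.
      by transitivity (- (- (3 ^+ a * y ord0 ^+ 3 + 3 ^+ b * 0 ^+ 3) - y o2 ^+ 3));
        [rewrite e1|rewrite e3]; ring.
    by rewrite mulf_eq0 (negPf lead_neq0) expf_eq0 => /eqP.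
  apply/eqP/rowP => i; rewrite xy mxE.
  case: (blk B i) => -[|[|[|//]]] hj.
  - by rewrite -[RHS]y0; congr y; apply: val_inj.
  - by rewrite -[RHS]y1; congr y; apply: val_inj.
  transitivity (y o2); first by congr y; apply: val_inj.
  by rewrite e1 y0 !mulr0 addr0 oppr0.
split=> //; exists (y ord0 / y o1).
  rewrite rootE horner_weighted_cubic; apply/eqP.
  apply: (mulfI (_ : y o1 ^+ 3 != 0)); first by rewrite expf_neq0.
  transitivity (3 ^+ a * y ord0 ^+ 3 + 3 ^+ b * y o1 ^+ 3 + y o2 ^+ 3).
    by rewrite e1; field.
  by rewrite e3; ring.
apply/rowP => i; rewrite !mxE xy -/(y o1) /base /slope.
case: (blk B i) => -[|[|[|//]]] hj /=.
- by rewrite add0r mulr1 mulrC divfK //; congr y; apply: val_inj.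
- by rewrite mulr0 addr0 mulr1; congr y; apply: val_inj.
transitivity (y o2); first by congr y; apply: val_inj.
by rewrite e1; field.
Qed.

Let act (s : 'S_n) (x : 'rV[algC]_n) := nrm (col_perm s^-1 x).

Let nrm_col_perm s (x : 'rV[algC]_n) : nrm (col_perm s (nrm x)) = nrm (col_perm s x).
Proof. by have [c c0 ->] := nrm_scale x; rewrite linearZ nrmZ. Qed.

Let actM s t x : act s (act t x) = act (t * s) x.
Proof. by rewrite /act nrm_col_perm invMg col_permM. Qed.

Variables (k : fieldType) (iota : {rmorphism k -> algC}).
Hypothesis irr : irreducible_poly (weighted_cubic (3 ^+ a) (3 ^+ b) : {poly k}).
Local Notation q := (weighted_cubic (3 ^+ a) (3 ^+ b)).

Let mapq : map_poly iota q = q.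
Proof. by rewrite map_weighted_cubic !rmorphXn !rmorph_nat. Qed.

Let sizeq : size (q : {poly algC}) = 4. Proof. exact: size_weighted_cubic lead_neq0. Qed.

(** By unique factorisation the translations permute the projective points of s, so that the size of
    s is congruent to the number of fixed points. A specialisation of Psi to one variable turns
    these into a factor dividing a power of q, and the other points into a factor prime to q;
    [size_dvd_irreducible] then makes 3, the degree of q, divide the number of fixed points. *)
Lemma chow_form_degree (Psi : {mpoly k[n]}) (s : seq 'rV[algC]_n) c : c != 0 ->
    {in s, forall x : 'rV[algC]_n, [/\ x != 0, \sum_i x 0 i = 0 & \sum_i x 0 i ^+ 3 = 0]} ->
    \prod_(x <- s) lform x = c *: map_mpoly iota Psi ->
    {in trs B, forall t : 'S_n, exists2 d, d != 0 & msym t Psi = d *: Psi} ->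
  (3 %| size s)%N.
Proof.
(* For normalised vectors, equality of projective points is equality of vectors. *)
wlog sn : s c / {in s, forall x : 'rV[algC]_n, nrm x = x}.
  move=> H c0 sX sE Psi_sym; rewrite -(size_map (@nrm n algC)).
  have [d d0 dE] : exists2 d, d != 0 &
      \prod_(x <- map (@nrm n algC) s) lform x = d *: \prod_(x <- s) lform x.
    elim: s {sX sE} => [|x s [d d0 IH]] /=.
      by exists 1; rewrite ?oner_neq0 // !big_nil scale1r.
    have [e e0 eE] := nrm_scale x; exists (e * d); first by rewrite mulf_neq0.
    by rewrite !big_cons IH eE linearZ -scalerAl -scalerAr scalerA.
  apply: (H _ (d * c)) => //.
  - by move=> _ /mapP[x _ ->]; rewrite nrm_nrm.
  - by rewrite mulf_neq0.
  - move=> _ /mapP[x /sX[x0 x1 x3] ->]; rewrite nrm_eq0; have [e e0 ->] := nrm_scale x.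
    split=> //.
      by under eq_bigr do rewrite mxE; rewrite -mulr_sumr x1 mulr0.
    by under eq_bigr do rewrite mxE exprMn; rewrite -mulr_sumr x3 mulr0.
  by rewrite dE sE scalerA.
move=> c0 sX sE Psi_sym.
have s0 : 0 \notin s by apply/negP => /sX[/eqP].
have act_perm : {in trs B, forall t, perm_eq (map (act t) s) s}.
  move=> t tB; have [d d0 dE] := Psi_sym t tB.
  have -> : map (act t) s = map (@nrm n algC) (map (col_perm t^-1) s) by rewrite -map_comp.
  have snE : map (@nrm n algC) s = s by rewrite map_id_in.
  rewrite -[X in perm_eq _ X]snE.
  apply: (@lform_prod_unique _ _ _ _ 1 (iota d)); rewrite ?oner_neq0 ?fmorph_eq0 //.
    apply/negP => /mapP[x xs] /(congr1 (col_perm t)); rewrite -col_permM mulgV col_perm1.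
    by rewrite linear0 => x0; move: s0; rewrite x0 xs.
  rewrite scale1r big_map (eq_bigr (fun x => msym t (lform x))) => [|x _]; last by rewrite msym_lform.
  rewrite -rmorph_prod /= sE msymZ scalerA mulrC -scalerA; congr (_ *: _).
  rewrite -mul_mpolyC -map_mpolyC -rmorphM /= mul_mpolyC -dE.
  by apply/mpolyP => m; rewrite mcoeff_sym !mcoeff_map_mpoly mcoeff_sym.
pose p x := all (fun t => act t x == x) (trs B).
have sz_fix : size s = count p s %[mod 3].
  apply: count_commuting_order3 => // [t tB x xs|t u tB uB x xs].
    by rewrite !actM mulgA (trs_order tB) /act invg1 col_perm1 sn.
  by rewrite !actM (trs_comm tB uB).
pose s1 := filter p s; pose s2 := filter (predC p) s.
have sub1 : {subset s1 <= s} by move=> x; rewrite mem_filter => /andP[].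
have sub2 : {subset s2 <= s} by move=> x; rewrite mem_filter => /andP[].
have s1_shape (x : 'rV[algC]_n) : x \in s1 ->
    x 0 i1 != 0 /\ exists2 t, root q t & x = x 0 i1 *: line t.
  rewrite mem_filter => /andP[px /sX[x0 x1 x3]]; apply: line_shape => //.
  apply: fixed_block_constant => // t tB.
  have /eqP := allP px t tB; rewrite /act.
  have [d d0 ->] := nrm_scale (col_perm t^-1 x) => e; exists d => i.
  by rewrite -{1}e !mxE permK.
have s2_shape (x : 'rV[algC]_n) t : x \in s2 -> x - x 0 i1 *: line t != 0.
  rewrite mem_filter => /andP[/= npx xs]; apply: contra npx; rewrite subr_eq0 => /eqP xE.
  apply/allP => u uB; rewrite /act; suff -> : col_perm u^-1 x = x by rewrite sn.
  apply/rowP => i; rewrite mxE xE !mxE.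
  suff -> : blk B ((u^-1)%g i) = blk B i by [].
  by rewrite -[in RHS](permKV u i) (trs_blk uB).
have [r qE] := closed_field_poly_normal (q : {poly algC}).
have q0 : (q : {poly algC}) != 0 by rewrite -size_poly_gt0 sizeq.
have rootr t : root q t -> t \in r.
  by rewrite qE rootZ ?lead_coef_eq0 // root_prod_XsubC.
pose sl : 'rV[algC]_n := \row_i slope algC (blk B i).
(* The condition on sl makes the polynomial V below of degree 1; the others say that, for x not
   fixed, its image g x does not vanish at the roots of q. *)
have [w] : exists w : 'rV[k]_n, all (fun v : 'rV_n => \sum_j v 0 j * iota (w 0 j) != 0)
    (sl :: [seq x - x 0 i1 *: line t | x : 'rV[algC]_n <- s2, t <- r]).
  apply: generic_vector; rewrite inE negb_or; apply/andP; split.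
    apply/eqP => /rowP /(_ (rep ord0)); rewrite !mxE repE => /esym/eqP.
    by rewrite oner_eq0.
  by apply/negP => /allpairsP[[x t] [/= /(s2_shape x t) + _ e]]; rewrite -e eqxx.
move=> /= /andP[w_sl /allP w_s2].
pose V : {poly k} := \sum_j w 0 j *: ((base k (blk B j))%:P + slope k (blk B j) *: 'X).
(* Evaluation at w - V e_i1, where V = (line 'X . w): the form of a fixed point
   with parameter t becomes a multiple of 'X - t, and, w being generic, the forms
   of the other points become prime to q. *)
pose h i : {poly k} := (w 0 i)%:P - (i == i1)%:R *: V.
pose dot (x : 'rV[algC]_n) := \sum_j x 0 j * iota (w 0 j).
pose lb : 'rV[algC]_n := \row_i base algC (blk B i).
have VE : map_poly iota V = (dot lb)%:P + dot sl *: 'X.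
  rewrite rmorph_sum /= /dot rmorph_sum scaler_suml -big_split; apply: eq_bigr => j _ /=.
  rewrite map_polyZ rmorphD /= map_polyC map_polyZ map_polyX scalerDr !mxE scalerA.
  rewrite -mul_polyC -polyCM ![iota (w 0 j) * _]mulrC /base /slope.
  by case: (blk B j) => -[|[|[|//]]] ? /=;
    rewrite ?rmorphN ?rmorphXn ?rmorph_nat ?rmorph0 ?rmorph1.
pose g (x : 'rV[algC]_n) : {poly algC} := (dot x)%:P - x 0 i1 *: map_poly iota V.
have gE x : mmap (@polyC algC) (map_poly iota \o h) (lform x) = g x.
  rewrite mmap_lform /g /dot rmorph_sum /=.
  transitivity (\sum_j ((x 0 j * iota (w 0 j))%:P - (j == i1)%:R * x 0 j *: map_poly iota V)).
    apply: eq_bigr => j _; rewrite rmorphB /= map_polyC map_polyZ rmorph_nat mulrBr -polyCM.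
    by rewrite !mul_polyC scalerA [_ * x 0 j]mulrC.
  rewrite sumrB -scaler_suml; congr (_ - _ *: _).
  rewrite (bigD1 i1) //= eqxx mul1r big1 ?addr0 // => j /negPf ->.
  by rewrite mul0r.
pose f : {poly k} := mmap (@polyC k) h Psi.
have fE : map_poly iota f = mmap (@polyC algC) (map_poly iota \o h) (map_mpoly iota Psi).
  rewrite /f; apply: (mpoly_rmorph_eq (f := map_poly iota \o mmap (@polyC k) h)
    (g := mmap (@polyC algC) (map_poly iota \o h) \o map_mpoly iota)) => [d|i] /=.
    by rewrite map_mpolyC !mmapC map_polyC.
  by rewrite map_mpolyX !mmapX !mmap1U.
have gs : \prod_(x <- s) g x = c *: map_poly iota f.
  rewrite fE -mul_polyC -(mmapC (map_poly iota \o h)) -rmorphM /= mul_mpolyC -sE rmorph_prod.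
  by apply: eq_bigr => x _ /=; rewrite gE.
have g1 x : x \in s1 -> exists2 t, root q t & exists2 d, d != 0 & g x = d *: ('X - t%:P).
  move=> /s1_shape[x1 [t qt xE]]; exists t => //; exists (- (x 0 i1 * dot sl)).
    by rewrite oppr_eq0 mulf_neq0.
  have dx : dot x = x 0 i1 * (dot lb + t * dot sl).
    rewrite {1}xE /dot mulrDr !mulr_sumr -big_split; apply: eq_bigr => j _ /=.
    by rewrite !mxE; ring.
  by rewrite /g dx VE -!mul_polyC !(polyCN, polyCM, polyCD); ring.
have g2 x : x \in s2 -> coprimep q (g x).
  move=> xs; apply/Pdiv.ClosedField.coprimepP => t qt.
  have := w_s2 _ (allpairs_f (fun (x : 'rV[algC]_n) t => x - x 0 i1 *: line t) xs (rootr t qt)).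
  congr (_ != _); transitivity (dot x - x 0 i1 * (dot lb + t * dot sl)).
    rewrite /dot mulrDr !mulr_sumr -big_split -sumrB; apply: eq_bigr => j _ /=.
    by rewrite !mxE; ring.
  by rewrite /g VE !hornerE; ring.
have q_root : exists t, root (q : {poly algC}) t by apply/closed_rootP; rewrite sizeq.
have split_s : \prod_(x <- s) g x = \prod_(x <- s1) g x * \prod_(x <- s2) g x.
  by rewrite !big_filter (bigID p).
have [G1N G1s] : \prod_(x <- s1) g x %| q ^+ size s1 /\
    size (\prod_(x <- s1) g x) = (size s1).+1.
  elim: (s1) g1 => [_|x t IH g1]; first by rewrite !big_nil size_poly1 dvd1p.
  have [|tN ts] := IH; first by move=> y yt; apply: g1; rewrite inE yt orbT.
  have [z qz [d d0 gx]] := g1 x (mem_head _ _).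
  rewrite big_cons /= exprS; split.
    by rewrite dvdp_mul // gx dvdpZl // dvdp_XsubCl.
  rewrite size_mul ?ts; last by rewrite -size_poly_gt0 ts.
    by rewrite gx size_scale // size_XsubC.
  by rewrite gx scaler_eq0 negb_or d0 polyXsubC_eq0.
have G2 : coprimep q (\prod_(x <- s2) g x).
  elim: (s2) g2 => [_|x t IH g2]; first by rewrite big_nil coprimep1.
  rewrite big_cons coprimepMr g2 ?mem_head // IH // => y yt.
  by apply: g2; rewrite inE yt orbT.
have f0 : f != 0.
  rewrite -(map_poly_eq0 iota); suff : c *: map_poly iota f != 0.
    by rewrite scaler_eq0 negb_or => /andP[].
  rewrite -gs split_s mulf_neq0 //; first by rewrite -size_poly_gt0 G1s.
  have [t qt] := q_root; apply: contraTneq G2 => ->.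
  by rewrite coprimep0 -size_poly_eq1 sizeq.
have := @size_dvd_irreducible _ _ iota _ f (\prod_(x <- s1) g x)
  (c^-1 *: \prod_(x <- s2) g x) (size s1) irr f0.
rewrite mapq -scalerAr -split_s gs scalerA mulVf // scale1r coprimepZr ?invr_eq0 //.
move=> /(_ erefl G1N G2); rewrite G1s (size_weighted_cubic _) /=.
  by move=> d3; rewrite /dvdn sz_fix -size_filter -/s1.
rewrite -(fmorph_eq0 iota) rmorphB !rmorphXn rmorph_nat; exact: lead_neq0.
Qed.

End ChowForm.

(** * Construction of the block translations *)

Section Translations.
Variables k1 k2 k3 : nat.
Local Notation V k := 'rV['F_3]_k.
Local Notation T := (V k1 + V k2 + V k3)%type.

(** A vector v translates only the summand that contains it. *)
Let tr (v w : T) : T :=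
  match v, w with
  | inl (inl v), inl (inl w) => inl (inl (w + v))
  | inl (inr v), inl (inr w) => inl (inr (w + v))
  | inr v, inr w => inr (w + v)
  | _, _ => w
  end.

Let part (w : T) : 'I_3 :=
  match w with inl (inl _) => ord0 | inl (inr _) => lift ord0 ord0 | inr _ => ord_max end.

Let trC u v w : tr u (tr v w) = tr v (tr u w).
Proof. by move: u v w => [[u|u]|u] [[v|v]|v] [[w|w]|w] //=; rewrite addrAC. Qed.

Let addF3 k (u v : V k) : u + v + v + v = u.
Proof.
apply/rowP => i; rewrite !mxE -!addrA [X in _ + X](_ : _ = (v 0 i) *+ 3).
  by rewrite -mulr_natr (_ : 3%:R = 0 :> 'F_3) ?mulr0 ?addr0 //; apply: val_inj.
by rewrite !mulrS mulr0n addr0.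
Qed.

Let tr3 v w : tr v (tr v (tr v w)) = w.
Proof. by move: v w => [[v|v]|v] [[w|w]|w] //=; rewrite addF3. Qed.

Let tr_inj v : injective (tr v).
Proof. exact: can_inj (fun w => tr v (tr v w)) (tr3 v). Qed.

Let tr_part v w : part (tr v w) = part w.
Proof. by move: v w => [[v|v]|v] [[w|w]|w]. Qed.

Let tr_trans u w : part u = part w ->
  exists v, tr v u = w /\ forall l, part l != part u -> tr v l = l.
Proof.
move: u w => [[u|u]|u] [[w|w]|w] //= _.
- by exists (inl (inl (w - u))) => /=; rewrite addrC subrK; split=> // -[[l|l]|l].
- by exists (inl (inr (w - u))) => /=; rewrite addrC subrK; split=> // -[[l|l]|l].
- by exists (inr (w - u)) => /=; rewrite addrC subrK; split=> // -[[l|l]|l].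
Qed.

Let card_V k : #|{: V k}| = (3 ^ k)%N.
Proof. by rewrite card_mx card_Fp // mul1n. Qed.

Let cardT : #|{: T}| = (3 ^ k1 + 3 ^ k2 + 3 ^ k3)%N.
Proof. by rewrite !card_sum !card_V. Qed.

Let card_part b : #|[pred w : T | part w == b]| = block_size k1 k2 k3 b.
Proof.
have H k (f : V k -> T) : injective f -> (forall w, reflect (exists v, w = f v) (part w == b)) ->
    #|[pred w : T | part w == b]| = (3 ^ k)%N.
  move=> f_inj h; rewrite -card_V -(card_codom f_inj); apply: eq_card => w.
  by rewrite inE; apply/h/codomP.
rewrite /block_size; case: b H => -[|[|[|//]]] hb H /=.
- apply: (H _ (fun v => inl (inl v))) => [u v []//|[[w|w]|w]]; constructor;
    by [exists w|case].
- apply: (H _ (fun v => inl (inr v))) => [u v []//|[[w|w]|w]]; constructor;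
    by [exists w|case].
- apply: (H _ inr) => [u v []//|[[w|w]|w]]; constructor; by [exists w|case].
Qed.

Lemma block_translations_exist n : n = (3 ^ k1 + 3 ^ k2 + 3 ^ k3)%N ->
  inhabited (block_translations n (block_size k1 k2 k3)).
Proof.
move=> nE; pose phi (i : 'I_n) : T := enum_val (cast_ord (etrans nE (esym cardT)) i).
pose psi (w : T) : 'I_n := cast_ord (esym (etrans nE (esym cardT))) (enum_rank w).
have phiK : cancel phi psi by move=> i; rewrite /phi /psi enum_valK cast_ordK.
have psiK : cancel psi phi by move=> w; rewrite /phi /psi cast_ordKV enum_rankK.
have inj v : injective (psi \o tr v \o phi).
  exact: inj_comp (inj_comp (can_inj psiK) (@tr_inj v)) (can_inj phiK).
pose s v := perm (inj v).
have sE v i : s v i = psi (tr v (phi i)) by rewrite permE.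
constructor; apply: (@BlockTranslations _ _ (part \o phi) [seq s v | v : T]).
- move=> b; rewrite -card_part -(card_image (can_inj psiK)); apply: eq_card => i.
  rewrite !inE; apply/eqP/imageP => [<-|[w /eqP <- ->] /=]; last by rewrite psiK.
  by exists (phi i); rewrite ?inE ?phiK.
- move=> _ _ /imageP[u _ ->] /imageP[v _ ->]; apply/permP => i.
  by rewrite !permM !sE !psiK trC.
- move=> _ /imageP[v _ ->]; apply/permP => i.
  by rewrite !permM !sE !psiK tr3 phiK perm1.
- by move=> _ /imageP[v _ ->] i; rewrite sE /= psiK tr_part.
move=> i j /= /tr_trans[v [vi vl]]; exists (s v); first exact: image_f.
split=> [|l /vl e]; first by rewrite sE vi phiK.
by rewrite sE e phiK.
Qed.
End Translations.

(** * Places *)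

Section Place.
Variables (W : fieldType) (C : closedFieldType).
Implicit Types (G : W -> C -> Prop).

(* The graph of a ring morphism from a subring of W to C. *)
Record ring_graph G : Prop := RingGraph {
  graph1 : G 1 1;
  graphB : forall x y x' y', G x y -> G x' y' -> G (x - x') (y - y');
  graphM : forall x y x' y', G x y -> G x' y' -> G (x * x') (y * y');
  graph_fun0 : forall y, G 0 y -> y = 0 }.

(** The domain of G is a local ring whose maximal ideal is the kernel. *)
Definition graph_local G := forall x y, G x y -> y != 0 -> G x^-1 y^-1.

Section Graph.
Variables (G : W -> C -> Prop) (rG : ring_graph G).

Lemma graph0 : G 0 0.
Proof. by have := graphB rG (graph1 rG) (graph1 rG); rewrite !subrr. Qed.

Lemma graphN x y : G x y -> G (- x) (- y).
Proof. by move=> /(graphB rG graph0); rewrite !sub0r. Qed.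

Lemma graphD x y x' y' : G x y -> G x' y' -> G (x + x') (y + y').
Proof. by move=> xy /graphN /(graphB rG xy); rewrite !opprK. Qed.

Lemma graph_fun x y y' : G x y -> G x y' -> y = y'.
Proof.
by move=> /(graphB rG) h /h; rewrite subrr => /(graph_fun0 rG)/subr0_eq.
Qed.

Lemma graph_sum (I : Type) (r : seq I) (P : pred I) (f : I -> W) (g : I -> C) :
  (forall i, P i -> G (f i) (g i)) -> G (\sum_(i <- r | P i) f i) (\sum_(i <- r | P i) g i).
Proof.
move=> h; elim/big_rec2: _ => [|i y x Pi]; first exact: graph0.
exact/graphD/h.
Qed.

Lemma graphX x y i : G x y -> G (x ^+ i) (y ^+ i).
Proof.
move=> xy; elim: i => [|i IH]; first exact: graph1 rG.
by rewrite !exprS; apply: graphM.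
Qed.

(** The extension of G to the localisation of its domain at the kernel. *)
Definition graph_loc x y := exists a b a' b',
  [/\ G a a', G b b', b' != 0, x = a / b & y = a' / b'].

Lemma graph_neq0 b b' : G b b' -> b' != 0 -> b != 0.
Proof. by move=> h; apply: contraNneq => b0; rewrite b0 in h; rewrite (graph_fun0 rG h). Qed.

Lemma graph_loc_ring : ring_graph graph_loc.
Proof.
split.
- by exists 1, 1, 1, 1; rewrite !divr1; split=> //; [exact: graph1|exact: graph1|exact: oner_neq0].
- move=> x y x' y' [a [b [a' [b' [aa bb b0 -> ->]]]]] [c [d [c' [d' [cc dd d0 -> ->]]]]].
  exists (a * d - c * b), (b * d), (a' * d' - c' * b'), (b' * d'); split.
  + by apply: graphB => //; apply: graphM.
  + exact: graphM.
  + by rewrite mulf_neq0.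
  + by rewrite -mulNr addf_div ?mulNr // (graph_neq0 bb, graph_neq0 dd).
  + by rewrite -mulNr addf_div ?mulNr.
- move=> x y x' y' [a [b [a' [b' [aa bb b0 -> ->]]]]] [c [d [c' [d' [cc dd d0 -> ->]]]]].
  exists (a * c), (b * d), (a' * c'), (b' * d'); split; rewrite ?mulf_div ?mulf_neq0 //.
  + exact: graphM.
  + exact: graphM.
- move=> y [a [b [a' [b' [aa bb b0 /esym/eqP + ->]]]]].
  rewrite mulf_eq0 invr_eq0 (negPf (graph_neq0 bb b0)) orbF => /eqP a0.
  by rewrite a0 in aa; rewrite (graph_fun0 rG aa) mul0r.
Qed.

Lemma graph_loc_local : graph_local graph_loc.
Proof.
move=> x y [a [b [a' [b' [aa bb b0 -> ->]]]]].
rewrite mulf_eq0 invr_eq0 negb_or => /andP[a0 _].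
by exists b, a, b', a'; rewrite !invf_div.
Qed.

Lemma graph_loc_sub x y : G x y -> graph_loc x y.
Proof.
move=> h; exists x, 1, y, 1; rewrite !divr1; split=> //; first exact: graph1.
exact: oner_neq0.
Qed.

Definition pgraph (p : {poly W}) (p' : {poly C}) := forall i, G p`_i p'`_i.

Lemma pgraphC x y : G x y -> pgraph x%:P y%:P.
Proof. by move=> h i; rewrite !coefC; case: eqP => // _; exact: graph0. Qed.

Lemma pgraphX i : pgraph 'X^i 'X^i.
Proof.
move=> j; rewrite !coefXn; case: eqP => _ /=; [exact: graph1|exact: graph0].
Qed.

Lemma pgraphB p p' q q' : pgraph p p' -> pgraph q q' -> pgraph (p - q) (p' - q').
Proof. by move=> hp hq i; rewrite !coefB; apply: graphB. Qed.

Lemma pgraphM p p' q q' : pgraph p p' -> pgraph q q' -> pgraph (p * q) (p' * q').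
Proof.
by move=> hp hq i; rewrite !coefM; apply: graph_sum => j _; apply: graphM.
Qed.

Hypothesis lG : graph_local G.

(* If both m R[x] and m R[1/x] contained 1, a relation of minimal degree could be shortened. *)
Lemma graph_no_two_relations x (p r : {poly W}) : x != 0 ->
  (forall i, G p`_i 0) -> (forall i, G r`_i 0) -> p.[x] = 1 -> r.[x^-1] = 1 -> False.
Proof.
have [N] := ubnP (size p + size r); elim: N x p r => // N IH x p r; rewrite ltnS => sN x0.
wlog rp : x p r sN x0 / (size r <= size p)%N.
  move=> H pm rm px rx; have [rp|/ltnW pr] := leqP (size r) (size p); first exact: H px rx.
  by apply: (H x^-1 r p); rewrite ?invr_eq0 ?invrK // addnC.
move=> pm rm px rx.
have no_const (y : W) (q : {poly W}) : (forall i, G q`_i 0) -> q.[y] = 1 -> (1 < size q)%N.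
  move=> qm qy; rewrite ltnNge; apply/negP => /size1_polyC qE.
  move: qy (qm 0%N); rewrite {1}qE hornerC => -> h.
  by have := graph_fun (graph1 rG) h => /eqP; rewrite oner_eq0.
have sp := no_const _ _ pm px; have sr := no_const _ _ rm rx.
case spE: (size p) sp sN rp => [//|n] n0 sN rn.
pose r0 := 1 - r`_0.
have r0m : G r0 1.
  by have := graphB rG (graph1 rG) (rm 0%N); rewrite subr0.
have r0n : r0 != 0 by apply: graph_neq0 r0m _; exact: oner_neq0.
have r0V : G r0^-1 1 by have := lG r0m (oner_neq0 _); rewrite invr1.
have mM a b b' : G a 0 -> G b b' -> G (a * b) 0.
  by move=> ha hb; have := graphM rG ha hb; rewrite mul0r.
(* The relation r, multiplied by x^n, gives r0 x^n as the sum of the r_(n - i) x^i for i < n; p1 is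
   p with its leading term rewritten by it. *)
pose p1 := \poly_(i < n) (p`_i + p`_n * (r`_(n - i) * r0^-1)).
apply: (IH x p1 r) => //.
- apply: leq_trans sN; rewrite ltn_add2r ltnS; exact: size_poly.
- move=> i; rewrite coef_poly; case: ifP => _; last exact: graph0.
  rewrite -[X in G _ X]addr0; apply: graphD => //; apply: (mM _ _ 0) => //.
  exact: mM r0V.
- have xn : x ^+ n != 0 by rewrite expf_neq0.
  have E : \sum_(i < n) r`_(n - i) * x ^+ i = r0 * x ^+ n.
    have := rx; rewrite (horner_coef_wide _ rn) big_ord_recl expr0 mulr1 => /eqP.
    rewrite eq_sym addrC -subr_eq => /eqP; rewrite -/r0 => ->.
    rewrite mulr_suml (reindex_inj rev_ord_inj) /=; apply: eq_bigr => i _.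
    rewrite /bump /= add1n subKn // -mulrA exprVn; congr (_ * _).
    have xi : x ^+ i.+1 != 0 by rewrite expf_neq0.
    by apply: (mulfI xi); rewrite mulrA mulfV // mul1r -exprD subnKC.
  rewrite horner_poly -[RHS]px horner_coef spE big_ord_recr /=.
  rewrite (eq_bigr (fun i : 'I_n => p`_i * x ^+ i + p`_n * r0^-1 * (r`_(n - i) * x ^+ i))).
    by rewrite big_split -mulr_sumr E mulrA mulfVK.
  by move=> i _; ring.
Qed.
End Graph.
End Place.

Lemma min_nat_ex (P : nat -> Prop) : (exists n, P n) ->
  exists n, P n /\ forall m, P m -> (n <= m)%N.
Proof.
move=> [n Pn]; elim/ltn_ind: n Pn => n IH Pn.
have [[m [Pm mn]]|h] := Classical_Prop.classic (exists m, P m /\ (m < n)%N).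
  exact: IH mn Pm.
exists n; split=> // m Pm; rewrite leqNgt; apply/negP => mn.
by apply: h; exists m.
Qed.

Section PlaceExtension.
Variables (W : fieldType) (C : closedFieldType).
Implicit Types (G : W -> C -> Prop).

Definition decided G x := (exists y, G x y) \/ (exists y, G x^-1 y).
(* No extension of G can be defined at x. *)
Definition obstructed G x := exists p p',
  [/\ pgraph G p p', p.[x] = 0 & size p' = 1%N].

(** Among the nonzero reductions of polynomials vanishing at x, one of least degree is not constant,
    as x is not obstructed. A root y of it is a root of all of them, by Euclidean division carried
    out on p and p' at once. If all reductions vanish, any y will do. *)
Lemma common_root G x : ring_graph G -> graph_local G -> ~ obstructed G x ->
  exists y, forall p p', pgraph G p p' -> p.[x] = 0 -> p'.[y] = 0.
Proof.
move=> rG lG nobs.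
have [|all0] := Classical_Prop.classic (exists n p p',
    [/\ pgraph G p p', p.[x] = 0, p' != 0 & size p' = n]); last first.
  exists 0 => p p' pp px; have [->|p0] := eqVneq p' 0; first exact: horner0.
  by case: all0; exists (size p'), p, p'.
move=> /min_nat_ex[m [[p0 [p0' [pp0 p0x p0n sp0]]] min]].
have s1 : size p0' != 1%N by apply/eqP => e; apply: nobs; exists p0, p0'.
have [y yE] := closed_rootP _ s1; exists y.
move=> p p'; have [N] := ubnP (size p'); elim: N p p' => // N IH p p'.
rewrite ltnS => sN pp px; have [->|pn] := eqVneq p' 0; first exact: horner0.
have ms : (m <= size p')%N by apply: min; exists p, p'.
(* The degrees are those of the reductions: p and p0 may have higher terms, with coefficients
   reducing to 0. *)
pose l := p`_(size p').-1 / p0`_(size p0').-1.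
pose l' := lead_coef p' / lead_coef p0'.
have ll : G l l' by apply: graphM => //; apply: lG; rewrite ?lead_coef_eq0 //; exact: pp0.
pose d := (size p' - size p0')%N.
have E : (p' - (l'%:P * 'X^d) * p0').[y] = 0.
  apply: (IH (p - (l%:P * 'X^d) * p0)).
  - have s0 : size p' != 0%N by rewrite size_poly_eq0.
    apply: leq_trans sN; rewrite -[X in (_ < X)%N]prednK ?lt0n // ltnS.
    apply/leq_sizeP => j; rewrite leq_eqVlt => /predU1P[<-|jp].
      rewrite coefB -mulrA coefCM coefXnM ltnNge.
      have -> : (d <= (size p').-1)%N.
        by rewrite /d sp0; have : (0 < m)%N; [rewrite -sp0 size_poly_gt0|]; lia.
      have -> : ((size p').-1 - d = (size p0').-1)%N by rewrite /d sp0; lia.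
      by rewrite -!lead_coefE /l' divfK ?subrr // lead_coef_eq0.
    have jp' : (size p' <= j)%N by move: jp s0; clear; lia.
    rewrite coefB nth_default // -mulrA coefCM coefXnM; case: ifP => jd; first by rewrite mulr0 subr0.
    by rewrite nth_default ?mulr0 ?subr0 // sp0; move: jp' ms; rewrite /d sp0; clear; lia.
  - apply: pgraphB => //; apply: pgraphM => //; apply: pgraphM => //.
      exact: pgraphC.
    exact: pgraphX.
  - by rewrite hornerD hornerN !hornerM px p0x mulr0 subrr.
by move/rootP: yE => yE; move: E; rewrite hornerD hornerN hornerM yE mulr0 subr0.
Qed.

Definition adjoin_graph G x y z w := exists p p',
  [/\ pgraph G p p', z = p.[x] & w = p'.[y]].

Lemma adjoin_graph_ring G x y : ring_graph G ->
  (forall p p', pgraph G p p' -> p.[x] = 0 -> p'.[y] = 0) -> ring_graph (adjoin_graph G x y).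
Proof.
move=> rG h; split.
- exists 1, 1; rewrite !hornerC; split=> //.
  by have := pgraphC rG (graph1 rG); rewrite !polyC1.
- move=> _ _ _ _ [p [p' [pp -> ->]]] [r [r' [rr -> ->]]].
  exists (p - r), (p' - r'); rewrite !hornerD !hornerN; split=> //.
  exact: pgraphB.
- move=> _ _ _ _ [p [p' [pp -> ->]]] [r [r' [rr -> ->]]].
  exists (p * r), (p' * r'); rewrite !hornerM; split=> //.
  exact: pgraphM.
by move=> w [p [p' [pp /esym px ->]]]; apply: h px.
Qed.

Lemma extend_unobstructed G x : ring_graph G -> graph_local G -> ~ obstructed G x ->
  exists G', [/\ ring_graph G', graph_local G', forall z w, G z w -> G' z w &
    exists y, G' x y].
Proof.
move=> rG lG /(common_root rG lG)[y hy].
have rA := adjoin_graph_ring rG hy.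
exists (graph_loc (adjoin_graph G x y)); split.
- exact: graph_loc_ring.
- exact: graph_loc_local.
- move=> z w zw; apply: (graph_loc_sub rA); exists z%:P, w%:P.
  by rewrite !hornerC; split=> //; apply: pgraphC.
exists y; apply: (graph_loc_sub rA); exists 'X, 'X; rewrite !hornerX; split=> //.
by have := pgraphX rG 1; rewrite !expr1.
Qed.

(** A polynomial p vanishing at x reduces to a nonzero constant, so p_0 is a unit and 1 - p / p_0
    has all its coefficients in the maximal ideal. *)
Lemma obstructed_relation G x : ring_graph G -> graph_local G -> obstructed G x ->
  exists p : {poly W}, (forall i, G p`_i 0) /\ p.[x] = 1.
Proof.
move=> rG lG [p [p' [pp px /eqP/size_poly1P[c c0 p'E]]]].
have p0 : G p`_0 c by have := pp 0%N; rewrite p'E coefC.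
have p0n := graph_neq0 rG p0 c0.
exists (1 - (p`_0)^-1 *: p); split; last by rewrite !hornerE px mulr0 subr0.
move=> i; rewrite coefB coefZ coef1; case: i => [|i] /=.
  by rewrite mulVf // subrr; exact: graph0.
rewrite -[X in G _ X](subrr 0); apply: graphB => //; first exact: graph0.
rewrite -(mulr0 c^-1); apply: graphM => //; first exact: lG.
by have := pp i.+1; rewrite p'E coefC.
Qed.

(** Chevalley's extension of places, one element at a time: obstructions at both x and its inverse
    would give the two relations that [graph_no_two_relations] excludes. *)
Lemma extend_decide G x : ring_graph G -> graph_local G ->
  exists G', [/\ ring_graph G', graph_local G', forall z w, G z w -> G' z w & decided G' x].
Proof.
move=> rG lG; have [x0|x0] := eqVneq x 0.
  by exists G; split=> //; left; exists 0; rewrite x0; exact: graph0.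
have [ox|nox] := Classical_Prop.classic (obstructed G x); last first.
  have [G' [r l s [y xy]]] := extend_unobstructed rG lG nox.
  by exists G'; split=> //; left; exists y.
have [oy|noy] := Classical_Prop.classic (obstructed G x^-1); last first.
  have [G' [r l s [y xy]]] := extend_unobstructed rG lG noy.
  by exists G'; split=> //; right; exists y.
have [p [pm px]] := obstructed_relation rG lG ox.
have [r [rm rx]] := obstructed_relation rG lG oy.
by case: (graph_no_two_relations rG lG x0 pm rm px rx).
Qed.

Lemma extend_decide_seq G (xs : seq W) : ring_graph G -> graph_local G ->
  exists G', [/\ ring_graph G', graph_local G', forall z w, G z w -> G' z w &
    {in xs, forall x, decided G' x}].
Proof.
elim: xs G => [|x xs IH] G rG lG; first by exists G; split.
have [G1 [r1 l1 s1 d1]] := extend_decide x rG lG.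
have [G2 [r2 l2 s2 d2]] := IH G1 r1 l1.
exists G2; split=> // [z w /s1/s2 //|z]; rewrite inE => /predU1P[->|/d2 //].
by case: d1 => -[y /s2 h]; [left|right]; exists y.
Qed.
End PlaceExtension.

(** * The place given by leading coefficients *)

Section InitialPlace.
Variables (n : nat) (k W : fieldType) (C : closedFieldType).
Variables (iota : {rmorphism {mpoly k[n]} -> W}) (kappa : {rmorphism k -> C}).
Hypothesis iota_inj : injective iota.

(* The pairs f / g |-> f_m / g_m, with m a common bound of the leading monomials. *)
Definition lead_graph (x : W) (y : C) := exists f g (m : 'X_{1..n}),
  [/\ (mlead f <= m)%O, (mlead g <= m)%O, g@_m != 0, x = iota f / iota g &
      y = kappa (f@_m / g@_m)].

(** The coefficients at bounds m and m' of the leading monomials multiply to the coefficient of the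
    product at m + m'. A numerator with leading monomial below m is sent to 0. *)
Lemma lead_graphP : ring_graph lead_graph /\ graph_local lead_graph.
Proof.
have i0 (g : {mpoly k[n]}) m : g@_m != 0 -> iota g != 0.
  by move=> h; rewrite (raddf_eq0 _ iota_inj); apply: contraNneq h => ->; rewrite mcoeff0.
have M_le (f g : {mpoly k[n]}) m m' : (mlead f <= m)%O -> (mlead g <= m')%O ->
    (mlead (f * g) <= (m + m')%MM)%O.
  move=> h h'; apply: le_trans (mleadM_le _ _) _.
  by apply: le_trans (_ : ((mlead f + m')%MM <= _)%O); rewrite ?lemc_add2l ?lemc_add2r.
split; first split.
- exists 1, 1, 0%MM; rewrite mlead1 mcoeff1 eqxx oner_neq0 divr1 rmorph1 divr1 rmorph1.
  by split.
- move=> _ _ _ _ [f [g [m [fm gm gn -> ->]]]] [f' [g' [m' [fm' gm' gn' -> ->]]]].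
  exists (f * g' - f' * g), (g * g'), (m + m')%MM; split.
  + apply: le_trans (mleadB_le _ _) _; rewrite leUx M_le //=.
    by rewrite addmC M_le.
  + exact: M_le.
  + by rewrite mleadcMW // mulf_neq0.
  + rewrite -[- (iota f' / _)]mulNr addf_div ?(i0 _ _ gn) ?(i0 _ _ gn') //.
    by rewrite mulNr -!rmorphM -rmorphB.
  + have e : (f' * g)@_(m + m') = f'@_m' * g@_m by rewrite addmC mleadcMW.
    rewrite -rmorphB mcoeffB e !mleadcMW //.
    by rewrite -[- (f'@_m' / _)]mulNr addf_div // mulNr.
- move=> _ _ _ _ [f [g [m [fm gm gn -> ->]]]] [f' [g' [m' [fm' gm' gn' -> ->]]]].
  exists (f * f'), (g * g'), (m + m')%MM; split; rewrite ?M_le //.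
  + by rewrite mleadcMW // mulf_neq0.
  + by rewrite !rmorphM mulf_div.
  + by rewrite -rmorphM !mleadcMW // mulf_div.
- move=> y [f [g [m [fm gm gn /esym/eqP + ->]]]].
  rewrite mulf_eq0 invr_eq0 (negPf (i0 _ _ gn)) orbF (raddf_eq0 _ iota_inj) => /eqP ->.
  by rewrite mcoeff0 mul0r rmorph0.
move=> _ _ [f [g [m [fm gm gn -> ->]]]].
rewrite fmorph_eq0 mulf_eq0 invr_eq0 (negPf gn) orbF => fn.
by exists g, f, m; split; rewrite ?invf_div // -fmorphV invf_div.
Qed.
End InitialPlace.

Lemma total_rel_max (I : eqType) (le : I -> I -> Prop) (r : seq I) :
    (forall i, i \in r -> le i i) ->
    {in r &, forall i j, le i j \/ le j i} ->
    {in r & &, forall i j l, le i j -> le j l -> le i l} -> (0 < size r)%N ->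
  exists2 i0, i0 \in r & {in r, forall i, le i i0}.
Proof.
elim: r => // i [|j r] IH lexx tot tr _.
  by exists i; rewrite ?mem_head // => l; rewrite inE => /eqP ->; apply: lexx; rewrite mem_head.
have sub l : l \in j :: r -> l \in i :: j :: r.
  by move=> h; rewrite inE h orbT.
have [|||//|i0 i0r max] := IH.
- by move=> l /sub; apply: lexx.
- by move=> l m /sub hl /sub; apply: tot.
- by move=> l m p /sub hl /sub hm /sub; apply: tr.
have hi := mem_head i (j :: r).
have [h|h] := tot i i0 hi (sub _ i0r).
  by exists i0; rewrite ?sub // => l; rewrite inE => /predU1P[->//|/max].
exists i => // l; rewrite inE => /predU1P[->|lr]; first exact: lexx.
exact: (tr l i0 i (sub _ lr) (sub _ i0r) hi (max _ lr) h).
Qed.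

(** * Reduction of isotropic vectors and of their linear forms *)

Section Forms.
Variables (W : fieldType) (C : closedFieldType) (N : nat).
Variables (G : W -> C -> Prop) (rG : ring_graph G).

Definition mgraph (p : {mpoly W[N]}) (p' : {mpoly C[N]}) := forall i, G p@_i p'@_i.

Lemma mgraph1 : mgraph 1 1.
Proof. by move=> i; rewrite !mcoeff1; case: eqP => _; [apply: graph1|apply: graph0]. Qed.

Lemma mgraphM p p' q q' : mgraph p p' -> mgraph q q' -> mgraph (p * q) (p' * q').
Proof.
by move=> hp hq i; rewrite !mcoeffM; apply: graph_sum => // j _; apply: graphM.
Qed.

Lemma mgraphZ a a' p p' : G a a' -> mgraph p p' -> mgraph (a *: p) (a' *: p').
Proof. by move=> ha hp i; rewrite !mcoeffZ; apply: graphM. Qed.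

Lemma mgraph_lform (v : 'rV_N) (v' : 'rV_N) : (forall i, G (v 0 i) (v' 0 i)) -> mgraph (lform v) (lform v').
Proof.
move=> h m; rewrite /lform !raddf_sum; apply: graph_sum => // i _ /=.
rewrite !mcoeffZ !mcoeffX; apply: graphM => //.
by case: (_ == _); [apply: graph1|apply: graph0].
Qed.

Lemma mgraph_fun p q q' : mgraph p q -> mgraph p q' -> q = q'.
Proof. by move=> h h'; apply/mpolyP => i; apply: graph_fun (h i) (h' i). Qed.

Definition isotropic (K : fieldType) (v : 'rV[K]_N) :=
  [/\ v != 0, \sum_i v 0 i = 0 & \sum_i v 0 i ^+ 3 = 0].

(* Divide v by a coordinate whose quotients with the others reduce to finite values. *)
Lemma reduce_vector (v : 'rV[W]_N) : isotropic v ->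
    (forall i j, decided G (v 0 i / v 0 j)) ->
  exists e (v' : 'rV[C]_N), [/\ e != 0, isotropic v' & forall i, G (e * v 0 i) (v' 0 i)].
Proof.
move=> [v0 v1 v3] dec; have [i vi] := row_neq0 v0.
pose le i j := exists y, G (v 0 i / v 0 j) y.
have [||||j0 j0r max] := @total_rel_max _ le [seq i <- enum 'I_N | v 0 i != 0].
- move=> j; rewrite mem_filter => /andP[vj _]; exists 1; rewrite divff //; exact: graph1.
- by move=> j l _ _; case: (dec j l) => -[y h]; [left|right]; exists y => //; rewrite -invf_div.
- move=> j l p _; rewrite mem_filter => /andP[vl _] _ [y hy] [z hz]; exists (y * z).
  have -> : v 0 j / v 0 p = (v 0 j / v 0 l) * (v 0 l / v 0 p) by rewrite mulrA divfK.
  exact: graphM.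
- by rewrite -has_predT; apply/hasP; exists i; rewrite // mem_filter vi mem_enum.
have vj0 : v 0 j0 != 0 by move: j0r; rewrite mem_filter => /andP[].
have all_le j : exists y, G ((v 0 j0)^-1 * v 0 j) y.
  have [->|vj] := eqVneq (v 0 j) 0; first by exists 0; rewrite mulr0; apply: graph0.
  have [|y h] := max j; first by rewrite mem_filter vj mem_enum.
  by exists y; rewrite mulrC.
have [f fE] := fin_all_exists all_le.
exists (v 0 j0)^-1, (\row_j f j); split; first by rewrite invr_eq0.
  split.
  - apply/eqP => /rowP /(_ j0); rewrite !mxE => f0; have := fE j0.
    by rewrite mulVf // f0 => /(graph_fun rG (graph1 rG)) /eqP; rewrite oner_eq0.
  - under eq_bigr do rewrite mxE.
    apply: (graph_fun0 rG); rewrite -(mulr0 (v 0 j0)^-1) -v1 mulr_sumr.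
    exact: graph_sum.
  - under eq_bigr do rewrite mxE.
    apply: (graph_fun0 rG); rewrite -(mulr0 ((v 0 j0)^-1 ^+ 3)) -v3 mulr_sumr.
    by apply: graph_sum => // i' _; rewrite -exprMn; apply: graphX.
by move=> j; rewrite mxE.
Qed.

Lemma reduce_forms (P : seq 'rV[W]_N) :
    {in P, forall v, isotropic v} ->
    {in P, forall v : 'rV[W]_N, forall i j, decided G (v 0 i / v 0 j)} ->
  exists e s, [/\ e != 0, size s = size P, {in s, forall v, isotropic v} &
    mgraph (e *: \prod_(v <- P) lform v) (\prod_(v <- s) lform v)].
Proof.
elim: P => [|v P IH] iso dec.
  by exists 1, [::]; rewrite oner_neq0 scale1r !big_nil; split=> //; apply: mgraph1.
have [||e [s [e0 ss sI sG]]] := IH.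
- by move=> w wP; apply: iso; rewrite inE wP orbT.
- by move=> w wP; apply: dec; rewrite inE wP orbT.
have [d [v' [d0 v'I v'G]]] := reduce_vector (iso v (mem_head _ _)) (dec v (mem_head _ _)).
exists (d * e), (v' :: s); split; rewrite ?mulf_neq0 //=; first by rewrite ss.
  by move=> w; rewrite inE => /predU1P[->|/sI].
rewrite !big_cons -scalerA scalerAr scalerAl; apply: mgraphM => //.
by rewrite -linearZ; apply: mgraph_lform => i; rewrite mxE.
Qed.
End Forms.

Section Specialisation.
Variables (n : nat) (k W : fieldType) (C : closedFieldType).
Variables (iota : {rmorphism {mpoly k[n]} -> W}) (kappa : {rmorphism k -> C}).
Hypothesis iota_inj : injective iota.

Lemma top_coefficient N (Psi : {mpoly {mpoly k[n]}[N]}) : Psi != 0 ->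
  exists m : 'X_{1..n}, (forall i, (mlead Psi@_i <= m)%O) /\ map_mpoly (mcoeff m) Psi != 0.
Proof.
move=> Psi0.
have [||||i0 i0r max] := @total_rel_max _ (fun i j => (mlead Psi@_i <= mlead Psi@_j)%O) (msupp Psi).
- by move=> i _ /=.
- by move=> i j _ _; apply/orP; exact: le_total.
- by move=> i j l _ _ _; apply: le_trans.
- by rewrite lt0n size_eq0 msupp_eq0.
exists (mlead Psi@_i0); split=> [i|].
  have [/max //|] := boolP (i \in msupp Psi).
  by rewrite mcoeff_msupp negbK => /eqP ->; rewrite mlead0 le0x.
apply/eqP => /mpolyP /(_ i0) /eqP; rewrite mcoeff_map_mpoly mcoeff0 mleadc_eq0.
by move: i0r; rewrite mcoeff_msupp => /negPf ->.
Qed.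

(** Two multiples of Psi reduce to nonzero forms: its quotient by the monomial m reduces to Psi0,
    and the product of the rescaled linear forms reduces to the product over s. They differ by a
    factor g; once the place is extended to g or to its inverse, the value found there relates the
    two reductions. *)
Lemma specialize_forms N (Psi : {mpoly {mpoly k[n]}[N]}) (m : 'X_{1..n}) (P : seq 'rV[W]_N) (D : W) :
    D != 0 -> {in P, forall v, isotropic v} ->
    map_mpoly iota Psi = D *: \prod_(v <- P) lform v ->
    (forall i, (mlead Psi@_i <= m)%O) -> map_mpoly (mcoeff m) Psi != 0 ->
  exists c s, [/\ c != 0, size s = size P, {in s, forall v : 'rV[C]_N, isotropic v} &
    \prod_(v <- s) lform v = c *: map_mpoly kappa (map_mpoly (mcoeff m) Psi)].
Proof.
move=> D0 iso E le_m Psi0_neq0; set Psi0 := map_mpoly _ Psi in Psi0_neq0 *.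
have [r0 l0] := lead_graphP kappa iota_inj.
have [G1 [r1 l1 s1 d1]] := extend_decide_seq
  [seq v 0 ij.1 / v 0 ij.2 | v : 'rV[W]_N <- P, ij <- enum {: 'I_N * 'I_N}] r0 l0.
have dec1 : {in P, forall v : 'rV[W]_N, forall i j, decided G1 (v 0 i / v 0 j)}.
  move=> v vP i j; apply: d1.
  by apply/allpairsP; exists (v, (i, j)); rewrite mem_enum.
have [e [s [e0 ss sI sG]]] := reduce_forms r1 iso dec1.
pose um := iota 'X_[m].
have um0 : um != 0 by rewrite (raddf_eq0 _ iota_inj) -msupp_eq0 msuppX.
have PsiG : mgraph (lead_graph iota kappa) (um^-1 *: map_mpoly iota Psi) (map_mpoly kappa Psi0).
  move=> i; rewrite mcoeffZ !mcoeff_map_mpoly /=.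
  exists (Psi@_i), 'X_[m], m; rewrite mleadXm mcoeffX eqxx oner_neq0 divr1 mulrC.
  by split.
have {}PsiG : mgraph G1 (um^-1 *: map_mpoly iota Psi) (map_mpoly kappa Psi0).
  by move=> i; apply/s1/PsiG.
pose g := um^-1 * D * e^-1.
have gE : um^-1 *: map_mpoly iota Psi = g *: (e *: \prod_(v <- P) lform v).
  by rewrite E !scalerA /g mulfVK.
have g0 : g != 0 by rewrite !mulf_neq0 ?invr_eq0.
have K0 : map_mpoly kappa Psi0 != 0.
  apply: contraNneq Psi0_neq0 => /mpolyP h; apply/eqP/mpolyP => i.
  by have /eqP := h i; rewrite mcoeff_map_mpoly !mcoeff0 fmorph_eq0 => /eqP.
have s_neq0 : \prod_(v <- s) lform v != 0.
  rewrite prodf_seq_neq0; apply/allP => v /sI[v0 _ _] /=.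
  by rewrite lform_eq0.
have [G2 [r2 l2 s2 d2]] := extend_decide g r1 l1.
have sG2 : mgraph G2 (e *: \prod_(v <- P) lform v) (\prod_(v <- s) lform v).
  by move=> i; apply/s2/sG.
have PsiG2 : mgraph G2 (g *: (e *: \prod_(v <- P) lform v)) (map_mpoly kappa Psi0).
  by move=> i; apply: s2; rewrite -gE; apply: PsiG.
case: d2 => -[y gy].
  have yE := mgraph_fun r2 (mgraphZ r2 gy sG2) PsiG2.
  have y0 : y != 0 by apply: contraNneq K0 => y0; rewrite -yE y0 scale0r.
  by exists y^-1, s; split; rewrite ?invr_eq0 // -yE scalerA mulVf // scale1r.
have := mgraphZ r2 gy PsiG2; rewrite scalerA mulVf // scale1r => /(mgraph_fun r2 sG2) yE.
have y0 : y != 0 by apply: contraNneq s_neq0 => y0; rewrite yE y0 scale0r.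
by exists y, s; split.
Qed.
End Specialisation.

(** * Reduction of the product of the conjugates *)

Lemma codiagonalize_seq (F : fieldType) n (As : seq 'M[F]_n.+1) :
    {in As &, forall A B, comm_mx A B} ->
    {in As, forall A, exists2 rs, uniq rs & horner_mx A (\prod_(x <- rs) ('X - x%:P)) = 0} ->
  exists2 P, P \in unitmx & {in As, forall A, exists d, A *m P = P *m diag_mx d}.
Proof.
move=> comA dA.
have [P0 Pu /allP diag] : codiagonalizable As.
  apply/codiagonalizableP; split=> // A /dA[rs urs hrs]; apply/diagonalizableP.
  by exists rs => //; apply: mxminpoly_min.
exists (invmx P0) => [|A AA]; first by rewrite unitmx_inv.
have /diagonalizable_forPex[d /(simmxP Pu) e] := diag A AA; exists d.
by rewrite -[A]mul1mx -(mulVmx Pu) -!mulmxA (mulmxA P0) e mulmxK.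
Qed.

(** These commuting permutation matrices are killed by X^3 - 1, which has distinct roots in F, so
    they have a common basis of eigenvectors, the columns of P. *)
Lemma perm_mx_codiagonal (F : fieldType) (z : F) n (ts : seq 'S_n.+1) : 3.-primitive_root z ->
    {in ts &, forall s t, (s * t = t * s)%g} ->
    {in ts, forall s, (s * s * s = 1)%g} ->
  exists2 P : 'M[F]_n.+1, P \in unitmx &
    {in ts, forall s : 'S_n.+1, exists d : 'rV[F]_n.+1,
       (forall j, d 0 j != 0) /\ forall i j, P (s i) j = P i j * d 0 j}.
Proof.
move=> z3 tC t3.
have [A B|A|P Pu h] := @codiagonalize_seq F n [seq perm_mx s | s <- ts].
- move=> /mapP[s st ->] /mapP[t tt ->].
  by rewrite /comm_mx -!perm_mxM tC.
- move=> /mapP[s st ->]; exists [seq z ^+ i | i <- index_iota 0 3].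
    rewrite map_inj_in_uniq ?iota_uniq // => i j; rewrite !mem_index_iota /= => i3 j3 /eqP.
    by rewrite (eq_prim_root_expr z3) !modn_small // => /eqP.
  rewrite big_map (factor_Xn_sub_1 z3) rmorphB rmorphXn rmorph1 /= horner_mx_X.
  by rewrite !exprS expr0 mulr1 -!mulmxE -!perm_mxM mulgA t3 // perm_mx1 subrr.
exists P => // s st; have [d e] := h _ (map_f _ st); exists d; split=> [|i j].
  have : diag_mx d \in unitmx.
    rewrite (_ : diag_mx d = invmx P *m (perm_mx s *m P)); last by rewrite e mulKmx.
    by rewrite !unitmx_mul unitmx_inv Pu unitmx_perm.
  by rewrite unitmxE det_diag unitfE => /prodf_neq0 h' j; apply: h'.
have /matrixP /(_ i j) := e; rewrite -row_permE mxE => ->.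
by rewrite mul_mx_diag mxE.
Qed.

(** k = Q(z) has degree at most 2, so a root of the cubic in k would have a minimal polynomial over
    Q of degree at most 2 dividing it, while the cubic is irreducible over Q by
    [weighted_cubes_rat]. *)
Lemma cyclotomic3_field : exists (k : fieldExtType rat) (kC : {rmorphism k -> algC}) (z : k),
  3.-primitive_root z /\ forall a b, (0 < b)%N -> (b < a)%N ->
    irreducible_poly (weighted_cubic (3 ^+ a) (3 ^+ b) : {poly k}).
Proof.
have [w w3] := C_prim_root_exists (isT : (0 < 3)%N).
have [k [kC [[|z []] // [zE] gen]]] := num_field_exists [:: w].
have z3 : 3.-primitive_root z by rewrite -(fmorph_primitive_root kC) zE.
exists k, kC, z; split=> // a b b0 ba.
have a0 : (0 < a)%N by apply: leq_ltn_trans ba.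
have ne (F : numFieldType) : (3 ^+ a - (3 ^+ a) ^+ 3 : F) != 0.
  by rewrite -exprM -!natrX subr_eq0 eqr_nat eqn_exp2l // neq_ltn ltn_Pmulr.
have irrQ : irreducible_poly (weighted_cubic (3 ^+ a) (3 ^+ b) : {poly rat}).
  apply: cubic_irreducible; first by rewrite size_weighted_cubic ?ne.
  move=> x; rewrite rootE horner_weighted_cubic subr_eq0; apply/eqP.
  exact: weighted_cubes_rat.
have deg x (p : {poly rat}) : p != 0 -> root (map_poly (in_alg k) p) x ->
    exists r : {poly rat}, [/\ r %| p, root (map_poly (in_alg k) r) x &
      size r = (\dim <<1; x>>).+1].
  move=> p0 px; have /polyOver1P[r rE] := minPolyOver 1%AS x.
  exists r; rewrite -rE root_minPoly; split=> //.
    rewrite -(dvdp_map (in_alg k)) -rE minPoly_dvdp //.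
    by apply/polyOver1P; exists p.
  by rewrite -(size_map_poly (in_alg k)) -rE size_minPoly dim_Fadjoin dimv1 muln1.
have dim2 : (\dim {:k} <= 2)%N.
  have p0 : 'X^2 + 'X + 1 != 0 :> {poly rat}.
    by rewrite -size_poly_gt0 -addrA size_polyDl size_polyXn // (leq_ltn_trans (size_polyD _ _)) // size_polyX size_poly1.
  have [|r [rp _ sr]] := deg z _ p0.
    rewrite rootE !rmorphD rmorphXn rmorph1 /= map_polyX !hornerE.
    have /eqP := prim_expr_order z3; rewrite -subr_eq0.
    have -> : z ^+ 3 - 1 = (z - 1) * (z ^+ 2 + z + 1) by ring.
    rewrite mulf_eq0 subr_eq0 => /orP[/eqP z1|]; last by rewrite expr2.
    by have := eq_prim_root_expr z3 1 0; rewrite z1 !expr1n eqxx.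
  move: gen => /= <-; rewrite adjoin_seq1 -ltnS -sr.
  apply: (leq_trans (dvdp_leq p0 rp)).
  by rewrite -addrA size_polyDl size_polyXn // (leq_ltn_trans (size_polyD _ _)) // size_polyX size_poly1.
have nek : (3 ^+ a - (3 ^+ a) ^+ 3 : k) != 0.
  by rewrite -(fmorph_eq0 kC) rmorphB !rmorphXn rmorph_nat; exact: ne.
apply: cubic_irreducible; first by rewrite size_weighted_cubic ?nek.
move=> x; apply/negP => rx.
have [||r [rq rr sr]] := deg x (weighted_cubic (3 ^+ a) (3 ^+ b)).
- by rewrite irredp_neq0.
- by rewrite map_weighted_cubic !rmorphXn !rmorph_nat.
have dx : (\dim <<1; x>> <= 2)%N by apply: leq_trans dim2; apply/dimvS/subvf.
have dx0 : (0 < \dim <<1; x>>)%N by rewrite adim_gt0.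
have r1 : size r != 1%N by rewrite sr eqSS -lt0n.
have := eqp_size (apply_irredp irrQ r1 rq); rewrite sr size_weighted_cubic ?ne //.
by move: dx; case: (\dim _) => [|[|[|]]].
Qed.

Section FractionExtension.
Variables (n : nat) (K : fieldType) (f : {rmorphism {mpoly rat[n]} -> K}).
Hypothesis f_inj : injective f.

Definition frac_ext (x : ratfun n) : K := f \n_(repr x) / f \d_(repr x).

Let f_eq0 p : (f p == 0) = (p == 0). Proof. exact: raddf_eq0. Qed.

Lemma frac_extE p q : q != 0 -> frac_ext (tofrac p / tofrac q) = f p / f q.
Proof.
move=> q0; rewrite /frac_ext; move: (ratfun_numden (tofrac p / tofrac q)).
case: (repr _) => -[a b] /= b0 /eqP.
rewrite eqr_div ?tofrac_eq0 // -!tofracM tofrac_eq => /eqP E.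
by apply/eqP; rewrite eqr_div ?f_eq0 // -!rmorphM E.
Qed.

Lemma frac_ext_tofrac p : frac_ext (tofrac p) = f p.
Proof. by have := frac_extE p (oner_neq0 _); rewrite !rmorph1 !divr1. Qed.

Fact frac_ext_zmod_morphism : zmod_morphism frac_ext.
Proof.
move=> x y; have [a [b [b0 ->]]] := ratfunP x; have [c [d [d0 ->]]] := ratfunP y.
have -> : tofrac a / tofrac b - tofrac c / tofrac d
    = tofrac (a * d - c * b) / tofrac (b * d).
  by rewrite -mulNr addf_div ?tofrac_eq0 // mulNr -!tofracM -tofracB.
rewrite !frac_extE ?mulf_neq0 // -[- (f c / f d)]mulNr addf_div ?f_eq0 // mulNr.
by rewrite -!rmorphM -rmorphB.
Qed.

Fact frac_ext_monoid_morphism : monoid_morphism frac_ext.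
Proof.
split=> [|x y]; first by rewrite -(rmorph1 (@tofrac _)) frac_ext_tofrac rmorph1.
have [a [b [b0 ->]]] := ratfunP x; have [c [d [d0 ->]]] := ratfunP y.
by rewrite mulf_div -!tofracM !frac_extE ?mulf_neq0 // mulf_div -!rmorphM.
Qed.

Lemma frac_ext_rmorphism :
  exists g : {rmorphism ratfun n -> K}, forall p, g (tofrac p) = f p.
Proof.
pose g : {rmorphism ratfun n -> K} := HB.pack frac_ext
  (GRing.isZmodMorphism.Build _ _ frac_ext frac_ext_zmod_morphism)
  (GRing.isMonoidMorphism.Build _ _ frac_ext frac_ext_monoid_morphism).
exists g; exact: frac_ext_tofrac.
Qed.
End FractionExtension.

Lemma clear_denominators n N (Phi : {mpoly (ratfun n)[N]}) :
  exists2 D : {mpoly rat[n]}, D != 0 &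
  exists Psi : {mpoly {mpoly rat[n]}[N]}, map_mpoly (@tofrac _) Psi = tofrac D *: Phi.
Proof.
elim/mpolyind: Phi => [|c m p _ _ [D D0 [Psi E]]].
  by exists 1; rewrite ?oner_neq0 //; exists 0; rewrite rmorph0 scaler0.
have [a [b [b0 ->]]] := ratfunP c.
exists (b * D); rewrite ?mulf_neq0 //; exists ((a * D) *: 'X_[m] + b *: Psi).
rewrite rmorphD /= !map_mpolyZ map_mpolyX E scalerDr !scalerA !tofracM.
have e (F : fieldType) (x y z : F) : z != 0 -> x * y = z * y * (x / z) by move=> z0; field.
by congr (_ *: _ + _); rewrite rmorphM; apply: (e (ratfun n)); rewrite tofrac_eq0.
Qed.

Section Diagonal.
Variables (n : nat) (k : fieldType) (d : 'rV[k]_n).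

Definition scale_vars : {mpoly k[n]} -> {mpoly k[n]} :=
  mmap (@mpolyC n k) (fun j => d 0 j *: 'X_j).

Lemma mcoeff_scale_vars p m : (scale_vars p)@_m = (\prod_j d 0 j ^+ m j) * p@_m.
Proof.
rewrite /scale_vars /mmap [in RHS](mpolyE p) !raddf_sum /= mulr_sumr.
apply: eq_bigr => i _; rewrite mul_mpolyC !mcoeffZ mulrCA; congr (_ * _).
have -> : mmap1 (fun j => d 0 j *: 'X_j) i = (\prod_j d 0 j ^+ i j) *: 'X_[i].
  rewrite /mmap1 mpolyXE_id -mul_mpolyC rmorph_prod -big_split; apply: eq_bigr => j _ /=.
  by rewrite exprZn -mul_mpolyC.
by rewrite mcoeffZ mcoeffX; case: eqP => [->|_]; rewrite ?mulr0.
Qed.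

Lemma mlead_scale_vars p m : (mlead p <= m)%O -> (mlead (scale_vars p) <= m)%O.
Proof.
move=> pm; have [->|sp] := eqVneq (scale_vars p) 0; first by rewrite mlead0 le0x.
have := mlead_supp sp; rewrite mcoeff_msupp mcoeff_scale_vars mulf_eq0 negb_or => /andP[_].
by rewrite -mcoeff_msupp => /msupp_le_mlead h; apply: le_trans pm.
Qed.
End Diagonal.

Section Key.
Variables (n : nat) (k : fieldExtType rat) (M : 'M[k]_n).
Hypothesis Mu : M \in unitmx.

(** The change of variables x_i = sum_j M_ij u_j; for M as in [perm_mx_codiagonal], a translation of
    the x_i becomes a scaling of the u_j. *)
Definition linsub : {mpoly rat[n]} -> {mpoly k[n]} :=
  mmap (@mpolyC n k \o in_alg k) (fun i => lform (row i M)).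
HB.instance Definition _ := GRing.RMorphism.on linsub.

(** Followed by the substitution given by the inverse matrix, [linsub] is just the inclusion of Q in
    k. *)
Lemma linsub_inj : injective linsub.
Proof.
pose th : {rmorphism _ -> _} := mmap (@mpolyC n k) (fun j => lform (row j (invmx M))).
have e p : th (linsub p) = map_mpoly (in_alg k) p.
  apply: (mpoly_rmorph_eq (f := th \o linsub) (g := map_mpoly (in_alg k))) => [c|i] /=.
    by rewrite /linsub mmapC /= mmapC map_mpolyC.
  rewrite /linsub mmapX mmap1U /= mmap_lform map_mpolyX.
  transitivity (lform (row i M *m invmx M)).
    rewrite mulmx_sum_row raddf_sum; apply: eq_bigr => j _ /=.
    by rewrite linearZ mul_mpolyC.
  rewrite -row_mul mulmxV // /lform (bigD1 i) //= !mxE eqxx scale1r big1 ?addr0 // => j ji.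
  by rewrite !mxE eq_sym (negPf ji) scale0r.
move=> p q pq; apply/mpolyP => m; apply: (fmorph_inj (in_alg k)).
by rewrite -!mcoeff_map_mpoly -!e pq.
Qed.

Lemma linsub_msym (s : 'S_n) (d : 'rV[k]_n) p :
  (forall i j, M (s i) j = M i j * d 0 j) -> linsub (msym s p) = scale_vars d (linsub p).
Proof.
move=> h; apply: (mpoly_rmorph_eq (f := linsub \o msym s)
  (g := mmap (@mpolyC n k) (fun j => d 0 j *: 'X_j) \o linsub)) => [c|i] /=.
  by rewrite /msym mmapC /linsub !mmapC.
rewrite /msym mmapX mmap1U /linsub !mmapX !mmap1U mmap_lform /lform.
by apply: eq_bigr => j _; rewrite !mxE h mul_mpolyC scalerA.
Qed.
End Key.

Lemma map_mpoly_inj N (R S : comNzRingType) (f : {rmorphism R -> S}) :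
  injective f -> injective (map_mpoly (n := N) f).
Proof.
move=> fi p q e; apply/mpolyP => m; apply: fi.
by rewrite -!mcoeff_map_mpoly e.
Qed.

Lemma map_mpoly_msym N (R S : comNzRingType) (f : {rmorphism R -> S}) (s : 'S_N) p :
  map_mpoly f (msym s p) = msym s (map_mpoly f p).
Proof. by apply/mpolyP => m; rewrite mcoeff_sym !mcoeff_map_mpoly mcoeff_sym. Qed.

Lemma tofrac_inj (R : idomainType) : injective (@tofrac R).
Proof. by move=> p q /eqP; rewrite tofrac_eq => /eqP. Qed.

(** The denominator D may move under the action, hence the cross-multiplied form: clearing
    denominators in the equivariance of Phi gives D g(Psi) = g(D) t(Psi), which u transports to
    S. *)
Lemma equivariant_numerator (R L S : comNzRingType) (f : {rmorphism R -> L})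
    (g : {rmorphism R -> R}) (h : {rmorphism L -> L}) (u : {rmorphism R -> S}) (a : S -> S)
    N (t : 'S_N) (Phi : {mpoly L[N]}) (D : R) (Psi : {mpoly R[N]}) :
    injective f -> (forall x, h (f x) = f (g x)) -> (forall x, u (g x) = a (u x)) ->
    map_mpoly f Psi = f D *: Phi -> map_mpoly h Phi = msym t Phi ->
  forall i, u D * a (map_mpoly u Psi)@_i = a (u D) * (msym t (map_mpoly u Psi))@_i.
Proof.
move=> fi hf ua E hPhi.
have e : map_mpoly f (map_mpoly g Psi) = map_mpoly h (f D *: Phi).
  by rewrite -E; apply/mpolyP => m; rewrite !mcoeff_map_mpoly /= hf.
have {}e : D *: map_mpoly g Psi = g D *: msym t Psi.
  apply: (map_mpoly_inj fi).
  rewrite (map_mpolyZ f D) (map_mpolyZ f (g D)) (map_mpoly_msym f t Psi) E e.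
  by rewrite (map_mpolyZ h (f D)) (msymZ (f D)) hPhi /= hf !scalerA mulrC.
move=> i; rewrite -map_mpoly_msym (mcoeff_map_mpoly u i Psi) (mcoeff_map_mpoly u i (msym t Psi)) /=.
rewrite -!ua -!rmorphM; congr (u _).
by rewrite -(mcoeffZ (g D)) -e (mcoeffZ D) (mcoeff_map_mpoly g).
Qed.

(** The coefficients at l + m are compared, l being the leading monomial of D: scaling the variables
    preserves the bounds l and m and multiplies each coefficient by the value of a character. *)
Lemma top_coefficient_equivariant n N (k : fieldType) (d : 'rV[k]_n) (D : {mpoly k[n]})
    (Psi : {mpoly {mpoly k[n]}[N]}) (t : 'S_N) (m : 'X_{1..n}) : D != 0 ->
    (forall i, (mlead Psi@_i <= m)%O) ->
    (forall i, D * scale_vars d Psi@_i = scale_vars d D * (msym t Psi)@_i) ->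
  (\prod_j d 0 j ^+ m j) *: map_mpoly (mcoeff m) Psi =
    (\prod_j d 0 j ^+ mlead D j) *: msym t (map_mpoly (mcoeff m) Psi).
Proof.
move=> D0 le_m eqv; set l := mlead D.
have lD : D@_l != 0 by rewrite mleadc_eq0.
have cE p i : (map_mpoly (mcoeff m) p)@_i = (p@_i)@_m :> k by exact: mcoeff_map_mpoly.
have sE i : (msym t (map_mpoly (mcoeff m) Psi))@_i = ((msym t Psi)@_i)@_m.
  by rewrite mcoeff_sym cE -(mcoeff_sym Psi).
have le_s i : (mlead (msym t Psi)@_i <= m)%O by rewrite mcoeff_sym.
apply/mpolyP => i; rewrite 2!mcoeffZ cE sE; apply: (mulfI lD).
have := congr1 (mcoeff (l + m)%MM) (eqv i).
rewrite (mleadcMW (lexx l) (mlead_scale_vars d (le_m i))).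
rewrite (mleadcMW (mlead_scale_vars d (lexx l)) (le_s i)).
by rewrite 2!mcoeff_scale_vars => ->; rewrite mulrA [D@_l * _]mulrC.
Qed.

Lemma msym_semi_invariant N (k : fieldType) (c d : k) (p : {mpoly k[N]}) (t : 'S_N) :
  c != 0 -> c *: p = d *: msym t^-1 p -> msym t p = (d / c) *: p.
Proof.
move=> c0 /(congr1 (msym t)); rewrite !msymZ -msymMm mulVg msym1m => e.
by rewrite mulrC -scalerA -e scalerA mulVf // scale1r.
Qed.

(** K is k(u), with psi the change of variables; W is quantified afterwards, because the conjugates
    of F' live in an extension of K. The leading coefficient of the numerator of Phi is
    semi-invariant under the translations, so that [chow_form_degree] applies to the reduced
    points. *)
Lemma no_prime_to_3_point (n k1 k2 k3 : nat) : (k2 < k1)%N -> (k3 < k2)%N ->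
    n = (3 ^ k1 + 3 ^ k2 + 3 ^ k3)%N ->
  exists (K : fieldType) (psi : {rmorphism ratfun n -> K}),
    forall (W : fieldType) (iota : {rmorphism K -> W}) (Phi : {mpoly (ratfun n)[n]})
      (P : seq 'rV[W]_n),
    (forall s : 'S_n, map_mpoly (perm_act s) Phi = msym s^-1 Phi) ->
    {in P, forall v : 'rV[W]_n, isotropic v} ->
    map_mpoly (iota \o psi) Phi = \prod_(v <- P) lform v -> (3 %| size P)%N.
Proof.
move=> k12 k23 nE; have [B] := block_translations_exist nE.
have [k [kC [z [z3 irr]]]] := cyclotomic3_field.
have n0 : (0 < n)%N by rewrite nE !addn_gt0 expn_gt0.
have [M Mu Mdiag] : exists2 M : 'M[k]_n, M \in unitmx & {in trs B, forall s : 'S_n,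
    exists d : 'rV[k]_n, (forall j, d 0 j != 0) /\ forall i j, M (s i) j = M i j * d 0 j}.
  case: n n0 B {nE} => // n _ B.
  apply: (perm_mx_codiagonal z3); [exact: trs_comm|exact: trs_order].
have li := linsub_inj Mu.
pose f : {rmorphism {mpoly rat[n]} -> {fraction {mpoly k[n]}}} := @tofrac _ \o linsub M.
have fi : injective f by apply: inj_comp li; exact: tofrac_inj.
have [psi psiE] := frac_ext_rmorphism fi.
exists {fraction {mpoly k[n]}}, psi.
move=> W iota Phi P equi Piso E.
have [D D0 [Psi PsiE]] := clear_denominators Phi.
pose Psi1 := map_mpoly (linsub M) Psi; pose D1 := linsub M D.
pose iota1 : {rmorphism {mpoly k[n]} -> W} := iota \o @tofrac _.
have iota1_inj : injective iota1.
  by apply: inj_comp; [exact: fmorph_inj|exact: tofrac_inj].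
have D1n : D1 != 0 by rewrite (raddf_eq0 _ li).
have E1 : map_mpoly iota1 Psi1 = iota1 D1 *: \prod_(v <- P) lform v.
  rewrite -E; apply/mpolyP => m; rewrite mcoeffZ !mcoeff_map_mpoly /=.
  have fE x : iota (tofrac (linsub M x)) = iota (psi (tofrac x)) by rewrite psiE.
  have cE : tofrac Psi@_m = tofrac D * Phi@_m by rewrite -mcoeffZ -PsiE mcoeff_map_mpoly.
  rewrite /D1 (fE Psi@_m) (fE D) cE.
  by rewrite (rmorphM psi) (rmorphM iota).
have Psi1n : Psi1 != 0.
  suff : map_mpoly iota1 Psi1 != 0 by apply: contraNneq => ->; rewrite rmorph0.
  rewrite E1 scaler_eq0 negb_or (raddf_eq0 _ iota1_inj) D1n prodf_seq_neq0 /=.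
  by apply/allP => v /Piso[v0 _ _] /=; rewrite lform_eq0.
have [m [le_m Psi0n]] := top_coefficient Psi1n.
have iD1 : iota1 D1 != 0 by rewrite (raddf_eq0 _ iota1_inj).
have [c [s [c0 <- sI sE]]] := specialize_forms kC iota1_inj iD1 Piso E1 le_m Psi0n.
have irrk : irreducible_poly (weighted_cubic (3 ^+ (k1 - k3)) (3 ^+ (k2 - k3)) : {poly k}).
  by apply: irr; rewrite ?subn_gt0 // ltn_sub2r // (ltn_trans k23).
apply: (chow_form_degree k12 k23 irrk c0 sI sE) => t tB.
have [d [d0 dM]] := Mdiag t tB.
pose chi (m : 'X_{1..n}) := \prod_j d 0 j ^+ m j.
have chi0 m' : chi m' != 0 by apply/prodf_neq0 => j _; rewrite expf_neq0.
set Psi0 := map_mpoly _ _ in Psi0n *.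
have eqv1 := equivariant_numerator (@tofrac_inj _) (perm_act_tofrac t)
  (fun x => linsub_msym x dM) PsiE (equi t).
have e0 : chi m *: Psi0 = chi (mlead D1) *: msym t^-1 Psi0.
  exact: top_coefficient_equivariant D1n le_m eqv1.
exists (chi (mlead D1) / chi m); first by rewrite mulf_neq0 ?invr_eq0.
exact: msym_semi_invariant e0.
Qed.

(** * Conjugates and traces *)

Lemma irreducible_factor (K : fieldType) (p : {poly K}) : (1 < size p)%N ->
  exists2 q, irreducible_poly q & q %| p.
Proof.
have [N] := ubnP (size p); elim: N p => // N IH p lt_pN p1.
case: (Classical_Prop.classic (irreducible_poly p)) => [irr|nirr].
  by exists p.
case: (Classical_Prop.classic (exists q : {poly K}, [/\ size q != 1%N, q %| p & ~~ (q %= p)]))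
  => [[q [q1 qp nqp]]|h]; last first.
  case: nirr; split=> // q q1 qp; apply/negPn/negP => nqp.
  by apply: h; exists q.
have p0 : p != 0 by rewrite -size_poly_gt0 ltnW.
have q0 : q != 0 by apply: contraTneq qp => ->; rewrite dvd0p.
have sq : (size q < size p)%N.
  rewrite ltn_neqAle dvdp_leq // andbT; apply: contra nqp => /eqP e.
  by rewrite -(dvdp_size_eqp qp) e.
have q2 : (1 < size q)%N by move: q1 q0; rewrite -size_poly_gt0; case: (size q) => [|[]].
have [|r irr rq] := IH q _ q2; first by apply: leq_trans sq _; rewrite -ltnS.
by exists r => //; apply: dvdp_trans qp.
Qed.

Lemma splitting_field (K : fieldType) (p : {poly K}) : p != 0 ->
  exists (W : fieldType) (iota : {rmorphism K -> W}) (rs : seq W),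
    map_poly iota p %= \prod_(r <- rs) ('X - r%:P).
Proof.
have [N] := ubnP (size p); elim: N K p => // N IH K p lt_pN p0.
case: (leqP (size p) 1) => [p1|p1].
  exists K, (idfun : {rmorphism K -> K}), [::]; rewrite big_nil map_poly_id //.
  by rewrite -size_poly_eq1 eqn_leq p1 size_poly_gt0.
have [q irrq qp] := irreducible_factor p1.
have [L _ [z qz _]] := irredp_FAdjoin irrq.
have pz : root (map_poly (in_alg L) p) z.
  by have [r ->] := dvdpP _ _ qp; rewrite rmorphM rootM qz orbT.
have [r re] := factor_theorem _ _ pz.
have m0 : map_poly (in_alg L) p != 0 by rewrite map_poly_eq0.
have r0 : r != 0 by apply: contraNneq m0 => r0; rewrite re r0 mul0r.
have [|W [iota [rs e]]] := IH L r _ r0.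
  have := size_map_poly (in_alg L) p; rewrite re size_Mmonic ?monicXsubC // size_XsubC addn2 /= => sr.
  by rewrite -ltnS sr.
exists W, (iota \o in_alg L), (iota z :: rs).
rewrite map_poly_comp [X in map_poly iota X]re rmorphM big_cons mulrC /= map_polyXsubC.
by rewrite eqp_mul2l ?polyXsubC_eq0.
Qed.

(** B is the matrix of the values of the h i on the basis, and its columns are eigenvectors of every
    multiplication. The Vandermonde matrix of the distinct h i x factors through B, which is
    therefore invertible. *)
Lemma conjugates_diagonalize (F : fieldType) (A : falgType F) (W : fieldType)
    (iota : {rmorphism F -> W}) (h : 'I_(\dim {:A}) -> {rmorphism A -> W}) (x : A) :
    (forall i c, h i c%:A = iota c) -> injective (fun i => h i x) ->
  exists B : 'M[W]_(\dim {:A}),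
    [/\ B \in unitmx,
        forall a i, h i a = (map_mx iota (passmx.rVof (vbasis {:A}) a) *m B) 0 i
      & forall a, map_mx iota (passmx.mxof (vbasis {:A}) (vbasis {:A}) (amull a)) *m B =
          B *m diag_mx (\row_i h i a)].
Proof.
move=> hA inj; set b := vbasis {:A}.
pose B := \matrix_(k < \dim {:A}, i < \dim {:A}) h i b`_k.
have hB a i : h i a = (map_mx iota (passmx.rVof b a) *m B) 0 i.
  rewrite {1}(coord_vbasis (memvf a)) rmorph_sum mxE; apply: eq_bigr => k _.
  by rewrite !mxE -mulr_algl rmorphM hA.
exists B; split=> // [|a].
  pose C := \matrix_(k < \dim {:A}) map_mx iota (passmx.rVof b (x ^+ k)).
  have VE : Vandermonde _ (\row_i h i x) = C *m B.
    apply/matrixP => k i; rewrite !mxE -rmorphXn hB mxE.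
    by apply: eq_bigr => l _; rewrite !mxE.
  have : \det (Vandermonde (\dim {:A}) (\row_i h i x)) != 0.
    rewrite det_Vandermonde; apply/prodf_neq0 => i _; apply/prodf_neq0 => j ij.
    rewrite !mxE subr_eq0; apply: contraTneq ij => /inj ->.
    by rewrite ltnn.
  by rewrite VE det_mulmx unitmxE unitfE mulf_eq0 negb_or => /andP[].
apply/matrixP => k i; rewrite mul_mx_diag !mxE mulrC -rmorphM hB mxE.
apply: eq_bigr => l _; rewrite !mxE; congr (iota _ * _).
by rewrite /= passmx.vecof_delta lfunE.
Qed.

Lemma trace_conjugates (F : fieldType) (A : falgType F) (W : fieldType)
    (iota : {rmorphism F -> W}) (h : 'I_(\dim {:A}) -> {rmorphism A -> W}) (x : A) :
    (forall i c, h i c%:A = iota c) -> injective (fun i => h i x) ->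
  (forall a, iota (trace a) = \sum_i h i a) /\ (forall a, a != 0 -> exists i, h i a != 0).
Proof.
move=> hA inj; have [B [Bu hB TB]] := conjugates_diagonalize hA inj.
split=> a; last first.
  move=> a0; apply/existsP; apply: contraNT a0; rewrite negb_exists => /forallP h0.
  rewrite -(passmx.rVof_eq0 (vbasisP {:A})) -(map_mx_eq0 iota) -[map_mx _ _](mulmxK Bu).
  rewrite (_ : _ *m B = 0) ?mul0mx //.
  by apply/rowP => i; rewrite -hB [RHS]mxE; apply/eqP; move: (h0 i); rewrite negbK.
rewrite /trace -trace_map_mx -[map_mx _ _](mulmxK Bu) TB mxtrace_mulC mulKmx // mxtrace_diag.
by apply: eq_bigr => i _; rewrite mxE.
Qed.

(** The map q(z) |-> q(r) is well defined, because p divides the difference of two polynomials with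
    the same value at z. *)
Lemma simple_extension_morphism (F : fieldType) (L : fieldExtType F) (W : fieldType)
    (f : {rmorphism F -> W}) (z : L) (p : {poly F}) (r : W) :
    <<1; z>>%VS = fullv -> map_poly (in_alg L) p = minPoly 1 z -> root (map_poly f p) r ->
  exists tau : {rmorphism L -> W}, (forall c, tau c%:A = f c) /\ tau z = r.
Proof.
move=> gen pE pr.
pose ez (q : {poly F}) := (map_poly (in_alg L) q).[z].
pose er (q : {poly F}) := (map_poly f q).[r].
have key q1 q2 : ez q1 = ez q2 -> er q1 = er q2.
  move=> e; apply/eqP; rewrite -subr_eq0 -hornerN -hornerD -rmorphB -/(root _ r).
  have : map_poly (in_alg L) p %| map_poly (in_alg L) (q1 - q2).
    rewrite pE minPoly_dvdp //; first by apply/polyOver1P; exists (q1 - q2).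
    by rewrite rootE rmorphB hornerD hornerN subr_eq0; apply/eqP.
  rewrite dvdp_map => /dvdpP[q ->].
  by rewrite rmorphM rootM pr orbT.
have ex y : exists q, ez q == y.
  have /Fadjoin_polyP[_ /polyOver1P[q ->] ->] : y \in <<1; z>>%VS by rewrite gen memvf.
  by exists q.
pose t y := er (xchoose (ex y)).
have tE q : t (ez q) = er q by apply: key; apply/eqP/(xchooseP (ex _)).
have tez y : exists q, y = ez q by have [q /eqP] := ex y; exists q.
have tB : zmod_morphism t.
  move=> x y; have [a ->] := tez x; have [b ->] := tez y.
  have -> : ez a - ez b = ez (a - b) by rewrite /ez rmorphB hornerD hornerN.
  by rewrite !tE /er rmorphB hornerD hornerN.
have tM : monoid_morphism t.
  split=> [|x y].
    have -> : 1 = ez 1 by rewrite /ez rmorph1 hornerC.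
    by rewrite tE /er rmorph1 hornerC.
  have [a ->] := tez x; have [b ->] := tez y.
  have -> : ez a * ez b = ez (a * b) by rewrite /ez rmorphM hornerM.
  by rewrite !tE /er rmorphM hornerM.
pose tau : {rmorphism L -> W} := HB.pack t
  (GRing.isZmodMorphism.Build _ _ t tB) (GRing.isMonoidMorphism.Build _ _ t tM).
exists tau; split=> [c|] /=.
  have -> : c%:A = ez c%:P by rewrite /ez map_polyC hornerC.
  by rewrite tE /er map_polyC hornerC.
have -> : z = ez 'X by rewrite /ez map_polyX hornerX.
by rewrite tE /er map_polyX hornerX.
Qed.

(** z is a primitive element, separable in characteristic 0, and W a splitting field over K of its
    minimal polynomial, whose roots give the embeddings. *)
Lemma conjugate_embeddings (F : fieldType) (L : fieldExtType F) (K : fieldType)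
    (psi : {rmorphism F -> K}) : [pchar F] =i pred0 ->
  exists (W : fieldType) (iota : {rmorphism K -> W})
    (tau : 'I_(\dim {:L}) -> {rmorphism L -> W}) (z : L),
    (forall j c, tau j c%:A = iota (psi c)) /\ injective (fun j => tau j z).
Proof.
move=> F0; have L0 : [pchar L] =i pred0.
  by move=> q; rewrite -(F0 q) (fmorph_pchar (in_alg L)).
have sepz := pcharf0_separable 1%AS L0.
pose z := separable_generator 1%AS {:L}%AS.
have gen : <<1; z>>%VS = fullv.
  apply/esym/eq_adjoin_separable_generator; last exact: sub1v.
  by apply/separableP => y _.
have /polyOver1P[p /esym pE] := minPolyOver 1%AS z.
have sp : size p = (\dim {:L}).+1.
  rewrite -(size_map_poly (in_alg L)) pE size_minPoly -gen dim_Fadjoin dimv1 muln1 //.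
have psep : separable_poly p.
  by rewrite -(separable_map (in_alg L)) pE; exact: sepz.
have p0 : map_poly psi p != 0 by rewrite map_poly_eq0 -size_poly_gt0 sp.
have [W [iota [rs e]]] := splitting_field p0.
pose f : {rmorphism F -> W} := iota \o psi.
have {}e : map_poly f p %= \prod_(r <- rs) ('X - r%:P) by rewrite map_poly_comp.
have rsu : uniq rs.
  rewrite -separable_prod_XsubC -(eqp_separable e) separable_map //.
have rsz : size rs = \dim {:L}.
  by apply/eqP; rewrite -eqSS -(size_prod_XsubC rs id) -(eqp_size e) size_map_poly sp.
have tex (j : 'I_(\dim {:L})) : exists tau : {rmorphism L -> W},
    (forall c, tau c%:A = f c) /\ tau z = rs`_j.
  apply: (simple_extension_morphism gen pE).
  by rewrite (eqp_root e) root_prod_XsubC mem_nth // rsz.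
have [tau tauP] := fin_all_exists tex.
exists W, iota, tau, z; split=> [j c|i j]; first exact: (proj1 (tauP j)).
rewrite !(proj2 (tauP _)) => /eqP; rewrite nth_uniq ?rsz // => /eqP; exact: val_inj.
Qed.

(* The norm of sum_i N_i 'X_i. *)
Definition norm_form (R : comNzRingType) n d (N : 'I_n -> 'M[R]_d) : {mpoly R[n]} :=
  \det (\matrix_(a, b) lform (\row_i N i a b)).

Lemma map_norm_form (R S : comNzRingType) (f : {rmorphism R -> S}) n d (N : 'I_n -> 'M[R]_d) :
  map_mpoly f (norm_form N) = norm_form (fun i => map_mx f (N i)).
Proof.
rewrite /norm_form -det_map_mx; congr (\det _); apply/matrixP => a b; rewrite !mxE /= map_lform.
by congr lform; apply/rowP => i; rewrite !mxE.
Qed.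

Lemma msym_norm_form (R : comNzRingType) n d (s : 'S_n) (N : 'I_n -> 'M[R]_d) :
  msym s^-1 (norm_form N) = norm_form (fun i => N (s i)).
Proof.
rewrite /norm_form -det_map_mx.
congr (\det _); apply/matrixP => a b; rewrite !mxE /= msym_lform invgK.
by congr lform; apply/rowP => i; rewrite !mxE.
Qed.

(** B diagonalises every N i, hence also their generic combination, with the linear forms of the P j
    as eigenvalues. *)
Lemma norm_form_diag (W : idomainType) n d (N : 'I_n -> 'M[W]_d) (B : 'M_d) (P : 'I_d -> 'rV_n) :
    \det B != 0 -> (forall i, N i *m B = B *m diag_mx (\row_j P j 0 i)) ->
  norm_form N = \prod_j lform (P j).
Proof.
move=> B0 NB; pose MB := map_mx (@mpolyC n W) B.
set Y := \matrix_(a, b) lform (\row_i N i a b).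
have YB : Y *m MB = MB *m diag_mx (\row_j lform (P j)).
  apply/matrixP => a j; rewrite mul_mx_diag !mxE mul_mpolyC -linearZ /=.
  transitivity (lform (\sum_b B b j *: \row_i N i a b)).
    rewrite linear_sum; apply: eq_bigr => b _.
    by rewrite !mxE linearZ /= mulrC mul_mpolyC.
  congr lform; apply/rowP => i; rewrite summxE !mxE.
  have /matrixP/(_ a j) := NB i; rewrite mul_mx_diag !mxE mulrC => <-.
  by apply: eq_bigr => b _; rewrite !mxE mulrC.
have dMB : \det MB != 0 by rewrite det_map_mx mpolyC_eq0.
apply: (mulIf dMB); rewrite -det_mulmx YB det_mulmx det_diag mulrC.
by congr (_ * _); apply: eq_bigr => j _; rewrite mxE.
Qed.

(** * The conjugates of E_n over F_n *)

Section Conjugates.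

Variable m : nat.
Local Notation n := m.+1.

(** The embedding that sends x_1 to x_i. On elements fixed by the stabiliser of [ord0], every
    permutation taking [ord0] to i acts as this transposition. *)
Definition conj_En (i : 'I_n) : {rmorphism En n -> ratfun n} :=
  ratfun_aut (tperm ord0 i) \o (@fixed_val _ _ _ _ : {rmorphism En n -> ratfun n}).

Lemma conj_En_act s i e : perm_act s (conj_En i e) = conj_En (s i) e.
Proof.
rewrite /conj_En /= -perm_actM; set t := tperm ord0 (s i).
have -> : (tperm ord0 i * s = (tperm ord0 i * s * t) * t)%g by rewrite -mulgA tperm2 mulg1.
rewrite perm_actM; congr perm_act.
by apply: (fixed_actE (act := @ratfun_aut n)); rewrite stab0P !permM tpermL tpermR.
Qed.

Lemma conj_En_scalar i (c : Fn n) : conj_En i c%:A = fixed_val c.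
Proof.
rewrite /conj_En /= mulr1.
by apply: (fixed_actE (act := @ratfun_aut n)); rewrite inE.
Qed.

Lemma conj_En_generator : exists x : En n, forall i, conj_En i x = var i.
Proof.
have x1P : var ord0 \in fixed_pred (@ratfun_aut n) (stab0 n).
  by apply/fixedP => s; rewrite stab0P /= perm_act_var => /eqP ->.
by exists (Fixed x1P) => i; rewrite /conj_En /= perm_act_var tpermL.
Qed.

Lemma pchar_Fn : [pchar (Fn n)] =i pred0.
Proof.
pose f : {rmorphism rat -> ratfun n} := @tofrac _ \o @mpolyC n rat.
pose g : {rmorphism Fn n -> ratfun n} := @fixed_val _ _ _ _.
by move=> q; rewrite -(fmorph_pchar g) (fmorph_pchar f) pchar_num.
Qed.

End Conjugates.

Lemma tensor_sumE (F : fieldType) (K E : fieldExtType F) (u : tensor K E) :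
  u = \sum_i u 0 i *: tensor_inr K (vbasis {:E})`_i.
Proof.
apply/rowP => j; rewrite summxE (bigD1 j) //= !mxE coord_free ?(basis_free (vbasisP _)) //.
rewrite eqxx scale1r mulr1 big1 ?addr0 // => i ij.
by rewrite !mxE coord_free ?(basis_free (vbasisP _)) // (negPf ij) scale0r mulr0.
Qed.

(** The two traces are the sums of the conjugates of a and of their cubes, and a nonzero a has a
    nonzero conjugate. *)
Lemma isotropic_conjugates (F : fieldType) (A : falgType F) (W : fieldType)
    (iota : {rmorphism F -> W}) n (h : 'I_n -> {rmorphism A -> W}) (x a : A) :
    \dim {:A} = n -> (forall i c, h i c%:A = iota c) -> injective (fun i => h i x) ->
  a != 0 -> trace a = 0 -> trace (a ^+ 3) = 0 -> isotropic (\row_i h i a).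
Proof.
move=> An; case: n / An h => h hA inj a0 ta ta3.
have [trE nz] := trace_conjugates hA inj; split.
- by have [i hi] := nz a a0; apply: contraNneq hi => /rowP/(_ i); rewrite !mxE => ->.
- rewrite -[RHS](rmorph0 iota) -ta trE.
  by apply: eq_bigr => i _; rewrite mxE.
rewrite -[RHS](rmorph0 iota) -ta3 trE.
by apply: eq_bigr => i _; rewrite mxE rmorphXn.
Qed.

Section ConjugateForm.

Variables (F : fieldType) (K E : fieldExtType F) (L : comNzRingType) (n : nat).
Variables (f : {rmorphism F -> L}) (s : 'I_n -> {rmorphism E -> L}).
Implicit Types a : tensor K E.

(* Multiplication on K by the i-th conjugate of a, where s i acts on E. *)
Definition conjugate_matrix a (i : 'I_n) : 'M[L]_(\dim {:K}) :=
  \sum_(k < \dim {:E}) s i (vbasis {:E})`_k *: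
    map_mx f (passmx.mxof (vbasis {:K}) (vbasis {:K}) (amull (a 0 k))).

Lemma conjugate_form_equivariant (act : {rmorphism L -> L}) (g : 'S_n) a :
    (forall c, act (f c) = f c) -> (forall i x, act (s i x) = s (g i) x) ->
  map_mpoly act (norm_form (conjugate_matrix a)) = msym g^-1 (norm_form (conjugate_matrix a)).
Proof.
move=> actf acts; rewrite map_norm_form msym_norm_form /norm_form.
congr (\det _); apply/matrixP => u v; rewrite !mxE; congr lform; apply/rowP => i; rewrite !mxE.
rewrite !summxE rmorph_sum; apply: eq_bigr => k _.
by rewrite !mxE rmorphM actf acts.
Qed.

(** Over W, the matrix B of [conjugates_diagonalize] for K over F diagonalises all multiplications
    by elements of K at once, with their images under the tau j as eigenvalues. *)
Lemma conjugate_form_split (W : fieldType) (phi : {rmorphism L -> W})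
    (tau : 'I_(\dim {:K}) -> {rmorphism K -> W}) (z : K)
    (h : 'I_(\dim {:K}) -> 'I_n -> {rmorphism tensor K E -> W}) a :
    (forall j c, tau j c%:A = phi (f c)) -> injective (fun j => tau j z) ->
    (forall j i c, h j i c%:A = tau j c) -> (forall j i x, h j i (tensor_inr K x) = phi (s i x)) ->
  map_mpoly phi (norm_form (conjugate_matrix a)) = \prod_j lform (\row_i h j i a).
Proof.
move=> tauA tau_inj hA hE.
have [B [Bu _ TB]] := conjugates_diagonalize (iota := phi \o f) tauA tau_inj.
rewrite map_norm_form; apply: (norm_form_diag (B := B)).
  by rewrite -unitfE -unitmxE.
move=> i; rewrite raddf_sum /= mulmx_suml.
transitivity (\sum_(k < \dim {:E}) phi (s i (vbasis {:E})`_k) *: (B *m diag_mx (\row_j tau j (a 0 k)))).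
  apply: eq_bigr => k _; rewrite -TB scalemxAl; congr (_ *m _).
  by apply/matrixP => u v; rewrite !mxE rmorphM.
under eq_bigr do rewrite scalemxAr.
rewrite -mulmx_sumr; congr (_ *m _).
apply/matrixP => u v; rewrite summxE !mxE.
rewrite [in RHS](tensor_sumE a) rmorph_sum -sumrMnl; apply: eq_bigr => k _.
rewrite !mxE mulrnAr; congr (_ *+ _).
by rewrite -mulr_algl rmorphM hA hE mulrC.
Qed.

End ConjugateForm.

(** * Absence of nonzero elements with vanishing traces *)

Section Main.

Variables m k1 k2 k3 : nat.
Hypotheses (lt21 : (k2 < k1)%N) (lt32 : (k3 < k2)%N).
Local Notation n := m.+1.
Hypothesis nE : n = (3 ^ k1 + 3 ^ k2 + 3 ^ k3)%N.

(** The case of a single point: W is K, Phi is the linear form of the conjugates of a, and 3 would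
    divide 1. *)
Lemma no_isotropic_En : ~ exists delta : En n,
  [/\ delta != 0, trace delta = 0 & trace (delta ^+ 3) = 0].
Proof.
move=> [a [a0 ta ta3]]; have [K [psi key]] := no_prime_to_3_point lt21 lt32 nE.
have [x xE] := conj_En_generator m.
pose h (i : 'I_n) : {rmorphism En n -> K} := psi \o conj_En i.
pose f : {rmorphism Fn n -> K} := psi \o (@fixed_val _ _ _ _ : {rmorphism Fn n -> ratfun n}).
have hA i (c : Fn n) : h i c%:A = f c := congr1 psi (conj_En_scalar i c).
have hx i : h i x = psi (var i) := congr1 psi (xE i).
have inj : injective (fun i => h i x).
  move=> i j e; apply/var_inj/(fmorph_inj psi).
  exact: etrans (esym (hx i)) (etrans e (hx j)).
have iso := isotropic_conjugates (dim_En (ltn0Sn m)) hA inj a0 ta ta3.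
suff: (3 %| 1)%N by [].
apply: (key K (idfun : {rmorphism K -> K}) (lform (\row_i conj_En i a)) [:: \row_i h i a]).
- move=> s; rewrite map_lform msym_lform invgK; congr lform.
  by apply/rowP => i; rewrite !mxE /= conj_En_act.
- by move=> v; rewrite inE => /eqP ->.
rewrite big_seq1 map_lform; congr lform.
by apply/rowP => i; rewrite !mxE.
Qed.

(** The maps h j i, equal to tau j on F' and to the i-th conjugation on E_n, come from
    [tensor_univ]. For fixed j they are separated by x_1, so that the conjugates of a form an
    isotropic vector P j. The product of the forms of the P j is a norm form with coefficients in
    L_n, and 3 would divide the degree of F'. *)
Lemma no_isotropic_tensor (F' : fieldExtType (Fn n)) : coprime (\dim {:F'}) 3 ->
  ~ exists delta : tensor F' (En n),
      [/\ delta != 0, trace delta = 0 & trace (delta ^+ 3) = 0].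
Proof.
move=> cop [a [a0 ta ta3]]; have [K [psi key]] := no_prime_to_3_point lt21 lt32 nE.
have [x xE] := conj_En_generator m.
pose g0 : {rmorphism Fn n -> ratfun n} := @fixed_val _ _ _ _.
pose f : {rmorphism Fn n -> K} := psi \o g0.
have [W [iota [tau [z [tauA tau_inj]]]]] := conjugate_embeddings F' f (@pchar_Fn m).
pose g (i : 'I_n) : {rmorphism En n -> W} := iota \o (psi \o conj_En i).
have gA i (c : Fn n) : g i c%:A = iota (f c) :=
  congr1 (iota \o psi) (conj_En_scalar i c).
have gx i : g i x = iota (psi (var i)) := congr1 (iota \o psi) (xE i).
have compat j i c : tau j c%:A = g i c%:A by rewrite tauA gA.
have hex (j : 'I_(\dim {:F'})) (i : 'I_n) : exists h : {rmorphism tensor F' (En n) -> W},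
    (forall c, h c%:A = tau j c) /\ (forall y, h (tensor_inr F' y) = g i y).
  by have [h [h1 h2 _]] := tensor_univ (compat j i); exists h.
have [h hP] := fin_all_exists (fun j => fin_all_exists (hex j)).
pose P (j : 'I_(\dim {:F'})) := \row_i h j i a.
have dimA : \dim {:tensor F' (En n)} = n.
  by rewrite dimvf /= -[RHS](dim_En (ltn0Sn m)); exact: mul1n.
have hA j i : forall c, h j i c%:A = tau j c := proj1 (hP j i).
have hx j i : h j i (tensor_inr F' x) = iota (psi (var i)) := etrans (proj2 (hP j i) x) (gx i).
have inj j : injective (fun i => h j i (tensor_inr F' x)).
  move=> i i' e; apply/var_inj/(fmorph_inj psi)/(fmorph_inj iota).
  exact: etrans (esym (hx j i)) (etrans e (hx j i')).
have iso j : isotropic (P j) := isotropic_conjugates dimA (hA j) (@inj j) a0 ta ta3.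
suff: (3 %| size [seq P j | j <- enum 'I_(\dim {:F'})])%N.
  by rewrite size_map size_enum_ord; apply/negP; rewrite -prime_coprime // coprime_sym.
apply: (key W iota (norm_form (conjugate_matrix g0 (@conj_En m) a))).
- move=> s; apply: conjugate_form_equivariant; last exact: conj_En_act.
  by move=> c; apply: (fixed_actE (act := @ratfun_aut n)); rewrite inE.
- by move=> _ /mapP[j _ ->].
rewrite big_map big_enum; exact (conjugate_form_split (phi := iota \o psi) a tauA tau_inj hA (fun j i => proj2 (hP j i))).
Qed.

End Main.

Theorem theorem3p1 (n k1 k2 k3 : nat)
    (hk12 : (k2 < k1)%N) (hk23 : (k3 < k2)%N)
    (hn : n = (3 ^ k1 + 3 ^ k2 + 3 ^ k3)%N) :
  (forall F' : fieldExtType (Fn n), coprime (\dim {:F'}) 3 ->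
     ~ exists delta : tensor F' (En n),
         [/\ delta != 0, trace delta = 0 & trace (delta ^+ 3) = 0])
  /\
  ~ exists delta : En n,
      [/\ delta != 0, trace delta = 0 & trace (delta ^+ 3) = 0].
Proof.
case: n hn => [|m] nE.
  by move/eqP: nE; rewrite eq_sym !addn_eq0 !expn_eq0.
split; first exact: (no_isotropic_tensor hk12 hk23 nE).
exact: (no_isotropic_En hk12 hk23 nE).
Qed.
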